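(* Let $1\leq p,q\leq\infty$ (if $p=1$, only $q=1$ is considered). Then there exists a non-constant function $f\in L^{p,q}(\mathbb{R}^{n})$ such that $\mathcal{M}f=f$ if and only if $n\geq 3$ and one of the following holds: $$\frac{n}{n-2}<p\leq\infty,\qquad\text{or}\qquad p=\frac{n}{n-2}\ \text{ and }\ q=\infty.$$
   Context: Functions on $\mathbb{R}^n$ ($n\ge 1$) are identified when equal almost everywhere; $\mathcal{M}f=f$ is an a.e. equality, and ''non-constant'' means not a.e. equal to a constant. The centered Hardy--Littlewood maximal operator is defined on $L^1_{\rm loc}(\mathbb{R}^n)$ by $$\mathcal{M}f(x)=\sup_{r>0}\frac{1}{|B_r|}\int_{B_r}|f(x-y)|\,dy,$$ where $B_r$ is the Euclidean ball of radius $r$ centered at the origin and $|B_r|$ its Lebesgue measure. For a measurable $f$, $f^*$ denotes its non-increasing rearrangement, i.e. the non-increasing, right-continuous function on $[0,\infty)$ equimeasurable with $f$. The Lorentz space $L^{p,q}(\mathbb{R}^n)$ consists of the measurable $f$ with $\int_0^\infty (t^{1/p}f^*(t))^q\,\frac{dt}{t}<\infty$ if $q<\infty$, and $\sup_{t>0}t^{1/p}f^*(t)<\infty$ if $q=\infty$ (with $1/\infty=0$, so $L^{\infty,\infty}=L^\infty$).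
   Formalization: When p = ∞ only q = ∞ is considered: for q < ∞ the space L^{∞,q} as defined contains only 0, so for n ≥ 3 the stated equivalence fails there (the right side holds, but no non-constant f exists). *)

(* Defs.v *)
From HB Require Import structures.
From mathcomp Require Import all_boot all_order all_algebra.
From mathcomp Require Import all_classical all_reals all_analysis.

Set Implicit Arguments.
Unset Strict Implicit.
Unset Printing Implicit Defensive.

Import Order.TTheory GRing.Theory Num.Theory.
Import numFieldNormedType.Exports.

Local Open Scope classical_set_scope.
Local Open Scope ring_scope.

(* R^n is [n.-tuple R] with the library's product sigma-algebra (the Borel
   one).  Lebesgue measure on R^n is the n-fold iterated product of
   [lebesgue_measure], transported along (x, y) |-> x :: y; [lebesgue_nd_box]
   below is its characterisation on boxes. *)
Section lebesgue_nd.
Context {R : realType}.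
Local Open Scope ereal_scope.

Definition tcons n (x : measurableTypeR R * n.-tuple R) : n.+1.-tuple R :=
  [tuple of (x.1 : R) :: x.2].

Fixpoint lebesgue_nd n : set (n.-tuple R) -> \bar R :=
  match n with
  | 0 => \d_([tuple] : 0.-tuple R)
  | n'.+1 => pushforward (@lebesgue_measure R \x @lebesgue_nd n') (@tcons n')
  end.

Lemma measurable_tcons n : measurable_fun setT (@tcons n).
Proof.
apply: (@measurable_cons _ _ _ R
  (fun x : measurableTypeR R * n.-tuple R => x.1 : R) n snd).
- exact: measurable_fst.
- exact: measurable_snd.
Qed.

Lemma tcons_surj n (t : n.+1.-tuple R) : exists x, tcons x = t.
Proof.
exists (thead t, [tuple of behead t]).
by rewrite [RHS]tuple_eta; apply/val_inj.
Qed.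

Lemma measurable_tcons_pre n (A : set (n.+1.-tuple R)) :
  measurable A -> measurable (@tcons n @^-1` A).
Proof. by move=> mA; rewrite -[X in measurable X]setTI; exact: measurable_tcons. Qed.

Lemma tcons_preimage n (B : set R) (C : set (n.-tuple R)) :
  @tcons n @^-1` [set t | B (thead t) /\ C [tuple of behead t]] = B `*` C.
Proof.
have E (x : measurableTypeR R) y : [tuple of behead (tcons (x, y))] = y.
  by apply/val_inj.
by apply/seteqP; split => -[x y]; rewrite /= E.
Qed.

Lemma measurable_box_cons n (B : set R) (C : set (n.-tuple R)) :
  measurable B -> measurable C ->
  measurable [set t : n.+1.-tuple R | B (thead t) /\ C [tuple of behead t]].
Proof.
move=> mB mC.
rewrite (_ : [set _ | _] = (fun t : n.+1.-tuple R => tnth t ord0) @^-1` B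
   `&` (fun t : n.+1.-tuple R => [tuple of behead t]) @^-1` C)//.
apply: measurableI; rewrite -[X in measurable X]setTI.
  exact: measurable_tnth.
exact: measurable_behead.
Qed.

Section step.
Variables (n : nat) (m : {sigma_finite_measure set (n.-tuple R) -> \bar R}).

Definition lebesgue_step : set (n.+1.-tuple R) -> \bar R :=
  pushforward (@lebesgue_measure R \x m) (@tcons n).

Let step0 : lebesgue_step set0 = 0.
Proof. by rewrite /lebesgue_step /pushforward preimage_set0 measure0. Qed.

Let step_ge0 A : 0 <= lebesgue_step A.
Proof. by rewrite /lebesgue_step /pushforward; exact: measure_ge0. Qed.

Let step_sigma_additive : semi_sigma_additive lebesgue_step.
Proof.
move=> F mF tF mUF; rewrite /lebesgue_step /pushforward preimage_bigcup.
apply: measure_semi_sigma_additive.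
- by move=> k; exact: measurable_tcons_pre.
- apply/trivIsetP => /= i j _ _ ij; rewrite -preimage_setI.
  by move/trivIsetP : tF => /(_ _ _ _ _ ij) ->//; rewrite preimage_set0.
- by rewrite -preimage_bigcup; exact: measurable_tcons_pre.
Qed.

HB.instance Definition _ := isMeasure.Build _ _ _ lebesgue_step
  step0 step_ge0 step_sigma_additive.

Let step_sigma_finite : sigma_finite setT lebesgue_step.
Proof.
have /sigma_finiteP[F [TF ndF Foo]] := @sigma_finiteT _ _ _ (@lebesgue_measure R).
have /sigma_finiteP[G [TG ndG Goo]] := @sigma_finiteT _ _ _ m.
exists (fun k => [set t | F k (thead t) /\ G k [tuple of behead t]]).
  apply/esym/seteqP; split=> // t _.
  have [i _ Fi] : (\bigcup_i F i) (thead t) by rewrite -TF.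
  have [j _ Gj] : (\bigcup_i G i) [tuple of behead t] by rewrite -TG.
  exists (maxn i j) => //; split.
    by move: Fi; exact/subsetPset/ndF/leq_maxl.
  by move: Gj; exact/subsetPset/ndG/leq_maxr.
move=> k; have [mF Fk] := Foo k; have [mG Gk] := Goo k.
split; first exact: measurable_box_cons.
rewrite /lebesgue_step /pushforward tcons_preimage product_measure1E//.
by rewrite lte_mul_pinfty// ge0_fin_numE.
Qed.

HB.instance Definition _ := Measure_isSigmaFinite.Build _ _ _ lebesgue_step
  step_sigma_finite.

End step.

Lemma lebesgue_nd_sigma_finite_measure n :
  exists m : {sigma_finite_measure set (n.-tuple R) -> \bar R},
    m = @lebesgue_nd n :> (set (n.-tuple R) -> \bar R).
Proof.
elim: n => [|n [m mE]].
  by exists [the {sigma_finite_measure set _ -> \bar R} of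
    @dirac _ (0.-tuple R) [tuple] R].
exists [the {sigma_finite_measure set _ -> \bar R} of lebesgue_step m].
by rewrite /= /lebesgue_step mE.
Qed.

Section instances.
Variable n : nat.

Let nd0 : @lebesgue_nd n set0 = 0.
Proof. by have [m <-] := lebesgue_nd_sigma_finite_measure n; exact: measure0. Qed.

Let nd_ge0 A : 0 <= @lebesgue_nd n A.
Proof. by have [m <-] := lebesgue_nd_sigma_finite_measure n; exact: measure_ge0. Qed.

Let nd_sigma_additive : semi_sigma_additive (@lebesgue_nd n).
Proof.
have [m <-] := lebesgue_nd_sigma_finite_measure n.
exact: measure_semi_sigma_additive.
Qed.

HB.instance Definition _ := isMeasure.Build _ _ _ (@lebesgue_nd n)
  nd0 nd_ge0 nd_sigma_additive.

Let nd_sigma_finite : sigma_finite setT (@lebesgue_nd n).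
Proof.
by have [m <-] := lebesgue_nd_sigma_finite_measure n; exact: sigma_finiteT.
Qed.

HB.instance Definition _ := Measure_isSigmaFinite.Build _ _ _ (@lebesgue_nd n)
  nd_sigma_finite.

End instances.

Lemma lebesgue_nd_box n (a b : 'I_n -> R) : (forall i, a i <= b i)%R ->
  measurable [set x : n.-tuple R | forall i, (a i < tnth x i <= b i)%R] /\
  lebesgue_nd [set x : n.-tuple R | forall i, (a i < tnth x i <= b i)%R] =
  (\prod_(i < n) (b i - a i))%:E.
Proof.
elim: n a b => [a b _|n IH a b ab].
  rewrite (_ : [set _ | _] = setT); last by apply/seteqP; split=> // x _ [].
  by rewrite big_ord0 /= diracT.
pose C := [set x : n.-tuple R |
  forall i, (a (lift ord0 i) < tnth x i <= b (lift ord0 i))%R].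
have [mC CE] : measurable C /\
    lebesgue_nd C = (\prod_(i < n) (b (lift ord0 i) - a (lift ord0 i)))%:E.
  by apply: IH => i; exact: ab.
have -> : [set x : n.+1.-tuple R | forall i, (a i < tnth x i <= b i)%R] =
    [set t | `]a ord0, b ord0]%classic (thead t) /\ C [tuple of behead t]].
  apply/seteqP; split=> t /= h.
    split; first by rewrite /= in_itv/=; exact: h.
    by move=> i /=; have := h (lift ord0 i); rewrite [in X in X -> _](tuple_eta t) tnthS.
  move: h => [h0 hi] i; case: (unliftP ord0 i) => [j ->|->].
    by have := hi j; rewrite [in X in _ -> X](tuple_eta t) tnthS.
  by move: h0; rewrite in_itv.
split; first by apply: measurable_box_cons => //; exact: measurable_itv.
transitivity ((@lebesgue_measure R \x @lebesgue_nd n)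
    (`]a ord0, b ord0]%classic `*` C)); first by rewrite -tcons_preimage.
have mB : measurable (`]a ord0, b ord0]%classic : set R) by exact: measurable_itv.
transitivity (@lebesgue_measure R `]a ord0, b ord0]%classic * lebesgue_nd C).
  exact: product_measure1E.
rewrite CE big_ord_recl EFinM; congr (_ * _).
by rewrite lebesgue_measure_itv/= lte_fin; case: ltP => // h;
  rewrite (@le_anti _ _ (a ord0) (b ord0)) ?subrr// h ab.
Qed.

End lebesgue_nd.

Section maximal.
Context {R : realType} {n : nat}.
Implicit Types (x y : n.-tuple R) (f : n.-tuple R -> R).

Definition tsub x y : n.-tuple R := [tuple tnth x i - tnth y i | i < n].

Definition eball (r : R) : set (n.-tuple R) :=
  [set y | Num.sqrt (\sum_(i < n) tnth y i ^+ 2) < r].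

(* Total: the formula is meaningful (possibly +oo) for every measurable f, in
   particular for every locally integrable one. *)
Definition maximal f x : \bar R :=
  ereal_sup [set ((lebesgue_nd (eball r))^-1 *
    \int[@lebesgue_nd R n]_(y in eball r) `|f (tsub x y)|%:E)%E | r in `]0, +oo[].

End maximal.

Section rearrangement.
Context d (T : measurableType d) (R : realType).
Local Open Scope ereal_scope.

Definition distribution_function (mu : set T -> \bar R) (f : T -> R) (s : R) :=
  mu [set x | (s < `|f x|)%R].

Definition rearrangement (mu : set T -> \bar R) (f : T -> R) (t : R) : \bar R :=
  ereal_inf [set s%:E | s in
    [set s | (0 <= s)%R /\ distribution_function mu f s <= t%:E]].

(* [g], on [0, +oo[, is a non-increasing right-continuous function
   equimeasurable with f; [rearrangementP] and [rearrangement_unique] below show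
   that [rearrangement mu f] is the only such function. *)
Definition is_rearrangement (mu : set T -> \bar R) (f : T -> R) (g : R -> \bar R) :=
  [/\ forall t, (0 <= t)%R -> 0 <= g t,
      forall t u, (0 <= t <= u)%R -> g u <= g t,
      forall t, (0 <= t)%R -> g u @[u --> t^'+] --> g t &
      forall s, (0 <= s)%R ->
        @lebesgue_measure R [set t | (0 <= t)%R /\ s%:E < g t] =
        distribution_function mu f s].

Lemma rearrangement_ge0 (mu : set T -> \bar R) (f : T -> R) t :
  0 <= rearrangement mu f t.
Proof. by apply: le_ereal_inf_tmp => _ [s [s0 _] <-]; rewrite lee_fin. Qed.

Lemma ge0_lee_real (x y : \bar R) : 0 <= y ->
  (forall s : R, (0 <= s)%R -> s%:E < x -> s%:E < y) -> x <= y.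
Proof.
move=> y0 h; rewrite leNgt; apply/negP => yx.
have yf : y \is a fin_num by rewrite ge0_fin_numE// (lt_le_trans yx)// leey.
have := h (fine y); rewrite fineK// ltxx => /(_ _ yx).
by rewrite fine_ge0// => /(_ isT).
Qed.

Variables (mu : {measure set T -> \bar R}) (f : T -> R).
Hypothesis mf : measurable_fun setT f.

Let m_super s : measurable [set x | (s < `|f x|)%R].
Proof.
rewrite (_ : [set _ | _] = (fun x => `|f x|%R) @^-1` `]s, +oo[).
  rewrite -[X in measurable X]setTI.
  by apply: (measurableT_comp _ mf) => //; exact: measurable_itv.
by apply/seteqP; split=> x /=; rewrite in_itv/= andbT.
Qed.

Let df_le s u : (s <= u)%R ->
  distribution_function mu f u <= distribution_function mu f s.
Proof.
move=> su; apply: le_measure; rewrite ?inE// => x /=.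
exact: le_lt_trans.
Qed.

Let df_right s (t : R) : t%:E < distribution_function mu f s ->
  exists2 u : R, (s < u)%R & t%:E < distribution_function mu f u.
Proof.
move=> ts.
pose F k := [set x | (s + k.+1%:R^-1 < `|f x|)%R].
have FU : \bigcup_k F k = [set x | (s < `|f x|)%R].
  apply/seteqP; split=> x /=.
    by move=> [k _]; apply: le_lt_trans; rewrite lerDl.
  move=> sx; have : (0 < `|f x| - s)%R by rewrite subr_gt0.
  move=> /ltr_add_invr[k]; rewrite add0r => hk; exists k => //=.
  by rewrite /F/= addrC -ltrBrDr.
have cF : mu \o F @ \oo --> distribution_function mu f s.
  rewrite /distribution_function -FU; apply: nondecreasing_cvg_mu.
  - by move=> k; exact: m_super.
  - by rewrite FU.
  - move=> k l kl; apply/subsetPset => x /=; apply: le_lt_trans.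
    by rewrite lerD2l lef_pV2 ?posrE// ler_nat.
have [k _ hk] : exists2 k, True & t%:E < mu (F k).
  apply: contrapT => nk.
  have : distribution_function mu f s <= t%:E.
    rewrite -(cvg_lim _ cF)//; apply: lime_le; first by apply/cvg_ex; eexists; exact: cF.
    by apply: nearW => k; rewrite leNgt; apply/negP => tk; apply: nk; exists k.
  by rewrite leNgt ts.
by exists (s + k.+1%:R^-1)%R => //; rewrite ltrDl.
Qed.

Lemma lt_rearrangement (s t : R) : (0 <= s)%R ->
  (s%:E < rearrangement mu f t) = (t%:E < distribution_function mu f s).
Proof.
move=> s0; apply/idP/idP; last first.
  move=> /df_right[u su tu]; rewrite (@lt_le_trans _ _ u%:E) ?lte_fin//.
  apply: le_ereal_inf_tmp => _ [v [v0 vt] <-]; rewrite lee_fin leNgt.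
  apply/negP => vu; have := lt_le_trans tu (df_le (ltW vu)).
  by rewrite ltNge vt.
rewrite !ltNge; apply: contra => ds; apply: ereal_inf_lbound.
by exists s.
Qed.

Lemma rearrangementP : is_rearrangement mu f (rearrangement mu f).
Proof.
have ni t u : (t <= u)%R -> rearrangement mu f u <= rearrangement mu f t.
  move=> tu; apply: ereal_inf_le_tmp => _ [s [s0 st] <-]; exists s => //.
  by split=> //; rewrite (le_trans st)// lee_fin.
split.
- by move=> t _; exact: rearrangement_ge0.
- by move=> t u /andP[_]; exact: ni.
- move=> t t0.
  have := @nonincreasing_at_right_cvge R (rearrangement mu f) t (BInfty _ false).
  move=> /(_ isT)/(_ (fun x y _ _ => @ni x y)).
  set l := ereal_sup _; suff -> : l = rearrangement mu f t by [].
  apply/eqP; rewrite eq_le; apply/andP; split.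
    apply: ge_ereal_sup => _ [u /= + <-]; rewrite in_itv/= andbT => tu.
    exact/ni/ltW.
  have l0 : 0 <= l.
    apply: (@le_trans _ _ (rearrangement mu f (t + 1))).
      exact: rearrangement_ge0.
    by apply: ereal_sup_ubound; exists (t + 1)%R => //=; rewrite in_itv/= andbT ltrDl.
  apply: ge0_lee_real => // s s0; rewrite lt_rearrangement// => td.
  have [u tu ud] : exists2 u : R, (t < u)%R & u%:E < distribution_function mu f s.
    case: (distribution_function mu f s) td => [r| |]//.
      rewrite lte_fin => tr; exists ((t + r) / 2)%R; first exact: (midf_lt tr).1.
      by rewrite lte_fin (midf_lt tr).2.
    by move=> _; exists (t + 1)%R; rewrite ?ltrDl ?ltry.
  rewrite (@lt_le_trans _ _ (rearrangement mu f u)) ?lt_rearrangement//.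
  by apply: ereal_sup_ubound; exists u => //=; rewrite in_itv/= andbT.
- move=> s s0; have : 0 <= distribution_function mu f s by exact: measure_ge0.
  under eq_set do rewrite lt_rearrangement//.
  case: (distribution_function mu f s) => [r| |]//; rewrite ?lee_fin => r0.
    rewrite (_ : [set _ | _] = `[0%R, r[%classic).
      rewrite lebesgue_measure_itv/= lte_fin; case: ltP => rle; first by rewrite sube0.
      by rewrite (@le_anti _ _ r 0%R)// r0 rle.
    by apply/seteqP; split=> t /=; rewrite in_itv/= lte_fin => /andP.
  rewrite (_ : [set _ | _] = `[0%R, +oo[%classic).
    by rewrite lebesgue_measure_itv/= ?ltry ?sube0.
  by apply/seteqP; split=> t /=; rewrite in_itv/= andbT ltry// => -[].
Qed.

Lemma rearrangement_unique (g : R -> \bar R) : is_rearrangement mu f g ->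
  forall t, (0 <= t)%R -> g t = rearrangement mu f t.
Proof.
move=> [g0 gni gc ge] t t0.
have gE s : (0 <= s)%R -> (s%:E < g t) = (t%:E < distribution_function mu f s).
  move=> s0; rewrite -ge//; set G := [set _ | _].
  have mG : measurable G.
    suff /is_intervalP -> : is_interval G by exact: (@measurable_itv R).
    move=> a b /= [a0 sa] [b0 sb] c /andP[ac cb].
    have c0 := le_trans a0 ac.
    by split => //; apply: (lt_le_trans sb); apply: gni; rewrite c0.
  have mI (i : interval R) : measurable ([set` i] : set R) by exact: measurable_itv.
  have le_leb (A B : set R) : measurable A -> measurable B -> A `<=` B ->
      @lebesgue_measure R A <= @lebesgue_measure R B.
    by move=> mA mB AB; apply: (@le_measure _ _ _ (@lebesgue_measure R)) => //;
      exact: mem_set.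
  apply/idP/idP => h.
    have [u tu su] : exists2 u, (t < u)%R & s%:E < g u.
      have : \forall u \near t^'+, s%:E < g u by
        apply: (gc t t0 [set y | s%:E < y]); exact: open_ereal_gt'.
      move=> H; near t^'+ => u; exists u; first by near: u; exact: nbhs_right_gt.
      by near: u.
    rewrite (@lt_le_trans _ _ u%:E) ?lte_fin//.
    have <- : @lebesgue_measure R `[0%R, u[%classic = u%:E.
      by rewrite lebesgue_measure_itv/= lte_fin (le_lt_trans t0 tu) sube0.
    apply: le_leb; [exact: mI|exact: mG|].
    move=> v /=; rewrite in_itv/= => /andP[v0 vu]; split=> //.
    by apply: (lt_le_trans su); apply: gni; rewrite v0 ltW.
  rewrite ltNge; apply: contraTN h => gs; rewrite -leNgt.
  have <- : @lebesgue_measure R `[0%R, t]%classic = t%:E.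
    rewrite lebesgue_measure_itv/= lte_fin; case: ltP => [_|t0']; first by rewrite sube0.
    by rewrite (@le_anti _ _ t 0%R)// t0 t0'.
  apply: le_leb; [exact: mG|exact: mI|].
  move=> v /= [v0 sv]; rewrite in_itv/= v0 leNgt; apply/negP => tv.
  have := gni t v; rewrite t0 ltW// => /(_ isT) gvt.
  by have := le_lt_trans (le_trans gvt gs) sv; rewrite ltxx.
apply/eqP; rewrite eq_le; apply/andP; split; apply: ge0_lee_real => //.
- exact: rearrangement_ge0.
- by move=> s s0; rewrite gE// lt_rearrangement.
- exact: g0.
- by move=> s s0; rewrite gE// lt_rearrangement.
Unshelve. all: by end_near. Qed.

End rearrangement.

Section lorentz.
Context {R : realType} {n : nat}.
Implicit Types (p q : \bar R) (f : n.-tuple R -> R).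
Local Open Scope ereal_scope.

(* [fine p^-1] is the real number 1/p, with 1/+oo = 0. *)
Definition in_lorentz p q f : Prop :=
  let fstar := rearrangement (@lebesgue_nd R n) f in
  measurable_fun setT f /\
  match q with
  | r%:E => \int[@lebesgue_measure R]_(t in `]0%R, +oo[)
      (((t `^ fine p^-1)%:E * fstar t) `^ r * (t^-1)%:E) < +oo
  | +oo => ereal_sup
      [set (t `^ fine p^-1)%:E * fstar t | t in `]0%R, +oo[] < +oo
  | -oo => False
  end.

Definition ae_constant f : Prop :=
  exists c : R, {ae @lebesgue_nd R n, forall x, f x = c}.

End lorentz.

(* Main.v *)
Require Import Defs.
From mathcomp Require Import all_boot all_order all_algebra.
From mathcomp Require Import all_classical all_reals all_analysis.
From mathcomp Require Import measurable_realfun ring lra.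

(** If Mf = f almost everywhere, then f is almost everywhere nonnegative and
    g = |f| satisfies [bavg r g x <= g x] for almost every x and all r > 0,
    where [bavg r] is the average over the ball of radius r: g is superharmonic
    in the sense of means ([supersol]).  Conversely, a smooth nonnegative
    function whose ball averages never exceed its value is a fixed point.  The
    question is therefore which Lorentz spaces contain a nonconstant nonnegative
    superharmonic function, and the Newtonian decay |x|^(2 - n) decides it.

    Existence.  For n >= 3 the function (1 + |x|^2)^(-(n - 2) / 2)
    ([newton_profile]) has a negative Laplacian, so it is a fixed point
    ([maximal_newton]).  Its rearrangement is at most
    min (1, C t^(-(n - 2) / n)) ([rearrangement_newton]), which puts it in every
    space of the statement.

    Non-existence.  Averaging over balls is self-adjoint ([integral_bavgC]).
    If u >= 0 satisfies u + k2 <= bavg r u + k1, integrating against g gives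
    int k2 g + int u (g - bavg r g) <= int k1 g ([supersol_test]), which plays
    the part of int g Delta u <= 0.  Two families of u are used.
    - For n <= 2, u = (1 - a ln (1 + |x|^2))_+^3.  It tends to 1 as a tends to
      0, while its Laplacian is at least - 12 a (1 + |x|^2)^(-2).  In the limit
      g = bavg r g almost everywhere; as large balls about two points almost
      coincide, g is constant ([supersol_constant]).
    - For n >= 3, u = (2 - (1 + |x|^2)^(-(n - 2) / 2) - |x|^2 / rho^2)_+^3.  Its
      Laplacian is bounded below by a positive constant near the origin and by
      - C / rho^2 elsewhere, and its support lies in the ball of radius 2 rho.
      So the integral of g over that ball is at least c rho^2
      ([supersol_ball_growth]), and comparison with the average over a ball
      about x gives g x >= c |x|^(2 - n) far out ([supersol_lower_bound]).  The
      rearrangement is then at least C t^(-(n - 2) / n) for large t, which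
      excludes all the other spaces ([not_lorentz_weak],
      [not_lorentz_strong]).

    Everything rests on comparing a radial function u with its ball averages
    through its Laplacian ([mean_value_ge]).  The mean over |y| < r of
    u (x - tau y) is differentiated in tau, and an integration by parts in each
    coordinate y_i against (r^2 - |y|^2) / 2, which vanishes on the sphere,
    turns the derivative into a positively weighted integral of the Laplacian.
    This takes only Tonelli's theorem with the coordinate y_i innermost
    ([integral_ndS_insert]) and the fundamental theorem of calculus on the line
    ([integral_eball_slice0]). *)

Set Implicit Arguments.
Unset Strict Implicit.
Unset Printing Implicit Defensive.

Import Order.TTheory GRing.Theory Num.Theory.
Import numFieldNormedType.Exports.
Local Open Scope classical_set_scope.
Local Open Scope ring_scope.
Local Open Scope ereal_scope.

(** * Tonelli on tuples with any coordinate innermost *)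

Section tuple_integration.
Context {R : realType}.
Local Notation leb := (@lebesgue_measure R).
Local Notation nd n := (@lebesgue_nd R n).

Lemma integral_ndS n (h : n.+1.-tuple R -> \bar R) :
  measurable_fun setT h -> (forall x, 0 <= h x) ->
  \int[nd n.+1]_x h x = \int[leb]_t \int[nd n]_z h (tcons (t, z)).
Proof.
move=> mh h0.
transitivity (\int[pushforward (leb \x nd n) (@tcons R n)]_x h x).
  by [].
rewrite (ge0_integral_pushforward (@measurable_tcons R n))//.
rewrite preimage_setT fubini_tonelli1//; last by move=> x; exact: h0.
exact: (measurableT_comp mh (@measurable_tcons R n)).
Qed.

Definition tinsert n (i : 'I_n.+1) (t : R) (z : n.-tuple R) : n.+1.-tuple R :=
  [tuple if unlift i j is Some k then tnth z k else t | j < n.+1].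

Lemma tnth_tinsert_eq n (i : 'I_n.+1) (t : R) (z : n.-tuple R) :
  tnth (tinsert i t z) i = t.
Proof. by rewrite tnth_mktuple unlift_none. Qed.

Lemma tnth_tinsert_lift n (i : 'I_n.+1) (t : R) (z : n.-tuple R) k :
  tnth (tinsert i t z) (lift i k) = tnth z k.
Proof. by rewrite tnth_mktuple liftK. Qed.

Lemma tnth_tcons_lift n (s : R) (z : n.-tuple R) k :
  tnth (tcons (s, z)) (lift ord0 k) = tnth z k.
Proof. by rewrite tnthS. Qed.

Lemma tinsert0 n (t : R) (z : n.-tuple R) : tinsert ord0 t z = tcons (t, z).
Proof.
apply: eq_from_tnth => j; case: (unliftP ord0 j) => [k ->|->].
  by rewrite tnth_tinsert_lift tnth_tcons_lift.
by rewrite tnth_tinsert_eq.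
Qed.

Lemma tinsert_lift n (i : 'I_n.+1) (t s : R) (z : n.-tuple R) :
  tinsert (lift ord0 i) t (tcons (s, z)) = tcons (s, tinsert i t z).
Proof.
apply: eq_from_tnth => j; case: (unliftP (lift ord0 i) j) => [k ->|->].
  rewrite tnth_tinsert_lift.
  case: (unliftP ord0 k) => [l ->|->]; last first.
    by rewrite (_ : lift (lift ord0 i) ord0 = ord0)//; apply: val_inj.
  rewrite tnth_tcons_lift.
  rewrite (_ : lift (lift ord0 i) (lift ord0 l) = lift ord0 (lift i l)).
    by rewrite tnth_tcons_lift tnth_tinsert_lift.
  by apply: val_inj; rewrite /= !/bump /= !add1n ltnS addnS.
by rewrite tnth_tinsert_eq tnth_tcons_lift tnth_tinsert_eq.
Qed.

Lemma measurable_mktuple d (T : measurableType d) n (f : 'I_n -> T -> R) :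
  (forall i, measurable_fun setT (f i)) ->
  measurable_fun setT (fun x => [tuple f i x | i < n]).
Proof.
move=> mf; apply/measurable_fun_tnthP => i.
by apply: (eq_measurable_fun (f i)) => // x _; rewrite /= tnth_mktuple.
Qed.

Lemma measurable_tinsert n (i : 'I_n.+1) :
  measurable_fun setT
    (fun x : measurableTypeR R * n.-tuple R => tinsert i x.1 x.2).
Proof.
apply: measurable_mktuple => j; case: (unliftP i j) => [k _|_].
  apply: (measurableT_comp (measurable_tnth k)); exact: measurable_snd.
exact: measurable_fst.
Qed.

(** By induction on the dimension: the head coordinate is set aside, the
    induction hypothesis moves the chosen coordinate innermost in the tail, and
    the head is put back among the outer coordinates.  This does the work of the
    invariance of the measure under permutations of coordinates. *)
Lemma integral_ndS_insert n (i : 'I_n.+1) (h : n.+1.-tuple R -> \bar R) :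
  measurable_fun setT h -> (forall x, 0 <= h x) ->
  \int[nd n.+1]_x h x = \int[nd n]_z \int[leb]_t h (tinsert i t z).
Proof.
have zero m (k : m.+1.-tuple R -> \bar R) : measurable_fun setT k ->
    (forall x, 0 <= k x) ->
    \int[nd m.+1]_x k x = \int[nd m]_z \int[leb]_t k (tinsert ord0 t z).
  move=> mk k0; rewrite integral_ndS//.
  have mkt := measurableT_comp mk (@measurable_tcons R m).
  rewrite (@fubini_tonelli _ _ _ _ _ leb (nd m) _ mkt (fun x => k0 _)).
  by apply: eq_integral => z _; apply: eq_integral => t _; rewrite tinsert0.
elim: n i h => [|n IH] i h mh h0.
  by rewrite (ord1 i) zero.
case: (unliftP ord0 i) => [j ->|->]; last by rewrite zero.
pose H (z : n.+1.-tuple R) := \int[leb]_t h (tinsert (lift ord0 j) t z).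
have mH : measurable_fun setT H.
  apply: (@measurable_fun_fubini_tonelli_G _ _ _ _ _ leb
    (fun x => h (tinsert (lift ord0 j) x.1 x.2))) => //.
  exact: (measurableT_comp mh (measurable_tinsert (lift ord0 j))).
rewrite -/(H _) [RHS]integral_ndS//; last by move=> z; exact: integral_ge0.
rewrite integral_ndS//; apply: eq_integral => s _.
have mhs : measurable_fun setT (fun z : n.+1.-tuple R => h (tcons (s, z))).
  apply: (measurableT_comp mh).
  apply: (measurableT_comp (@measurable_tcons R n.+1)).
  exact: pair1_measurable.
rewrite (IH j _ mhs (fun z => h0 _)).
apply: eq_integral => z _; apply: eq_integral => t _.
by rewrite tinsert_lift.
Qed.

End tuple_integration.

(** * Affine changes of variables *)

Section affine_change.
Context {R : realType}.
Local Notation leb := (@lebesgue_measure R).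
Local Notation nd n := (@lebesgue_nd R n).

Definition affine1 (c b t : R) : measurableTypeR R := (c * t + b)%R.

Lemma measurable_affine1 (c b : R) :
  measurable_fun setT (affine1 c b : measurableTypeR R -> _).
Proof. exact: measurable_funD. Qed.

(** Both sides are measures in A, so half-open intervals suffice.  A decreasing
    map exchanges the open and the closed end, hence the two signs of c. *)
Lemma lebesgue_affine1 (c b : R) (A : set (measurableTypeR R)) : c != 0%R ->
  measurable A -> `|c|%:E * leb (affine1 c b @^-1` A) = leb A.
Proof.
move=> c0 mA.
pose m : {measure set (measurableTypeR R) -> \bar R} :=
  mscale (NngNum (normr_ge0 c)) (pushforward leb (affine1 c b)
    : {measure set (measurableTypeR R) -> \bar R}).
have := @lebesgue_measure_unique R (m (measurable_affine1 c b)).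
move=> mE; apply/esym/mE => // {A mA} _ [[u v]] _ <-.
rewrite /m /= /mscale /= /pushforward.
have [vu|uv] := leP v u.
  rewrite set_itv_ge ?preimage_set0 ?measure0 ?mule0 ?bnd_simp -?leNgt//.
rewrite lebesgue_measure_itv/= lte_fin uv.
have [clt0|cgt0|c00] := ltgtP c 0%R; last by rewrite c00 eqxx in c0.
- rewrite (_ : _ @^-1` _ = `[((v - b) / c)%R, ((u - b) / c)%R[%classic).
    rewrite lebesgue_measure_itv/= lte_fin ltr_nM2r ?invr_lt0// ltrD2r uv.
    rewrite ltr0_norm// -!EFinB -EFinM; congr EFin; field; exact: c0.
  apply/seteqP; split=> t /=; rewrite !in_itv/= /affine1 ler_ndivrMr//.
    by rewrite ltr_ndivlMr// lerBrDr ltrBlDr mulrC => /andP[-> ->].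
  by rewrite ltr_ndivlMr// lerBrDr ltrBlDr mulrC => /andP[-> ->].
- rewrite (_ : _ @^-1` _ = `]((u - b) / c)%R, ((v - b) / c)%R]%classic).
    rewrite lebesgue_measure_itv/= lte_fin ltr_pM2r ?invr_gt0// ltrD2r uv.
    rewrite gtr0_norm// -!EFinB -EFinM; congr EFin; field; exact: c0.
  apply/seteqP; split=> t /=; rewrite !in_itv/= /affine1 ltr_pdivrMr//.
    by rewrite ler_pdivlMr// lerBrDr ltrBlDr mulrC => /andP[-> ->].
  by rewrite ler_pdivlMr// lerBrDr ltrBlDr mulrC => /andP[-> ->].
Qed.

Lemma integral_affine1 (c b : R) (h : R -> \bar R) : c != 0%R ->
  measurable_fun setT h -> (forall t, 0 <= h t) ->
  \int[leb]_t h (c * t + b)%R = `|c|^-1%:E * \int[leb]_t h t.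
Proof.
move=> c0 mh h0.
pose m : {measure set (measurableTypeR R) -> \bar R} :=
  mscale (NngNum (normr_ge0 c)) (pushforward leb (affine1 c b)
    : {measure set (measurableTypeR R) -> \bar R}).
transitivity (`|c|^-1%:E * \int[m (measurable_affine1 c b)]_t h t).
  rewrite ge0_integral_mscale//= muleA -EFinM mulVf ?normr_eq0// mul1e.
  rewrite (ge0_integral_pushforward (measurable_affine1 c b))//.
congr (_ * _); apply: eq_measure_integral => A mA _ /=.
exact: lebesgue_affine1.
Qed.

Definition tlin n (c : R) (b y : n.-tuple R) : n.-tuple R :=
  [tuple (c * tnth y i + tnth b i)%R | i < n].

Lemma measurable_tlin n c (b : n.-tuple R) : measurable_fun setT (tlin c b).
Proof.
apply: measurable_mktuple => i; apply: measurable_funD => //.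
by apply: measurable_funM => //; exact: measurable_tnth.
Qed.

Lemma tlin_tcons n c (b0 t : R) (b z : n.-tuple R) :
  tlin c (tcons (b0, b)) (tcons (t, z)) = tcons ((c * t + b0)%R, tlin c b z).
Proof.
apply: eq_from_tnth => j; rewrite tnth_mktuple.
by case: (unliftP ord0 j) => [k ->|->]; rewrite ?tnth_tcons_lift ?tnth_mktuple.
Qed.

(** With c = -1 this is the change y |-> x - y, which brings the ball average to
    kernel form; with b = 0 it gives the volumes of balls. *)
Lemma integral_nd_affine n (c : R) (b : n.-tuple R) (h : n.-tuple R -> \bar R) :
  c != 0%R -> measurable_fun setT h -> (forall x, 0 <= h x) ->
  \int[nd n]_x h (tlin c b x) = (`|c| ^- n)%:E * \int[nd n]_x h x.
Proof.
move=> c0.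
elim: n b h => [|n IH] b h mh h0.
  rewrite expr0 invr1 mul1e; apply: eq_integral => x _; congr h.
  by rewrite [LHS]tuple0 [RHS]tuple0.
have mhl := measurableT_comp mh (measurable_tlin c b).
rewrite (integral_ndS mhl (fun x => h0 _)) (integral_ndS mh h0).
have [[b0 b'] bE] := tcons_surj b; rewrite -{}bE in mhl *.
have mht t : measurable_fun setT (fun z => h (tcons (t, z))).
  apply: (measurableT_comp mh).
  apply: (measurableT_comp (@measurable_tcons R n)).
  exact: pair1_measurable.
pose G t := \int[nd n]_z h (tcons (t, z)).
have mG : measurable_fun setT G.
  apply: (@measurable_fun_fubini_tonelli_F _ _ _ _ _ (nd n)
    (fun x => h (tcons x))) => //.
  exact: (measurableT_comp mh (@measurable_tcons R n)).
have G0 t : 0 <= G t by apply: integral_ge0.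
transitivity (\int[leb]_t ((`|c| ^- n)%:E * G (c * t + b0)%R)).
  apply: eq_integral => t _.
  rewrite /G -(IH b' _ (mht _) (fun z => h0 _)).
  by apply: eq_integral => z _ /=; rewrite tlin_tcons.
rewrite ge0_integralZl//; last first.
  apply: (measurableT_comp mG); exact: (measurable_affine1 c b0).
rewrite (integral_affine1 _ c0 mG G0) muleA -EFinM -invfM -exprSr.
by [].
Qed.

End affine_change.

(** * Euclidean norm, balls and ball averages *)

Section euclid.
Context {R : realType} {n : nat}.
Implicit Types x y z : n.-tuple R.
Local Notation nd := (@lebesgue_nd R n).

Definition tsq x : R := (\sum_(i < n) tnth x i ^+ 2)%R.
Definition tnorm x : R := Num.sqrt (tsq x).

Lemma tsq_ge0 x : (0 <= tsq x)%R.
Proof. by apply: sumr_ge0 => i _; exact: sqr_ge0. Qed.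

Lemma tnorm_ge0 x : (0 <= tnorm x)%R. Proof. exact: sqrtr_ge0. Qed.

Lemma tnorm_sqr x : (tnorm x ^+ 2 = tsq x)%R.
Proof. by rewrite sqr_sqrtr// tsq_ge0. Qed.

Lemma eballE r y : eball r y = (tnorm y < r)%R. Proof. by []. Qed.

Lemma eball_sq r y : (0 < r)%R -> (eball r y <-> (tsq y < r ^+ 2)%R).
Proof.
move=> r0; rewrite eballE -tnorm_sqr; split => h.
  by rewrite ltr_pXn2r// nnegrE ?tnorm_ge0// ltW.
by move: h; rewrite ltr_pXn2r// nnegrE ?tnorm_ge0// ltW.
Qed.

Lemma le_tnorm x (r : R) : (0 <= r)%R -> (tsq x <= r ^+ 2)%R -> (tnorm x <= r)%R.
Proof.
move=> r0; rewrite -tnorm_sqr => h.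
by move: h; rewrite ler_pXn2r// nnegrE ?tnorm_ge0// ltW.
Qed.

(** Lagrange's identity: twice the difference of the two sides is the sum of the
    squares of a_i b_j - a_j b_i. *)
Lemma cauchy_schwarz_sum (a b : 'I_n -> R) :
  ((\sum_i a i * b i) ^+ 2 <= (\sum_i a i ^+ 2) * (\sum_i b i ^+ 2))%R.
Proof.
have h : (0 <= \sum_i \sum_j (a i * b j - a j * b i) ^+ 2)%R.
  by apply: sumr_ge0 => i _; apply: sumr_ge0 => j _; exact: sqr_ge0.
rewrite -subr_ge0 -(pmulr_lge0 _ (@ltr0n R 2)).
suff -> : (((\sum_i a i ^+ 2) * (\sum_i b i ^+ 2) - (\sum_i a i * b i) ^+ 2) * 2 =
  \sum_i \sum_j (a i * b j - a j * b i) ^+ 2)%R by [].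
have E1 : ((\sum_i a i ^+ 2) * (\sum_i b i ^+ 2) =
    \sum_i \sum_j a i ^+ 2 * b j ^+ 2)%R.
  by rewrite mulr_suml; apply: eq_bigr => i _; rewrite mulr_sumr.
have E2 : ((\sum_i a i ^+ 2) * (\sum_i b i ^+ 2) =
    \sum_i \sum_j a j ^+ 2 * b i ^+ 2)%R.
  by rewrite E1 exchange_big.
have E3 : ((\sum_i a i * b i) ^+ 2 =
    \sum_i \sum_j a i * b i * (a j * b j))%R.
  by rewrite expr2 mulr_suml; apply: eq_bigr => i _; rewrite mulr_sumr.
rewrite mulrBl mulr_natr mulr2n {1}E1 E2 E3 -big_split/= mulr_suml -sumrB.
apply: eq_bigr => i _; rewrite -big_split/= mulr_suml -sumrB.
by apply: eq_bigr => j _; ring.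
Qed.

Lemma tnormD (x y z : n.-tuple R) :
  (forall i, tnth z i = tnth x i + tnth y i)%R -> (tnorm z <= tnorm x + tnorm y)%R.
Proof.
move=> zE; apply: le_tnorm; first by rewrite addr_ge0// tnorm_ge0.
have -> : (tsq z = tsq x + tsq y + 2 * \sum_i tnth x i * tnth y i)%R.
  rewrite /tsq mulr_sumr -!big_split/=; apply: eq_bigr => i _.
  by rewrite zE; ring.
have h : (\sum_i tnth x i * tnth y i <= tnorm x * tnorm y)%R.
  apply: (le_trans (ler_norm _)).
  rewrite -(@ler_pXn2r _ 2)// ?nnegrE ?mulr_ge0 ?tnorm_ge0//.
  by rewrite -normrX ger0_norm ?sqr_ge0// exprMn !tnorm_sqr; exact: cauchy_schwarz_sum.
rewrite -!tnorm_sqr; nra.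
Qed.

Lemma tnormN x y : (forall i, tnth y i = - tnth x i)%R -> tnorm y = tnorm x.
Proof.
move=> yE; congr Num.sqrt; apply: eq_bigr => i _.
by rewrite yE sqrrN.
Qed.

Lemma tnorm_tsub_le x y : (tnorm (tsub x y) <= tnorm x + tnorm y)%R.
Proof.
pose y' := [tuple (- tnth y i)%R | i < n].
rewrite -(@tnormN y y'); last by move=> i; rewrite tnth_mktuple.
by apply: tnormD => i; rewrite !tnth_mktuple.
Qed.

Lemma tnorm_tsubC x y : tnorm (tsub x y) = tnorm (tsub y x).
Proof. by apply: tnormN => i; rewrite !tnth_mktuple opprB. Qed.

Lemma tnorm_le_tsub x y : (tnorm x <= tnorm y + tnorm (tsub x y))%R.
Proof. by apply: tnormD => i; rewrite tnth_mktuple addrC subrK. Qed.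

Lemma tsubK x y : tsub x (tsub x y) = y.
Proof. by apply: eq_from_tnth => i; rewrite !tnth_mktuple opprB addrC subrK. Qed.

Lemma tnth_le_tnorm x i : (`|tnth x i| <= tnorm x)%R.
Proof.
rewrite -(@ler_pXn2r _ 2)// ?nnegrE ?tnorm_ge0//.
rewrite tnorm_sqr -normrX ger0_norm ?sqr_ge0// /tsq (bigD1 i)//= lerDl.
by apply: sumr_ge0 => j _; exact: sqr_ge0.
Qed.

Lemma measurable_tsq : measurable_fun setT tsq.
Proof.
apply: measurable_sum => i; apply: (measurableT_comp (exprn_measurable 2)).
exact: measurable_tnth.
Qed.

Lemma measurable_tnorm : measurable_fun setT tnorm.
Proof.
apply: (measurableT_comp _ measurable_tsq).
by apply: continuous_measurable_fun; exact: sqrt_continuous.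
Qed.

Lemma measurable_eball (r : R) : measurable (@eball R n r).
Proof.
rewrite -[X in measurable X]setTI.
rewrite (_ : eball r = tnorm @^-1` `]-oo, r[%classic).
  apply: measurable_tnorm => //; exact: measurable_itv.
by apply/seteqP; split=> y /=; rewrite in_itv.
Qed.

Lemma measurable_tsub x : measurable_fun setT (tsub x).
Proof.
by apply: measurable_mktuple => i; apply: measurable_funB => //; exact: measurable_tnth.
Qed.

Lemma tsub_tlin x : tsub x = tlin (-1)%R x.
Proof.
apply/funext => y; apply: eq_from_tnth => i.
by rewrite !tnth_mktuple mulN1r addrC.
Qed.

Lemma integral_tsub x (h : n.-tuple R -> \bar R) :
  measurable_fun setT h -> (forall y, 0 <= h y) ->
  \int[nd]_y h (tsub x y) = \int[nd]_y h y.
Proof.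
move=> mh h0; rewrite tsub_tlin integral_nd_affine// ?oppr_eq0//.
by rewrite normrN normr1 expr1n invr1 mul1e.
Qed.

Definition bvol : R := fine (nd (@eball R n 1)).

Let tnth0 : n.-tuple R := [tuple 0%R | i < n].

(** The ball lies between the cubes of half-sides 1 / (n + 1) and 1. *)
Lemma eball1_bounds : 0 < nd (@eball R n 1) < +oo.
Proof.
have [m1 e1] := @lebesgue_nd_box R n (fun=> (- n.+1%:R^-1)%R) (fun=> n.+1%:R^-1%R)
  (fun=> ltac:(by rewrite lerNl (@le_trans _ _ 0%R)// oppr_le0)).
have [m2 e2] := @lebesgue_nd_box R n (fun=> (-1)%R) (fun=> 1%R)
  (fun=> ltac:(by rewrite lerNl (@le_trans _ _ 0%R)// oppr_le0)).
apply/andP; split.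
  apply: (@lt_le_trans _ _ (nd [set x : n.-tuple R | forall i,
      (- n.+1%:R^-1 < tnth x i <= n.+1%:R^-1)%R])).
    rewrite e1 lte_fin; apply: prodr_gt0 => i _.
    by rewrite opprK addr_gt0.
  apply: le_measure; rewrite ?inE//; first exact: measurable_eball.
  move=> x /= hx; apply/eball_sq => //; rewrite expr1n.
  apply: (@le_lt_trans _ _ (\sum_(i < n) (n.+1%:R^-1)))%R.
    apply: ler_sum => i _; rewrite -real_normK ?num_real//.
    have h : (`|tnth x i| <= n.+1%:R^-1)%R.
      by rewrite ler_norml; have /andP[/ltW -> ->] := hx i.
    apply: (le_trans (_ : _ <= n.+1%:R^-1 ^+ 2)%R).
      by rewrite ler_pXn2r// nnegrE.
    by rewrite expr2 ler_piMr// invf_le1// ler1n.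
  by rewrite sumr_const card_ord -[X in (X < _)%R]mulr_natl ltr_pdivrMr// mul1r ltr_nat.
apply: (@le_lt_trans _ _ (nd [set x : n.-tuple R | forall i,
    (-1 < tnth x i <= 1)%R])); last by rewrite e2 ltry.
apply: le_measure; rewrite ?inE//; first exact: measurable_eball.
move=> x /=; rewrite -/(tnorm x) => hx i.
have := le_lt_trans (tnth_le_tnorm x i) hx.
by rewrite ltr_norml => /andP[-> /ltW ->].
Qed.

Lemma bvol_gt0 : (0 < bvol)%R.
Proof. by have /andP[h1 h2] := eball1_bounds; exact: fine_gt0 (introT andP (conj h1 h2)). Qed.

Lemma measure_eball (r : R) : (0 < r)%R -> nd (eball r) = (bvol * r ^+ n)%:E.
Proof.
move=> r0.
have mB : measurable_fun setT (EFin \o (\1_(@eball R n r) : n.-tuple R -> R)).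
  by apply/measurable_EFinP; apply: measurable_indic; exact: measurable_eball.
have B0 y : 0 <= (EFin \o (\1_(@eball R n r) : n.-tuple R -> R)) y.
  by rewrite lee_fin.
have ind (s : R) : \int[nd]_y (\1_(@eball R n s) y)%:E = nd (@eball R n s).
  have := @integral_indic _ _ R nd setT measurableT _ (measurable_eball s).
  by rewrite setIT.
have := integral_nd_affine tnth0 (lt0r_neq0 r0) mB B0.
rewrite [in RHS]/comp ind (_ : \int[nd]_x _ = nd (eball 1)); last first.
  rewrite -ind.
  apply: eq_integral => y _; congr EFin.
  rewrite !indicE; congr (nat_of_bool _)%:R; apply: asbool_equiv_eq.
  rewrite -/(eball r _) -/(eball 1 _) !eball_sq// expr1n.
  rewrite (_ : tsq (tlin r tnth0 y) = r ^+ 2 * tsq y)%R; last first.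
    rewrite /tsq mulr_sumr; apply: eq_bigr => i _.
    by rewrite !tnth_mktuple addr0 exprMn.
  by rewrite gtr_pMr// exprn_gt0.
rewrite gtr0_norm// => e1.
have <- : (r ^+ n)%:E * nd (eball 1) = nd (eball r).
  by rewrite e1 muleA -EFinM mulfV ?mul1e// gt_eqF// exprn_gt0.
have /andP[h0 h1] := eball1_bounds.
by rewrite /bvol mulrC EFinM fineK// ge0_fin_numE// ltW.
Qed.

Definition bavg (r : R) (g : n.-tuple R -> R) (x : n.-tuple R) : \bar R :=
  (nd (eball r))^-1 * \int[nd]_(y in eball r) (g (tsub x y))%:E.

(** In this form the average is an integral operator on the whole space, to which
    Tonelli's theorem applies. *)
Lemma bavgE (r : R) (g : n.-tuple R -> R) x : (0 < r)%R ->
  measurable_fun setT g -> (forall y, (0 <= g y)%R) ->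
  bavg r g x = (bvol * r ^+ n)^-1%:E *
    \int[nd]_y (\1_(eball r) (tsub x y) * g y)%:E.
Proof.
move=> r0 mg g0.
rewrite /bavg measure_eball// inver gt_eqF ?mulr_gt0 ?bvol_gt0 ?exprn_gt0//.
congr (_ * _).
have mI : measurable_fun setT (fun y : n.-tuple R => \1_(eball r) (tsub x y) : R).
  apply: measurableT_comp (measurable_tsub x).
  by apply: measurable_indic; exact: measurable_eball.
rewrite -[RHS](integral_tsub x); last 2 first.
- by apply/measurable_EFinP; apply: measurable_funM.
- by move=> y; rewrite lee_fin mulr_ge0// indicE.
rewrite integral_mkcond; apply: eq_integral => y _.
rewrite patchE tsubK indicE; case: ifP => _; first by rewrite mul1r.
by rewrite mul0r.
Qed.

(** The kernel of the average depends only on |x - y|, hence is symmetric. *)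
Lemma integral_bavgC (r : R) (u g : n.-tuple R -> R) : (0 < r)%R ->
  measurable_fun setT u -> (forall y, (0 <= u y)%R) ->
  measurable_fun setT g -> (forall y, (0 <= g y)%R) ->
  \int[nd]_x ((u x)%:E * bavg r g x) = \int[nd]_x ((g x)%:E * bavg r u x).
Proof.
move=> r0 mu u0 mg g0.
pose I (z : n.-tuple R) : R := \1_(eball r) z.
have I0 z : (0 <= I z)%R by rewrite /I indicE.
have mI : measurable_fun setT I by apply: measurable_indic; exact: measurable_eball.
pose k := (bvol * r ^+ n)^-1%R.
have k0 : (0 <= k)%R by rewrite invr_ge0 mulr_ge0 ?exprn_ge0// ltW// bvol_gt0.
have Isym x y : I (tsub x y) = I (tsub y x).
  rewrite /I !indicE; congr (nat_of_bool _)%:R; apply: asbool_equiv_eq.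
  by rewrite !eballE tnorm_tsubC.
have msub : measurable_fun setT (fun p : n.-tuple R * n.-tuple R => tsub p.1 p.2).
  by apply: measurable_mktuple => i; apply: measurable_funB => //;
    apply: (measurableT_comp (measurable_tnth i)).
have main (v w : n.-tuple R -> R) : measurable_fun setT v -> (forall y, (0 <= v y)%R) ->
    measurable_fun setT w -> (forall y, (0 <= w y)%R) ->
    \int[nd]_x ((v x)%:E * bavg r w x) =
    \int[nd]_x \int[nd]_y (k * (v x * (I (tsub x y) * w y)))%:E.
  move=> mv v0 mw w0; apply: eq_integral => x _.
  have mIw : measurable_fun setT (fun y => (I (tsub x y) * w y)%R).
    by apply: measurable_funM => //; apply: measurableT_comp (measurable_tsub x).
  have Iw0 y : 0 <= (I (tsub x y) * w y)%:E by rewrite lee_fin mulr_ge0.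
  rewrite bavgE// -/k muleCA -ge0_integralZl//; last 2 first.
  - exact/measurable_EFinP.
  - by rewrite lee_fin.
  rewrite -ge0_integralZl//.
  - by apply: measurable_funeM; exact/measurable_EFinP.
  - by move=> y _; apply: mule_ge0; [rewrite lee_fin|exact: Iw0].
rewrite (main u g mu u0 mg g0) (main g u mg g0 mu u0).
have mF : measurable_fun setT (fun p : n.-tuple R * n.-tuple R =>
    (k * (u p.1 * (I (tsub p.1 p.2) * g p.2)))%:E).
  apply/measurable_EFinP; apply: measurable_funM => //.
  apply: measurable_funM; first exact: (measurableT_comp mu).
  apply: measurable_funM; first exact: (measurableT_comp mI).
  exact: (measurableT_comp mg).
have F0 p : 0 <= (k * (u p.1 * (I (tsub p.1 p.2) * g p.2)))%:E.
  by rewrite lee_fin !mulr_ge0.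
rewrite (@fubini_tonelli _ _ _ _ _ nd nd _ mF F0).
apply: eq_integral => y _; apply: eq_integral => x _ /=.
by rewrite Isym; congr EFin; ring.
Qed.

End euclid.

(** * Integration by parts along one coordinate of a ball *)

Section slices.
Context {R : realType} {n : nat}.
Local Notation leb := (@lebesgue_measure R).
Local Notation nd := (@lebesgue_nd R n.+1).

Lemma integrable_eball m (r M : R) (e : m.-tuple R -> R) : (0 < r)%R ->
  measurable_fun setT e -> (forall y, eball r y -> (`|e y| <= M)%R) ->
  (@lebesgue_nd R m).-integrable (eball r) (EFin \o e).
Proof.
move=> r0 me eM; apply: measurable_bounded_integrable.
- exact: measurable_eball.
- by change (@lebesgue_nd R m (eball r) < +oo); rewrite measure_eball// ltry.
- exact: measurable_funS me.
- exists M; split; first exact: num_real.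
  by move=> N MN y By; apply: (le_trans (eM y By)); exact: ltW.
Qed.

Lemma tsq_tinsert (i : 'I_n.+1) t (z : n.-tuple R) :
  tsq (tinsert i t z) = (t ^+ 2 + tsq z)%R.
Proof.
rewrite /tsq (bigD1_ord i)//= tnth_tinsert_eq; congr (_ + _)%R.
by apply: eq_bigr => k _; rewrite tnth_tinsert_lift.
Qed.

(** A line in direction i meets the ball in an interval at whose ends H vanishes,
    so the integral of e, the derivative of H, over that interval is 0.  Since
    Tonelli's theorem is used for nonnegative functions, this is read as the
    equality of the integrals of the positive and negative parts of e on each
    line; the bound M makes the total integrals finite. *)
Lemma integral_eball_slice0 (i : 'I_n.+1) (r M : R) (e : n.+1.-tuple R -> R)
    (H : n.-tuple R -> R -> R) : (0 < r)%R ->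
  measurable_fun setT e -> (forall y, eball r y -> (`|e y| <= M)%R) ->
  (forall z t, is_derive t (1%R : R) (H z) (e (tinsert i t z))) ->
  (forall z, continuous (fun t => e (tinsert i t z))) ->
  (forall z t, (t ^+ 2 + tsq z = r ^+ 2)%R -> H z t = 0%R) ->
  \int[nd]_(y in eball r) (e y)%:E = 0.
Proof.
move=> r0 me eM dH ce H0.
have mB := @measurable_eball R n.+1 r.
have ie := integrable_eball r0 me eM.
rewrite integralE.
suff -> : \int[nd]_(y in eball r) (EFin \o e)^\+ y =
    \int[nd]_(y in eball r) (EFin \o e)^\- y.
  by apply: subee; exact: integrable_neg_fin_num.
have mp : measurable_fun setT ((EFin \o e)^\+ \_ (eball r)).
  apply/(measurable_restrictT _ _).1 => //.
  by apply: measurable_funepos; apply/measurable_EFinP; exact: measurable_funS me.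
have mn : measurable_fun setT ((EFin \o e)^\- \_ (eball r)).
  apply/(measurable_restrictT _ _).1 => //.
  by apply: measurable_funeneg; apply/measurable_EFinP; exact: measurable_funS me.
rewrite integral_mkcond [RHS]integral_mkcond.
have p0 x : 0 <= ((EFin \o e)^\+ \_ (eball r)) x by apply: erestrict_ge0 => y _; exact: funepos_ge0.
have n0 x : 0 <= ((EFin \o e)^\- \_ (eball r)) x by apply: erestrict_ge0 => y _; exact: funeneg_ge0.
rewrite (integral_ndS_insert i mp p0) (integral_ndS_insert i mn n0).
apply: eq_integral => z _.
pose J := [set t : R | eball r (tinsert i t z)].
pose h t := e (tinsert i t z).
have toJ (k : n.+1.-tuple R -> \bar R) :
    \int[leb]_t (k \_ (eball r)) (tinsert i t z) = \int[leb]_(t in J) k (tinsert i t z).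
  rewrite [RHS]integral_mkcond; apply: eq_integral => t _.
  by rewrite !patchE.
rewrite !toJ.
have [rz|zr] := leP (r ^+ 2)%R (tsq z).
  have -> : J = set0.
    rewrite -subset0 => t; rewrite /J /= => /(eball_sq _ r0).
    rewrite tsq_tinsert ltNge => /negP; apply.
    by rewrite (le_trans rz)// lerDr sqr_ge0.
  by rewrite !integral_set0.
pose a := Num.sqrt (r ^+ 2 - tsq z)%R.
have a0 : (0 < a)%R by rewrite sqrtr_gt0 subr_gt0.
have a2 : (a ^+ 2 = r ^+ 2 - tsq z)%R by rewrite sqr_sqrtr// subr_ge0 ltW.
have JE : J = `](- a)%R, a[%classic.
  apply/seteqP; split=> t; rewrite /J /= in_itv/=.
    move=> /(eball_sq _ r0); rewrite tsq_tinsert -ltrBrDr -a2 => ta.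
    rewrite -ltr_norml -(@ltr_pXn2r _ 2)// ?nnegrE// ?(ltW a0)//.
    by rewrite real_normK// num_real.
  rewrite -ltr_norml => ta; apply/(eball_sq _ r0).
  rewrite tsq_tinsert -ltrBrDr -a2 -real_normK ?num_real//.
  by rewrite ltr_pXn2r// ?nnegrE// (ltW a0).
have ch : continuous h by exact: ce.
have cH : continuous (H z).
  by move=> t; apply/differentiable_continuous/derivable1_diffP; exact: ex_derive.
have naa : (- a < a)%R by rewrite gt0_cp.
have mh (A : set R) : measurable_fun A (EFin \o h).
  by apply/measurable_EFinP/measurable_funTS; exact: continuous_measurable_fun.
have ih : leb.-integrable `](- a)%R, a[ (EFin \o h).
  apply: (@integrableS _ _ _ leb `[(- a)%R, a]).
  - exact: measurable_itv.
  - exact: measurable_itv.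
  - exact: subset_itv_oo_cc.
  - apply: continuous_compact_integrable; first exact: segment_compact.
    exact: continuous_subspaceT.
have I0 : \int[leb]_(t in `](- a)%R, a[) (h t)%:E = 0.
  rewrite -(@integral_itv_bndoo _ _ _ _ true false); last exact: mh.
  rewrite (@continuous_FTC2 _ h (H z))//.
  - by rewrite !H0 ?sube0// ?sqrrN a2 subrK.
  - exact: continuous_subspaceT.
  - split; [by move=> t _; exact: ex_derive|exact/cvg_at_right_filter/cH|
      exact/cvg_at_left_filter/cH].
  - by move=> t _; rewrite derive1E; exact: derive_val.
rewrite JE.
have mJ : measurable (`](- a)%R, a[%classic : set (measurableTypeR R)).
  exact: measurable_itv.
have Pf := @integrable_pos_fin_num _ _ _ leb _ mJ _ ih.
have Nf := @integrable_neg_fin_num _ _ _ leb _ mJ _ ih.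
pose P := \int[leb]_(t in `](- a)%R, a[) (EFin \o h)^\+ t.
pose N := \int[leb]_(t in `](- a)%R, a[) (EFin \o h)^\- t.
suff PN : P = N.
  transitivity P; first by apply: eq_integral => t _; rewrite /h !funeposE.
  by rewrite PN; apply: eq_integral => t _; rewrite /h !funenegE.
have : P - N = 0 by rewrite -I0 [RHS]integralE.
rewrite -[P]fineK// -[N]fineK// -EFinB => -[] /eqP.
by rewrite subr_eq0 => /eqP ->.
Qed.
End slices.

(** * Ball averages of radial functions and the Laplacian *)

Section profile.
Context {R : realType}.
Variables F F1 F2 : R -> R.
Hypothesis mF : measurable_fun setT F.
Hypothesis mF1 : measurable_fun setT F1.
Hypothesis mF2 : measurable_fun setT F2.
Hypothesis dF : forall s : R, (0 <= s)%R -> is_derive s (1%R : R) F (F1 s).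
Hypothesis dF1 : forall s : R, (0 <= s)%R -> is_derive s (1%R : R) F1 (F2 s).
Hypothesis cF2 : forall s : R, (0 <= s)%R -> {for s, continuous F2}.

Lemma is_derive_slice (c a tau K t : R) : (0 <= c)%R ->
 let q := (c + (a - tau * t) ^+ 2)%R in
 is_derive t (1%R : R)
  (fun t => - (K - t ^+ 2) * (a - tau * t) * F1 (c + (a - tau * t) ^+ 2))%R
  (2 * t * (a - tau * t) * F1 q +
     (K - t ^+ 2) * (tau * F1 q + 2 * tau * (a - tau * t) ^+ 2 * F2 q))%R.
Proof.
move=> c0 /=.
pose q (t : R) := (c + (a - tau * t) ^+ 2)%R.
have q0 : (0 <= q t)%R by rewrite addr_ge0// sqr_ge0.
have dq : is_derive t (1%R : R) q (- 2 * tau * (a - tau * t))%R.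
  by rewrite /q; apply: is_derive_eq; rewrite /GRing.scale/=; ring.
have dFq : is_derive t (1%R:R) (fun t => F1 (q t))
    (F2 (q t) * (- 2 * tau * (a - tau * t)))%R.
  by apply: (@is_derive1_comp R F1 q); exact: dF1.
have dp : is_derive t (1%R:R) (fun t => - (K - t ^+ 2) * (a - tau * t))%R
    (2 * t * (a - tau * t) + (K - t ^+ 2) * tau)%R.
  by apply: is_derive_eq; rewrite /GRing.scale/=; ring.
apply: (@is_derive_eq _ _ _ _ _ _ _ _ (is_deriveM dp dFq)).
by rewrite /GRing.scale/= -/(q t); ring.
Qed.

Lemma continuous_slice (G : R -> R) (c a tau : R) : (0 <= c)%R ->
  (forall s, (0 <= s)%R -> {for s, continuous G}) ->
  continuous (fun t : R => G (c + (a - tau * t) ^+ 2)%R).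
Proof.
move=> c0 cG t; pose q (t : R) := (c + (a - tau * t) ^+ 2)%R.
apply: (@continuous_comp _ _ _ q G); last by apply: cG; rewrite addr_ge0// sqr_ge0.
by apply/differentiable_continuous/derivable1_diffP; exact: ex_derive.
Qed.

Lemma continuous_at_derive (G : R -> R) (s a : R) :
  is_derive s (1%R:R) G a -> {for s, continuous G}.
Proof.
by move=> dG; apply/differentiable_continuous/derivable1_diffP; exact: ex_derive.
Qed.

Lemma bounded_on_segment (G : R -> R) (Q : R) : (0 <= Q)%R ->
  (forall s, (0 <= s)%R -> {for s, continuous G}) ->
  exists2 M, (0 <= M)%R & forall s, (0 <= s <= Q)%R -> (`|G s| <= M)%R.
Proof.
move=> Q0 cG.
have cN : {within `[0%R, Q], continuous (fun s => `|G s|%R)}.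
  apply: continuous_in_subspaceT => s; rewrite inE/= in_itv/= => /andP[s0 _].
  apply: (@continuous_comp _ _ _ G (fun y => `|y|%R)); first exact: cG.
  exact: norm_continuous.
have [c _ cM] := EVT_max Q0 cN.
by exists `|G c|%R => // s s0Q; apply: cM; rewrite in_itv.
Qed.

(** The Laplacian of F (|x|^2) in dimension n, as a function of s = |x|^2, where
    F1 and F2 are the first two derivatives of F. *)
Definition lap n (s : R) : R := (2 * n%:R * F1 s + 4 * s * F2 s)%R.

Section point.
Variables (n : nat) (x : n.+1.-tuple R) (r : R).
Hypothesis r0 : (0 < r)%R.
Local Notation nd := (@lebesgue_nd R n.+1).

Definition tshift (tau : R) (y : n.+1.-tuple R) : n.+1.-tuple R :=
  [tuple (tnth x i - tau * tnth y i)%R | i < n.+1].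

Lemma tnth_tshift tau y i : tnth (tshift tau y) i = (tnth x i - tau * tnth y i)%R.
Proof. exact: tnth_mktuple. Qed.

Let q tau y := tsq (tshift tau y).

Lemma tnorm_tshift tau y : (tnorm (tshift tau y) <= tnorm x + `|tau| * tnorm y)%R.
Proof.
have -> : (`|tau| * tnorm y = tnorm [tuple (- (tau * tnth y i))%R | i < n.+1])%R.
  rewrite /tnorm -sqrtr_sqr -sqrtrM ?sqr_ge0//; congr Num.sqrt.
  by rewrite /tsq mulr_sumr; apply: eq_bigr => i _; rewrite tnth_mktuple sqrrN exprMn.
by apply: tnormD => i; rewrite !tnth_mktuple.
Qed.

(** The partial derivative in y_i of
    - (r^2 - |y|^2) (x_i - tau y_i) F1 (|x - tau y|^2), which vanishes on the
    sphere of radius r. *)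
Definition slice_flux (i : 'I_n.+1) tau (y : n.+1.-tuple R) : R :=
  (2 * tnth y i * tnth (tshift tau y) i * F1 (q tau y) +
   (r ^+ 2 - tsq y) * (tau * F1 (q tau y) +
      2 * tau * tnth (tshift tau y) i ^+ 2 * F2 (q tau y)))%R.

Lemma measurable_tshift tau : measurable_fun setT (tshift tau).
Proof.
apply: measurable_mktuple => i; apply: measurable_funB => //.
by apply: measurable_funM => //; exact: measurable_tnth.
Qed.

Lemma measurable_q tau : measurable_fun setT (q tau).
Proof. exact: measurableT_comp measurable_tsq (measurable_tshift tau). Qed.

Lemma q_bound tau y : (`|tau| <= 2)%R -> eball r y ->
  (0 <= q tau y <= (tnorm x + 2 * r) ^+ 2)%R.
Proof.
rewrite eballE => t2 yr; rewrite tsq_ge0/= /q -tnorm_sqr.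
have h0 : (0 <= tnorm x + 2 * r)%R.
  by rewrite addr_ge0 ?tnorm_ge0// mulr_ge0// ltW.
rewrite ler_pXn2r// ?nnegrE ?tnorm_ge0//.
apply: (le_trans (tnorm_tshift _ _)); rewrite lerD2l.
by apply: ler_pM; rewrite ?tnorm_ge0// ltW.
Qed.

Lemma integral_slice_flux (i : 'I_n.+1) tau : (`|tau| <= 2)%R ->
  \int[nd]_(y in eball r) (slice_flux i tau y)%:E = 0 /\
  nd.-integrable (eball r) (EFin \o slice_flux i tau).
Proof.
move=> tau2.
have Q0 := sqr_ge0 (tnorm x + 2 * r)%R.
have [N1 N10 hN1] := bounded_on_segment Q0 (fun s s0 => continuous_at_derive (dF1 s0)).
have [N2 N20 hN2] := bounded_on_segment Q0 cF2.
have mf : measurable_fun setT (slice_flux i tau).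
  have mF1q := measurableT_comp mF1 (measurable_q tau).
  have mF2q := measurableT_comp mF2 (measurable_q tau).
  have mi := measurable_tnth (d := default_measure_display) (T := R) i.
  have msi := measurableT_comp mi (measurable_tshift tau).
  apply: measurable_funD.
    by apply: measurable_funM => //; apply: measurable_funM => //; exact: measurable_funM.
  apply: measurable_funM; first by apply: measurable_funB => //; exact: measurable_tsq.
  apply: measurable_funD; first exact: measurable_funM.
  by apply: measurable_funM => //; apply: measurable_funM => //; exact: measurable_funX.
pose Q := (tnorm x + 2 * r)%R.
have Qp : (0 <= Q)%R by rewrite addr_ge0 ?tnorm_ge0// mulr_ge0// ltW.
pose M := (2 * r * Q * N1 + r ^+ 2 * (2 * N1 + 2 * 2 * Q ^+ 2 * N2))%R.
have bM y : eball r y -> (`|slice_flux i tau y| <= M)%R.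
  move=> By; have qb := q_bound tau2 By.
  have b1 := hN1 _ qb; have b2 := hN2 _ qb.
  have yi : (`|tnth y i| <= r)%R by apply: (le_trans (tnth_le_tnorm _ _)); exact: ltW.
  have si : (`|tnth (tshift tau y) i| <= Q)%R.
    apply: (le_trans (tnth_le_tnorm _ _)).
    rewrite -(@ler_pXn2r _ 2)// ?nnegrE ?tnorm_ge0// tnorm_sqr.
    by case/andP: qb.
  have ry : (`|r ^+ 2 - tsq y| <= r ^+ 2)%R.
    have /(eball_sq _ r0) h := By.
    rewrite ger0_norm; last by rewrite subr_ge0 ltW.
    by rewrite gerBl tsq_ge0.
  apply: (le_trans (ler_normD _ _)); apply: lerD.
    rewrite !normrM (ger0_norm (ler0n _ 2)).
    by rewrite !ler_pM ?mulr_ge0.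
  rewrite normrM ler_pM//.
  apply: (le_trans (ler_normD _ _)); apply: lerD; rewrite !normrM.
    by rewrite ler_pM.
  rewrite (ger0_norm (ler0n _ 2)) -expr2 ler_pM// ?mulr_ge0// ?sqr_ge0//.
  by rewrite !ler_pM ?mulr_ge0 ?sqr_ge0// ler_pXn2r.
split; last exact: integrable_eball bM.
pose c z := (\sum_(k < n) (tnth x (lift i k) - tau * tnth z k) ^+ 2)%R.
have c0 z : (0 <= c z)%R by apply: sumr_ge0 => k _; exact: sqr_ge0.
have qE z t : q tau (tinsert i t z) = (c z + (tnth x i - tau * t) ^+ 2)%R.
  rewrite /q /tsq (bigD1_ord i)//= tnth_tshift tnth_tinsert_eq addrC; congr (_ + _)%R.
  by apply: eq_bigr => k _; rewrite tnth_tshift tnth_tinsert_lift.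
have fE z t : slice_flux i tau (tinsert i t z) =
  (2 * t * (tnth x i - tau * t) * F1 (c z + (tnth x i - tau * t) ^+ 2) +
   (r ^+ 2 - tsq z - t ^+ 2) * (tau * F1 (c z + (tnth x i - tau * t) ^+ 2) +
     2 * tau * (tnth x i - tau * t) ^+ 2 * F2 (c z + (tnth x i - tau * t) ^+ 2)))%R.
  rewrite /slice_flux qE tnth_tshift tnth_tinsert_eq tsq_tinsert.
  by congr (_ + _ * _)%R; ring.
pose H z t := (- (r ^+ 2 - tsq z - t ^+ 2) * (tnth x i - tau * t) *
  F1 (c z + (tnth x i - tau * t) ^+ 2))%R.
apply: (@integral_eball_slice0 _ _ i r M _ H r0 mf bM).
- by move=> z t; rewrite fE; exact: is_derive_slice.
- move=> z; under eq_fun do rewrite fE.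
  have cp1 : continuous (fun t : R => 2 * t * (tnth x i - tau * t))%R.
    by move=> t; apply/differentiable_continuous/derivable1_diffP; exact: ex_derive.
  have cp2 : continuous (fun t : R => r ^+ 2 - tsq z - t ^+ 2)%R.
    by move=> t; apply/differentiable_continuous/derivable1_diffP; exact: ex_derive.
  have cp3 : continuous (fun t : R => 2 * tau * (tnth x i - tau * t) ^+ 2)%R.
    by move=> t; apply/differentiable_continuous/derivable1_diffP; exact: ex_derive.
  have cF1q := @continuous_slice F1 (c z) (tnth x i) tau (c0 z)
    (fun s s0 => continuous_at_derive (dF1 s0)).
  have cF2q := @continuous_slice F2 (c z) (tnth x i) tau (c0 z) cF2.
  move=> t; apply: cvgD; first by apply: cvgM; [exact: cp1|exact: cF1q].
  apply: cvgM; first exact: cp2.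
  apply: cvgD; first by apply: cvgM; [exact: cvg_cst|exact: cF1q].
  by apply: cvgM; [exact: cp3|exact: cF2q].
- move=> z t tz.
  by rewrite /H -tz addrK subrr oppr0 !mul0r.
Qed.

Let xy (y : n.+1.-tuple R) : R := (\sum_(i < n.+1) tnth x i * tnth y i)%R.

(** The derivative in tau of F (|x - tau y|^2). *)
Definition radial_slope tau (y : n.+1.-tuple R) : R :=
  (F1 (q tau y) * (- 2 * xy y + 2 * tau * tsq y))%R.

Lemma q_expand tau y : q tau y = (tsq x - 2 * tau * xy y + tau ^+ 2 * tsq y)%R.
Proof.
rewrite /q /xy /tsq !mulr_sumr -sumrB -big_split/=; apply: eq_bigr => i _.
by rewrite tnth_tshift; ring.
Qed.

Lemma is_derive_profile tau y :
  is_derive tau (1%R : R) (fun tau => F (q tau y)) (radial_slope tau y).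
Proof.
have dq : is_derive tau (1%R : R) (fun tau => q tau y) (- 2 * xy y + 2 * tau * tsq y)%R.
  under eq_fun do rewrite q_expand.
  by apply: is_derive_eq; rewrite /GRing.scale/=; ring.
apply: (@is_derive1_comp R F (fun tau => q tau y)).
by apply: dF; exact: tsq_ge0.
Qed.

(** The divergence of the field behind [slice_flux].  As it integrates to 0 over
    the ball, the derivative in tau and the weighted Laplacian have the same
    integral. *)
Lemma sum_slice_flux tau y : (\sum_(i < n.+1) slice_flux i tau y =
  - radial_slope tau y + tau / 2 * (r ^+ 2 - tsq y) * lap n.+1 (q tau y))%R.
Proof.
have e1 : (\sum_(i < n.+1) 2 * tnth y i * tnth (tshift tau y) i = 
    2 * xy y - 2 * tau * tsq y)%R.
  rewrite /xy /tsq !mulr_sumr -sumrB; apply: eq_bigr => i _.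
  by rewrite tnth_tshift; ring.
rewrite /slice_flux big_split/= -mulr_suml e1 -mulr_sumr big_split/=.
rewrite sumr_const card_ord -mulr_suml -mulr_sumr -/(tsq _) -/(q tau y).
by rewrite /radial_slope /lap; field.
Qed.

Lemma integrable_radial tau : (`|tau| <= 2)%R ->
  nd.-integrable (eball r) (EFin \o (fun y => F (q tau y))).
Proof.
move=> tau2; have Q0 := sqr_ge0 (tnorm x + 2 * r)%R.
have [N _ hN] := bounded_on_segment Q0 (fun s s0 => continuous_at_derive (dF s0)).
apply: (integrable_eball r0 (measurableT_comp mF (measurable_q tau))) => y By.
by apply: hN; exact: q_bound.
Qed.

Lemma radial_slope_bound : exists2 M : R, (0 <= M)%R & forall tau y,
  (`|tau| <= 2)%R -> eball r y -> (`|radial_slope tau y| <= M)%R.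
Proof.
have Q0 := sqr_ge0 (tnorm x + 2 * r)%R.
have [N N0 hN] := bounded_on_segment Q0 (fun s s0 => continuous_at_derive (dF1 s0)).
exists (N * (2 * (tnorm x * r) + 2 * 2 * r ^+ 2))%R.
  by rewrite mulr_ge0// addr_ge0// ?mulr_ge0 ?tnorm_ge0// ltW.
move=> tau y tau2 By; rewrite normrM ler_pM//.
  by apply: hN; exact: q_bound.
apply: (le_trans (ler_normD _ _)); apply: lerD; rewrite !normrM.
  rewrite normrN (ger0_norm (ler0n _ 2)) ler_pM2l//.
  have h : (`|xy y| <= tnorm x * tnorm y)%R.
    rewrite -(@ler_pXn2r _ 2)// ?nnegrE ?mulr_ge0 ?tnorm_ge0//.
    by rewrite real_normK ?num_real// exprMn !tnorm_sqr; exact: cauchy_schwarz_sum.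
  by apply: (le_trans h); apply: ler_wpM2l; [exact: tnorm_ge0|exact: ltW].
rewrite (ger0_norm (ler0n _ 2)) ler_pM ?mulr_ge0// ?ler_pM2l//.
rewrite ger0_norm ?tsq_ge0//; apply: ltW; exact/(eball_sq _ r0).
Qed.

Lemma integrable_radial_slope tau : (`|tau| <= 2)%R ->
  nd.-integrable (eball r) (EFin \o radial_slope tau).
Proof.
move=> tau2; have [M _ hM] := radial_slope_bound.
apply: (@integrable_eball _ _ r M) => //; last by move=> y; exact: hM.
apply: measurable_funM; first exact: (measurableT_comp mF1 (measurable_q tau)).
apply: measurable_funD; apply: measurable_funM => //.
  apply: measurable_sum => i; apply: measurable_funM => //.
  exact: measurable_tnth.
exact: measurable_tsq.
Qed.

Definition bump_mass : R := (\int[nd]_(y in eball r) (r ^+ 2 - tsq y))%R.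

Lemma integrable_bump :
  nd.-integrable (eball r) (EFin \o (fun y => r ^+ 2 - tsq y))%R.
Proof.
apply: (@integrable_eball _ _ r (r ^+ 2)) => //.
  by apply: measurable_funB => //; exact: measurable_tsq.
move=> y /(eball_sq _ r0) h.
rewrite ger0_norm; last by rewrite subr_ge0 ltW.
by rewrite gerBl tsq_ge0.
Qed.

Let phi tau : R := (\int[nd]_(y in eball r) F (q tau y))%R.

Let in_itv2 (tau : R) : `](-1)%R, 2%R[%classic tau -> (`|tau| <= 2)%R.
Proof.
rewrite /= in_itv/= => /andP[h1 h2]; rewrite ler_norml (ltW h2) andbT.
by rewrite (le_trans _ (ltW h1))// lerN2 ler1n.
Qed.

Lemma is_derive_phi (tau : R) : `](-1)%R, 2%R[%classic tau ->
  is_derive tau (1%R : R) phi (\int[nd]_(y in eball r) radial_slope tau y)%R.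
Proof.
move=> tau2; have [M M0 hM] := radial_slope_bound.
have p1E t y : partial1of2 (fun tau y => F (q tau y)) t y = radial_slope t y.
  by rewrite /partial1of2 derive1E; have := is_derive_profile t y => ?; exact: derive_val.
have a1 t : `](-1)%R, 2%R[%classic t ->
    nd.-integrable (eball r) (EFin \o (fun y => F (q t y))).
  by move=> /in_itv2; exact: integrable_radial.
have a2 (t : R) (y : n.+1.-tuple R) : `](-1)%R, 2%R[%classic t -> eball r y ->
    derivable (fun tau => F (q tau y)) t (1%R:R).
  by move=> _ _; have := is_derive_profile t y => ?; exact: ex_derive.
have a3 : nd.-integrable (eball r) (EFin \o (fun=> M)).
  by apply: (@integrable_eball _ _ r M) => // y _; rewrite ger0_norm.
have a4 t y : `](-1)%R, 2%R[%classic t -> eball r y ->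
    (`|partial1of2 (fun tau y => F (q tau y)) t y| <= M)%R.
  by move=> /in_itv2 t2 By; rewrite p1E; exact: hM.
apply: DeriveDef.
  exact: (derivable_under_integral (measurable_eball r) tau2 a1 a2 (fun=> M0) a3 a4).
rewrite -derive1E.
rewrite (differentiation_under_integral (measurable_eball r) tau2 a1 a2 (fun=> M0) a3 a4).
by apply: eq_Rintegral => y _; rewrite p1E.
Qed.

Lemma integral_radial_slope (tau : R) : (`|tau| <= 2)%R ->
  (\int[nd]_(y in eball r) radial_slope tau y =
   \int[nd]_(y in eball r) (tau / 2 * (r ^+ 2 - tsq y) * lap n.+1 (q tau y)))%R.
Proof.
move=> tau2.
have mB := @measurable_eball R n.+1 r.
have is_ := integrable_radial_slope tau2.
have isf : nd.-integrable (eball r)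
    (fun y => \sum_(i < n.+1) (slice_flux i tau y)%:E).
  by apply: integrable_sum => // i _; have [] := integral_slice_flux i tau2.
have E0 : \int[nd]_(y in eball r) (\sum_(i < n.+1) (slice_flux i tau y)%:E) = 0.
  rewrite integral_sum//; last by move=> i; have [] := integral_slice_flux i tau2.
  by rewrite big1// => i _; have [] := integral_slice_flux i tau2.
have E1 : (\int[nd]_(y in eball r) (\sum_(i < n.+1) slice_flux i tau y) = 0)%R.
  rewrite /Rintegral -[RHS]/(fine 0) -E0; congr fine.
  by apply: eq_integral => y _; rewrite sumEFin.
have isf' : nd.-integrable (eball r)
    (EFin \o (fun y => \sum_(i < n.+1) slice_flux i tau y)%R).
  by apply: eq_integrable isf => // y _; rewrite /= sumEFin.
transitivity ((\int[nd]_(y in eball r) radial_slope tau y) +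
   (\int[nd]_(y in eball r) (\sum_(i < n.+1) slice_flux i tau y)))%R.
  by rewrite E1 addr0.
rewrite -RintegralD//.
by apply: eq_Rintegral => y _; rewrite sum_slice_flux addrA subrr add0r.
Qed.

Lemma integrable_bump_lap (tau : R) : (`|tau| <= 2)%R ->
  nd.-integrable (eball r)
   (EFin \o (fun y => tau / 2 * (r ^+ 2 - tsq y) * lap n.+1 (q tau y))%R).
Proof.
move=> tau2.
have mB := @measurable_eball R n.+1 r.
have is_ := integrable_radial_slope tau2.
have isf : nd.-integrable (eball r)
    (fun y => (radial_slope tau y)%:E + \sum_(i < n.+1) (slice_flux i tau y)%:E).
  apply: integrableD => //.
  by apply: integrable_sum => // i _; have [] := integral_slice_flux i tau2.
apply: eq_integrable isf => // y _.
by rewrite /= sumEFin -EFinD sum_slice_flux addrA subrr add0r.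
Qed.

Lemma bump_mass_gt0 : (0 < bump_mass)%R.
Proof.
have mB := @measurable_eball R n.+1 r.
have mB2 := @measurable_eball R n.+1 (r / 2).
have sub : @eball R n.+1 (r / 2) `<=` eball r.
  by move=> y; rewrite !eballE => /lt_trans; apply; rewrite gtr_pMr// invf_lt1// ltr1n.
have r20 : (0 < r / 2)%R by rewrite divr_gt0.
have ib := integrable_bump.
rewrite /bump_mass /Rintegral -lte_fin fineK; last exact: integrable_fin_num.
have b0 y : eball r y -> 0 <= (r ^+ 2 - tsq y)%:E.
  by move=> /(eball_sq _ r0) h; rewrite lee_fin subr_ge0 ltW.
have mb : measurable_fun setT (EFin \o (fun y : n.+1.-tuple R => r ^+ 2 - tsq y)%R).
  by apply/measurable_EFinP; apply: measurable_funB => //; exact: measurable_tsq.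
apply: (@lt_le_trans _ _ (\int[nd]_(y in eball (r / 2)) (r ^+ 2 / 2)%:E)).
  rewrite integral_cst// -[X in _ * X]/(@lebesgue_nd R n.+1 (eball (r / 2))).
  rewrite measure_eball// -EFinM lte_fin.
  by rewrite mulr_gt0 ?divr_gt0 ?exprn_gt0// mulr_gt0 ?bvol_gt0 ?exprn_gt0.
apply: (@le_trans _ _ (\int[nd]_(y in eball (r / 2)) (r ^+ 2 - tsq y)%:E)).
  apply: ge0_le_integral => //.
  - by move=> y _; rewrite lee_fin divr_ge0// sqr_ge0.
  - exact: measurable_funTS.
  - move=> y /(eball_sq _ r20) h; rewrite lee_fin.
    have := sqr_ge0 r; nra.
apply: ge0_subset_integral => //; [exact: measurable_funTS|exact: b0].
Qed.

(** The integral over the ball of F (|x - tau y|^2) is the left-hand side at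
    tau = 0 and the integral on the right at tau = 1.  Its derivative is tau / 2
    times a Laplacian weighted by r^2 - |y|^2, at least - kappa tau / 2 times
    the mass of the weight; adding kappa tau^2 / 4 times that mass makes it
    nondecreasing on [0, 1]. *)
Lemma mean_value_ge kappa :
  (forall z, eball r (tsub x z) -> (- kappa <= lap n.+1 (tsq z))%R) ->
  (F (tsq x) * (@bvol R n.+1 * r ^+ n.+1) <=
    \int[nd]_(y in eball r) F (tsq (tsub x y)) + kappa / 4 * bump_mass)%R.
Proof.
move=> hk.
have mB := @measurable_eball R n.+1 r.
have qsub y : q 1 y = tsq (tsub x y).
  by congr tsq; apply: eq_from_tnth => i; rewrite !tnth_mktuple mul1r.
have q0 y : q 0 y = tsq x.
  by congr tsq; apply: eq_from_tnth => i; rewrite !tnth_mktuple mul0r subr0.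
have phi0 : phi 0 = (F (tsq x) * (@bvol R n.+1 * r ^+ n.+1))%R.
  rewrite /phi; under eq_Rintegral do rewrite q0.
  rewrite Rintegral_cst//; congr (_ * _)%R.
  by rewrite -[X in fine X]/(@lebesgue_nd R n.+1 (eball r)) measure_eball.
have phi1 : phi 1 = (\int[nd]_(y in eball r) F (tsq (tsub x y)))%R.
  by rewrite /phi; under eq_Rintegral do rewrite qsub.
rewrite -phi0 -phi1.
pose psi tau : R := (phi tau + kappa * bump_mass / 4 * tau ^+ 2)%R.
have dpsi (tau : R) : `](-1)%R, 2%R[%classic tau -> is_derive tau (1%R:R) psi
    ((\int[nd]_(y in eball r) radial_slope tau y) + kappa * bump_mass / 2 * tau)%R.
  move=> tau2; have dphi := is_derive_phi tau2.
  by apply: is_derive_eq; rewrite /GRing.scale/=; field.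
have in01 (tau : R) : tau \in `[0%R, 1%R] -> `](-1)%R, 2%R[%classic tau.
  rewrite in_itv/= in_itv/= => /andP[h1 h2]; apply/andP; split.
    by apply: lt_le_trans h1; rewrite ltrN10.
  by apply: (le_lt_trans h2); rewrite ltr1n.
suff : (psi 0 <= psi 1)%R.
  by rewrite /psi expr0n mulr0 addr0 expr1n mulr1 mulrAC.
apply: (@ger0_derive1_le_cc _ psi 0 1)%R => //; rewrite ?in_itv/= ?lexx ?ler01//.
- by move=> tau /subset_itv_oo_cc/in01/dpsi d; exact: ex_derive.
- move=> tau tau01; have t01 := subset_itv_oo_cc tau01.
  have d := dpsi _ (in01 _ t01).
  rewrite derive1E derive_val.
  have tau2 : (`|tau| <= 2)%R by apply: in_itv2; exact: in01.
  rewrite integral_radial_slope//.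
  have t0 : (0 <= tau)%R by move: t01; rewrite in_itv/= => /andP[].
  have t1 : (tau <= 1)%R by move: t01; rewrite in_itv/= => /andP[].
  have -> : (kappa * bump_mass / 2 * tau =
      - (\int[nd]_(y in eball r) (- (kappa * tau / 2) * (r ^+ 2 - tsq y))))%R.
    rewrite RintegralZl//; last exact: integrable_bump.
    by rewrite -/bump_mass; field.
  rewrite subr_ge0; apply: le_Rintegral => //.
  - have := integrableZl mB (- (kappa * tau / 2))%R integrable_bump.
    by apply: eq_integrable => // y _; rewrite /= EFinM.
  - exact: integrable_bump_lap.
  move=> y By.
  have w0 : (0 <= r ^+ 2 - tsq y)%R by rewrite subr_ge0 ltW//; exact/(eball_sq _ r0).
  have := hk (tshift tau y).
  rewrite -/(q tau y) => hk'.
  have hl : (- kappa <= lap n.+1 (q tau y))%R.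
    apply: hk'; apply/(eball_sq _ r0).
    rewrite (_ : tsq _ = tau ^+ 2 * tsq y)%R; last first.
      rewrite /tsq mulr_sumr; apply: eq_bigr => i _.
      by rewrite !tnth_mktuple opprB addrC subrK exprMn.
    have /(eball_sq _ r0) := By.
    apply: le_lt_trans; rewrite ler_piMl ?tsq_ge0//.
    by rewrite expr_le1.
  rewrite -subr_ge0 (_ : (_ - _ = (tau / 2 * (r ^+ 2 - tsq y)) *
    (lap n.+1 (q tau y) + kappa))%R); last by field.
  by rewrite mulr_ge0// ?mulr_ge0// -lerBlDr sub0r.
- apply: continuous_in_subspaceT => tau; rewrite inE => /in01/dpsi d.
  by apply/differentiable_continuous/derivable1_diffP; exact: ex_derive.
Qed.

End point.
End profile.

(** * Truncated radial profiles *)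

Section pospart_cube.
Context {R : realType}.
Implicit Types t s : R.

Definition pos t : R := Num.max t 0%R.

Lemma pos_ge0 t : (0 <= pos t)%R. Proof. by rewrite le_max lexx orbT. Qed.

Lemma is_derive_mul_norm t : is_derive t (1%R : R) (fun t => t * `|t|)%R (2 * `|t|)%R.
Proof.
have [t0|t0|->] := ltgtP t 0%R.
- apply: (@near_eq_is_derive _ _ _ (fun t => - (t * t))%R) => //.
    near=> s; rewrite ltr0_norm ?mulrN//; near: s; exact: lt_nbhsl.
  by apply: is_derive_eq; rewrite /GRing.scale/= ltr0_norm//; ring.
- apply: (@near_eq_is_derive _ _ _ (fun t => (t * t))%R) => //.
    near=> s; rewrite gtr0_norm//; near: s; exact: lt_nbhsr.
  by apply: is_derive_eq; rewrite /GRing.scale/= gtr0_norm//; ring.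
rewrite normr0 mulr0.
have H : (h^-1 *: (((fun t : R => t * `|t|) \o shift 0) (h *: (1:R)) - 0 * `|0 : R|))%R
    @[h --> (0%R:R)^'] --> (0%R:R).
  have c0 : `|h|%R @[h --> (0%R:R)^'] --> (0%R:R).
    rewrite -[X in _ --> X](@normr0 _ R); apply: cvg_norm.
    by apply: cvg_within_filter; exact: cvg_id.
  apply: cvg_trans c0; apply: near_eq_cvg; near=> h.
  have h0 : h != 0%R by near: h; exact: nbhs_dnbhs_neq.
  by rewrite /GRing.scale/= mulr1 addr0 mul0r subr0 mulrA mulVf// mul1r.
apply: DeriveDef; first by apply/cvg_ex; exists (0%R : R).
exact: cvg_lim H.
Unshelve. all: by end_near. Qed.

Lemma is_derive_pos2 t : is_derive t (1%R : R) (fun t => pos t ^+ 2)%R (2 * pos t)%R.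
Proof.
have posE s : (pos s ^+ 2 = (s ^+ 2 + s * `|s|) / 2)%R.
  rewrite /pos; case: (ltP 0%R s) => s0.
    by rewrite gtr0_norm//; field.
  by rewrite ler0_norm//; field.
have posE1 s : (pos s = (s + `|s|) / 2)%R.
  rewrite /pos; case: (ltP 0%R s) => s0.
    by rewrite gtr0_norm//; field.
  by rewrite ler0_norm//; field.
under eq_fun do rewrite posE; rewrite posE1.
have := is_derive_mul_norm t => ?.
by apply: is_derive_eq; rewrite /GRing.scale/=; field.
Qed.

Lemma is_derive_pos3 t : is_derive t (1%R : R) (fun t => pos t ^+ 3)%R (3 * pos t ^+ 2)%R.
Proof.
have posE s : (pos s ^+ 3 = s * pos s ^+ 2)%R.
  rewrite /pos; case: (ltP 0%R s) => s0; first by rewrite -exprS.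
  by rewrite !expr0n/= mulr0.
have E : (t * pos t = pos t ^+ 2)%R.
  rewrite /pos; case: (ltP 0%R t) => s0; first by rewrite expr2.
  by rewrite mulr0 expr0n.
under eq_fun do rewrite posE.
have := is_derive_pos2 t => ?.
apply: is_derive_eq; rewrite /GRing.scale/= mulr1.
by rewrite mulrCA E; ring.
Qed.

Lemma measurable_pos : measurable_fun setT (pos : R -> R).
Proof. exact: measurable_maxr. Qed.

Lemma continuous_pos : continuous (pos : R -> R).
Proof.
rewrite (_ : pos = fun t => ((t + `|t|) / 2)%R).
  move=> t; apply: cvgM; last exact: cvg_cst.
  by apply: cvgD; [exact: cvg_id|exact: norm_continuous].
apply/funext => s; rewrite /pos; case: (ltP 0%R s) => s0.
  by rewrite gtr0_norm//; field.
by rewrite ler0_norm//; field.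
Qed.

End pospart_cube.

Section truncated_profile.
Context {R : realType}.
Variables W W1 W2 : R -> R.
Hypothesis mW : measurable_fun setT W.
Hypothesis mW1 : measurable_fun setT W1.
Hypothesis mW2 : measurable_fun setT W2.
Hypothesis dW : forall s : R, (0 <= s)%R -> is_derive s (1%R : R) W (W1 s).
Hypothesis dW1 : forall s : R, (0 <= s)%R -> is_derive s (1%R : R) W1 (W2 s).
Hypothesis cW2 : forall s : R, (0 <= s)%R -> {for s, continuous W2}.

(** The third power is the least integer one for which truncation at 0 preserves two
    continuous derivatives. *)
Definition cube s : R := (pos (W s) ^+ 3)%R.
Definition cube1 s : R := (3 * pos (W s) ^+ 2 * W1 s)%R.
Definition cube2 s : R := (6 * pos (W s) * W1 s ^+ 2 + 3 * pos (W s) ^+ 2 * W2 s)%R.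

Lemma is_derive_cube (s : R) : (0 <= s)%R -> is_derive s (1%R : R) cube (cube1 s).
Proof.
move=> s0; have d := is_derive_pos3 (W s); have dw := dW s0.
exact: (@is_derive1_comp R (fun t => pos t ^+ 3)%R W).
Qed.

Lemma is_derive_cube1 (s : R) : (0 <= s)%R -> is_derive s (1%R : R) cube1 (cube2 s).
Proof.
move=> s0; have d := is_derive_pos2 (W s); have dw := dW s0; have dw1 := dW1 s0.
have dp : is_derive s (1%R:R) (fun s => pos (W s) ^+ 2)%R (2 * pos (W s) * W1 s)%R.
  exact: (@is_derive1_comp R (fun t => pos t ^+ 2)%R W).
by apply: is_derive_eq; rewrite /cube2 /GRing.scale/=; ring.
Qed.

Lemma continuous_cube2 (s : R) : (0 <= s)%R -> {for s, continuous cube2}.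
Proof.
move=> s0.
have cW := continuous_at_derive (dW s0); have cW1 := continuous_at_derive (dW1 s0).
have cp : {for s, continuous (pos \o W)} by apply: continuous_comp => //; exact: continuous_pos.
apply: cvgD; apply: cvgM.
- by apply: cvgM; [exact: cvg_cst|exact: cp].
- rewrite [X in _ --> X]expr2; under eq_fun do rewrite expr2; exact: cvgM.
- apply: cvgM; first exact: cvg_cst.
  rewrite [X in _ --> X]expr2; under eq_fun do rewrite expr2; exact: (cvgM cp cp).
- exact: cW2.
Qed.

Lemma measurable_cube : measurable_fun setT cube /\
  measurable_fun setT cube1 /\ measurable_fun setT cube2.
Proof.
have mp := measurableT_comp measurable_pos mW.
split; first exact: measurable_funX.
split; first by apply: measurable_funM => //; apply: measurable_funM => //; exact: measurable_funX.
apply: measurable_funD; apply: measurable_funM => //.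
- exact: measurable_funM.
- exact: measurable_funX.
- by apply: measurable_funM => //; exact: measurable_funX.
Qed.

(** The map t |-> t_+^3 is convex, so composing with it only adds the nonnegative
    term 24 s W_+ W1^2: the truncation leaves no error at the edge of the
    support. *)
Lemma lap_cube n (s : R) : (0 <= s)%R ->
  (3 * pos (W s) ^+ 2 * lap W1 W2 n s <= lap cube1 cube2 n s)%R.
Proof.
move=> s0; rewrite -subr_ge0.
rewrite (_ : (_ - _ = 24 * (s * pos (W s) * W1 s ^+ 2))%R); last first.
  by rewrite /lap /cube1 /cube2; ring.
rewrite mulr_ge0// mulr_ge0 ?sqr_ge0// mulr_ge0//; exact: pos_ge0.
Qed.

Lemma cube_ge0 s : (0 <= cube s)%R.
Proof. by rewrite exprn_ge0// pos_ge0. Qed.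

Lemma cube_eq0 s : (W s <= 0)%R -> cube s = 0%R.
Proof. by move=> w0; rewrite /cube /pos max_r// expr0n. Qed.

End truncated_profile.

Section bavg_profile.
Context {R : realType}.
Local Notation bv n := (@bvol R n.+1).

(** The mean of (r^2 - |y|^2) / 4 over the ball of radius r. *)
Definition bump_ratio n (r : R) : R := (@bump_mass R n r / (4 * (bv n * r ^+ n.+1)))%R.

Lemma bump_ratio_gt0 n (r : R) : (0 < r)%R -> (0 < bump_ratio n r)%R.
Proof.
by move=> r0; rewrite divr_gt0 ?bump_mass_gt0 ?mulr_gt0 ?bvol_gt0 ?exprn_gt0.
Qed.

Variables F F1 F2 : R -> R.
Hypothesis mF : measurable_fun setT F.
Hypothesis mF1 : measurable_fun setT F1.
Hypothesis mF2 : measurable_fun setT F2.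
Hypothesis dF : forall s : R, (0 <= s)%R -> is_derive s (1%R : R) F (F1 s).
Hypothesis dF1 : forall s : R, (0 <= s)%R -> is_derive s (1%R : R) F1 (F2 s).
Hypothesis cF2 : forall s : R, (0 <= s)%R -> {for s, continuous F2}.

Lemma integrable_profile_tsub n (x : n.+1.-tuple R) (r : R) : (0 < r)%R ->
  (@lebesgue_nd R n.+1).-integrable (eball r) (EFin \o (fun y => F (tsq (tsub x y)))).
Proof.
move=> r0; have ir := integrable_radial mF dF x r0 (tau := 1%R).
have : (`|1%R : R| <= 2)%R by rewrite normr1 ler1n.
move=> /ir; apply: eq_integrable; first exact: measurable_eball.
move=> y _ /=; congr (F (tsq _))%:E.
by apply: eq_from_tnth => i; rewrite !tnth_mktuple mul1r.
Qed.

Lemma bavg_profileE n (x : n.+1.-tuple R) (r : R) : (0 < r)%R ->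
  bavg r (F \o tsq) x =
  ((\int[@lebesgue_nd R n.+1]_(y in eball r) F (tsq (tsub x y)))
     / (bv n * r ^+ n.+1))%R%:E.
Proof.
move=> r0; have V0 : (0 < bv n * r ^+ n.+1)%R.
  by rewrite mulr_gt0 ?bvol_gt0 ?exprn_gt0.
rewrite /bavg measure_eball// inver gt_eqF// EFinM [RHS]muleC; congr (_ * _).
rewrite /Rintegral fineK//.
apply: integrable_fin_num; first exact: measurable_eball.
exact: integrable_profile_tsub.
Qed.

Lemma bavg_ge n (x : n.+1.-tuple R) (r kappa : R) : (0 < r)%R ->
  (forall z, eball r (tsub x z) -> (- kappa <= lap F1 F2 n.+1 (tsq z))%R) ->
  (F (tsq x))%:E <= bavg r (F \o tsq) x + (kappa * bump_ratio n r)%:E.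
Proof.
move=> r0 hk; have V0 : (0 < bv n * r ^+ n.+1)%R.
  by rewrite mulr_gt0 ?bvol_gt0 ?exprn_gt0.
rewrite bavg_profileE// -EFinD lee_fin.
have := mean_value_ge mF mF1 mF2 dF dF1 cF2 r0 hk.
rewrite -ler_pdivlMr// => /le_trans; apply.
rewrite mulrDl lerD2l /bump_ratio le_eqVlt; apply/orP; left; apply/eqP.
set V := (bv n * _)%R in V0 *.
by field; exact: lt0r_neq0.
Qed.

End bavg_profile.

Lemma bavg_le {R : realType} (F F1 F2 : R -> R) n (x : n.+1.-tuple R) (r : R) :
  measurable_fun setT F -> measurable_fun setT F1 -> measurable_fun setT F2 ->
  (forall s : R, (0 <= s)%R -> is_derive s (1%R : R) F (F1 s)) ->
  (forall s : R, (0 <= s)%R -> is_derive s (1%R : R) F1 (F2 s)) ->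
  (forall s : R, (0 <= s)%R -> {for s, continuous F2}) -> (0 < r)%R ->
  (forall s : R, (0 <= s)%R -> (lap F1 F2 n.+1 s <= 0)%R) ->
  bavg r (F \o tsq) x <= (F (tsq x))%:E.
Proof.
move=> mF mF1 mF2 dF dF1 cF2 r0 hl.
pose N (G : R -> R) s := (- G s)%R.
have mN G : measurable_fun setT G -> measurable_fun setT (N G).
  by move=> mG; exact: measurableT_comp.
have := @mean_value_ge R (N F) (N F1) (N F2) (mN _ mF) (mN _ mF1) (mN _ mF2) _ _ _ n x r r0 0%R.
rewrite bavg_profileE// lee_fin ler_pdivrMr; last first.
  by rewrite mulr_gt0 ?bvol_gt0 ?exprn_gt0.
have -> : (\int[@lebesgue_nd R n.+1]_(y in eball r) N F (tsq (tsub x y)) =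
   - \int[@lebesgue_nd R n.+1]_(y in eball r) F (tsq (tsub x y)))%R.
  rewrite -mulN1r -RintegralZl.
  - by apply: eq_Rintegral => y _; rewrite mulN1r.
  - exact: measurable_eball.
  exact: integrable_profile_tsub.
rewrite mul0r mul0r addr0 /N mulNr lerN2; apply.
- move=> s s0; have := dF s s0 => ?; exact: is_deriveN.
- move=> s s0; have := dF1 s s0 => ?; exact: is_deriveN.
- move=> s s0; apply: cvgN; exact: cF2.
- move=> z _; have := hl (tsq z) (tsq_ge0 z).
  by rewrite oppr0 -oppr_le0; congr (_ <= _)%R; rewrite /lap; ring.
Qed.

(** * The logarithmic and the Newtonian cutoffs *)

Section profiles.
Context {R : realType}.
Implicit Types s a b : R.

Let p1 s : (0 <= s)%R -> (0 < 1 + s)%R.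
Proof. by move=> s0; rewrite ltr_wpDr. Qed.

Lemma is_derive_ln1p s : (0 <= s)%R -> is_derive s (1%R : R) (fun s => ln (1 + s))%R (1 + s)^-1%R.
Proof.
move=> /p1 s0; have dl := is_derive1_ln s0.
have d1 : is_derive s (1%R : R) (fun s => 1 + s)%R 1%R.
  by apply: is_derive_eq; rewrite /GRing.scale/= add0r mulr1.
have := @is_derive1_comp R (@ln R) (fun s => 1 + s)%R s _ _ dl d1.
by rewrite mulr1.
Qed.

Lemma is_derive_inv1p s : (0 <= s)%R ->
  is_derive s (1%R : R) (fun s => (1 + s)^-1)%R (- (1 + s) ^- 2)%R.
Proof.
move=> /p1 s0.
have d1 : is_derive s (1%R : R) (fun s => 1 + s)%R 1%R.
  by apply: is_derive_eq; rewrite /GRing.scale/= add0r mulr1.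
apply: (@is_derive_eq _ _ _ _ _ _ _ _ (is_deriveV (lt0r_neq0 s0) d1)).
by rewrite /GRing.scale/= mulr1.
Qed.

Lemma measurable_inv : measurable_fun setT (fun s => s^-1)%R.
Proof.
have -> : [set: R] = [set~ 0%R] `|` [set 0%R] by rewrite setUC setUv.
apply/measurable_funU => //; first exact: measurableC.
split; last exact: measurable_fun_set1.
apply: open_continuous_measurable_fun.
  by apply: closed_openC; exact: closed_eq.
by move=> s; rewrite inE/= => /eqP s0; exact: inv_continuous.
Qed.

Lemma measurable_ln1p : measurable_fun setT (fun s => ln (1 + s))%R.
Proof. by apply: measurableT_comp; [exact: measurable_ln|exact: measurable_funD]. Qed.

Lemma measurable_inv1p : measurable_fun setT (fun s => (1 + s)^-1)%R.
Proof. by apply: measurableT_comp; [exact: measurable_inv|exact: measurable_funD]. Qed.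

Lemma continuous_inv1p s : (0 <= s)%R -> {for s, continuous (fun s => (1 + s)^-1)%R}.
Proof.
by move=> s0; have d := is_derive_inv1p s0; exact: continuous_at_derive d.
Qed.

Definition logW a s : R := (1 - a * ln (1 + s))%R.
Definition logW1 a s : R := (- a * (1 + s)^-1)%R.
Definition logW2 a s : R := (a * (1 + s)^-1 ^+ 2)%R.

Lemma is_derive_logW a s : (0 <= s)%R -> is_derive s (1%R : R) (logW a) (logW1 a s).
Proof.
move=> s0; have d := is_derive_ln1p s0.
by apply: is_derive_eq; rewrite /logW1 /GRing.scale/=; ring.
Qed.

Lemma is_derive_logW1 a s : (0 <= s)%R -> is_derive s (1%R : R) (logW1 a) (logW2 a s).
Proof.
move=> s0; have d := is_derive_inv1p s0.
by apply: is_derive_eq; rewrite /logW2 exprVn /GRing.scale/=; ring.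
Qed.

Lemma measurable_logW a : [/\ measurable_fun setT (logW a),
  measurable_fun setT (logW1 a) & measurable_fun setT (logW2 a)].
Proof.
split.
- by apply: measurable_funB => //; apply: measurable_funM => //; exact: measurable_ln1p.
- by apply: measurable_funM => //; exact: measurable_inv1p.
- by apply: measurable_funM => //; apply: measurable_funX; exact: measurable_inv1p.
Qed.

Lemma continuous_logW2 a s : (0 <= s)%R -> {for s, continuous (logW2 a)}.
Proof.
move=> s0; apply: cvgM; first exact: cvg_cst.
rewrite [X in _ --> X]expr2; under eq_fun do rewrite expr2.
by apply: cvgM; exact: continuous_inv1p.
Qed.

(** The Laplacian of ln (1 + |x|^2) is (2 n + (2 n - 4) s) / (1 + s)^2; the
    coefficient of s is nonpositive exactly when n <= 2. *)
Lemma lap_logW_ge n a s : (n <= 2)%N -> (0 <= a)%R -> (0 <= s)%R ->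
  (- (4 * a * (1 + s) ^- 2) <= lap (logW1 a) (logW2 a) n s)%R.
Proof.
move=> n2 a0 s0; have s1 := p1 s0.
have nR : (n%:R <= 2 :> R)%R by rewrite ler_nat.
have n0 : (0 <= n%:R :> R)%R by rewrite ler0n.
rewrite -subr_ge0 (_ : (_ - _ = a * (1 + s) ^- 2 * (2 * (2 - n%:R) * (1 + s)))%R).
  by rewrite mulr_ge0 ?mulr_ge0 ?invr_ge0 ?exprn_ge0 ?subr_ge0// ltW.
by rewrite /lap /logW1 /logW2; field; exact: lt0r_neq0.
Qed.

(** (1 + s)^(-b), a smooth substitute for the Newtonian potential when
    b = (n - 2) / 2. *)
Definition newton b s : R := expR (- b * ln (1 + s)).
Definition newton1 b s : R := (- b * (1 + s)^-1 * newton b s)%R.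
Definition newton2 b s : R := (b * (b + 1) * (1 + s)^-1 ^+ 2 * newton b s)%R.

Lemma newton_gt0 b s : (0 < newton b s)%R. Proof. exact: expR_gt0. Qed.

Lemma is_derive_newton b s : (0 <= s)%R -> is_derive s (1%R : R) (newton b) (newton1 b s).
Proof.
move=> s0; have d := is_derive_ln1p s0.
have dl : is_derive s (1%R : R) (fun s => - b * ln (1 + s))%R (- b * (1 + s)^-1)%R.
  by apply: is_derive_eq; rewrite /GRing.scale/=; ring.
rewrite /newton1 mulrC.
exact: (@is_derive1_comp R (@expR R) (fun s => - b * ln (1 + s))%R).
Qed.

Lemma is_derive_newton1 b s : (0 <= s)%R -> is_derive s (1%R : R) (newton1 b) (newton2 b s).
Proof.
move=> s0; have d := is_derive_inv1p s0; have dn := is_derive_newton b s0.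
apply: is_derive_eq; rewrite /newton2 /newton1 exprVn /GRing.scale/=.
by field; exact: lt0r_neq0 (p1 s0).
Qed.

Lemma measurable_newton b : [/\ measurable_fun setT (newton b),
  measurable_fun setT (newton1 b) & measurable_fun setT (newton2 b)].
Proof.
have m0 : measurable_fun setT (newton b).
  apply: measurableT_comp => //; apply: measurable_funM => //; exact: measurable_ln1p.
split => //.
- by apply: measurable_funM => //; apply: measurable_funM => //; exact: measurable_inv1p.
- apply: measurable_funM => //; apply: measurable_funM => //.
  by apply: measurable_funX; exact: measurable_inv1p.
Qed.

Lemma continuous_newton2 b s : (0 <= s)%R -> {for s, continuous (newton2 b)}.
Proof.
move=> s0; apply: cvgM; last exact: (continuous_at_derive (is_derive_newton b s0)).
apply: cvgM; first exact: cvg_cst.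
rewrite [X in _ --> X]expr2; under eq_fun do rewrite expr2.
by apply: cvgM; exact: continuous_inv1p.
Qed.

Lemma lap_newton n b s : (2 * b = n%:R - 2)%R -> (0 <= s)%R ->
  lap (newton1 b) (newton2 b) n s = (- (2 * b * n%:R * (1 + s)^-1 ^+ 2 * newton b s))%R.
Proof.
move=> bn s0; rewrite /lap /newton1 /newton2.
have -> : (n%:R = 2 * b + 2)%R by rewrite bn subrK.
by field; exact: lt0r_neq0 (p1 s0).
Qed.

Lemma newton_le1 b s : (0 <= b)%R -> (0 <= s)%R -> (newton b s <= 1)%R.
Proof.
by move=> b0 s0; rewrite -expR0 ler_expR mulNr oppr_le0 mulr_ge0// ln_ge0// lerDl.
Qed.

Lemma newton_anti b s t : (0 <= b)%R -> (0 <= s <= t)%R -> (newton b t <= newton b s)%R.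
Proof.
move=> b0 /andP[s0 st]; rewrite ler_expR !mulNr lerN2 ler_wpM2l//.
by rewrite ler_ln ?posrE ?p1 ?lerD2l// (le_trans s0).
Qed.

(** The coefficient k is meant to be 1 / rho^2: the term k s confines the region
    where the profile is positive to s < 2 rho^2, and costs only 2 n k in the
    Laplacian. *)
Definition tentW b k s : R := (2 - newton b s - k * s)%R.
Definition tentW1 b k s : R := (- newton1 b s - k)%R.
Definition tentW2 b s : R := (- newton2 b s)%R.

Lemma is_derive_tentW b k s : (0 <= s)%R -> is_derive s (1%R : R) (tentW b k) (tentW1 b k s).
Proof.
move=> s0; have d := is_derive_newton b s0.
by apply: is_derive_eq; rewrite /tentW1 /GRing.scale/=; ring.
Qed.

Lemma is_derive_tentW1 b k s : (0 <= s)%R -> is_derive s (1%R : R) (tentW1 b k) (tentW2 b s).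
Proof.
move=> s0; have d := is_derive_newton1 b s0.
by apply: is_derive_eq; rewrite /tentW2 subr0.
Qed.

Lemma measurable_tentW b k : [/\ measurable_fun setT (tentW b k),
  measurable_fun setT (tentW1 b k) & measurable_fun setT (tentW2 b)].
Proof.
have [m0 m1 m2] := measurable_newton b; split.
- by apply: measurable_funB; [exact: measurable_funB|exact: measurable_funM].
- by apply: measurable_funB => //; exact: measurableT_comp.
- exact: measurableT_comp.
Qed.

Lemma continuous_tentW2 b s : (0 <= s)%R -> {for s, continuous (tentW2 b)}.
Proof. by move=> s0; apply: cvgN; exact: continuous_newton2. Qed.

Lemma lap_tentW n b k s : (2 * b = n%:R - 2)%R -> (0 <= s)%R ->
  lap (tentW1 b k) (tentW2 b) n s =
  (2 * b * n%:R * (1 + s)^-1 ^+ 2 * newton b s - 2 * n%:R * k)%R.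
Proof.
move=> bn s0; rewrite -[X in (X - _)%R]opprK -(lap_newton bn s0) /lap /tentW1 /tentW2.
by ring.
Qed.

End profiles.

Section cutoffs.
Context {R : realType}.
Implicit Types (a k r : R).

Definition logcut n a : n.-tuple R -> R := cube (logW a) \o tsq.

(** On the ball of radius r about x the weight (1 + |z|^2)^(-2) is at most
    4 (1 + r^2)^2 times its value at x. *)
Lemma logcut_sub n a r (x : n.+1.-tuple R) : (n.+1 <= 2)%N -> (0 <= a)%R -> (0 < r)%R ->
  (logcut a x)%:E <= bavg r (@logcut n.+1 a) x +
    (48 * (1 + r ^+ 2) ^+ 2 * bump_ratio n r * a * (1 + tsq x) ^- 2)%R%:E.
Proof.
move=> n2 a0 r0; have [mW mW1 mW2] := measurable_logW a.
have [mF [mF1 mF2]] := measurable_cube mW mW1 mW2.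
have dW := is_derive_logW a; have dW1 := is_derive_logW1 a.
have cW2 := @continuous_logW2 R a.
have X0 : (0 < 1 + tsq x)%R by rewrite ltr_wpDr// tsq_ge0.
have := @bavg_ge R _ _ _ mF mF1 mF2 (is_derive_cube dW)
  (is_derive_cube1 dW dW1) (continuous_cube2 dW dW1 cW2) n x r
  (48 * (1 + r ^+ 2) ^+ 2 * a * (1 + tsq x) ^- 2)%R r0.
rewrite [X in _ -> _ <= _ + X%:E](_ : _ = (48 * (1 + r ^+ 2) ^+ 2 * a *
   (1 + tsq x) ^- 2 * bump_ratio n r)%R); last by ring.
apply => z zr.
have s0 := tsq_ge0 z.
have Z0 : (0 < 1 + tsq z)%R by rewrite ltr_wpDr.
have xz : (1 + tsq x <= 2 * (1 + r ^+ 2) * (1 + tsq z))%R.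
  have h := tnorm_le_tsub x z.
  have : (tsq x <= 2 * tsq z + 2 * r ^+ 2)%R.
    rewrite -!tnorm_sqr.
    apply: (@le_trans _ _ ((tnorm z + r) ^+ 2)%R).
      rewrite ler_pXn2r ?nnegrE ?addr_ge0 ?tnorm_ge0//; last exact: ltW.
      by apply: (le_trans h); rewrite lerD2l ltW.
    have := sqr_ge0 (tnorm z - r)%R; nra.
  have := sqr_ge0 r; nra.
have xz2 : ((1 + tsq z) ^- 2 <= 4 * (1 + r ^+ 2) ^+ 2 * (1 + tsq x) ^- 2)%R.
  rewrite -[leLHS]mul1r ler_pdivrMr ?exprn_gt0// mulrAC ler_pdivlMr ?exprn_gt0// mul1r.
  have -> : (4 * (1 + r ^+ 2) ^+ 2 * (1 + tsq z) ^+ 2 =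
     (2 * (1 + r ^+ 2) * (1 + tsq z)) ^+ 2)%R by ring.
  by rewrite ler_pXn2r// ?nnegrE ltW// (lt_le_trans X0).
apply: le_trans (lap_cube _ _ _ n.+1 s0).
have lw := lap_logW_ge n2 a0 s0.
have pw0 := pos_ge0 (logW a (tsq z)).
have pw1 : (pos (logW a (tsq z)) <= 1)%R.
  rewrite ge_max ler01 andbT /logW gerBl mulr_ge0// ln_ge0// lerDl//.
have pw2 : (0 <= pos (logW a (tsq z)) ^+ 2 <= 1)%R by rewrite sqr_ge0 expr_le1.
apply: (@le_trans _ _ (3 * pos (logW a (tsq z)) ^+ 2 * - (4 * a * (1 + tsq z) ^- 2)))%R.
  rewrite mulrN lerN2.
  apply: (@le_trans _ _ (3 * (4 * a * (4 * (1 + r ^+ 2) ^+ 2 * (1 + tsq x) ^- 2))))%R; last first.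
    by rewrite le_eqVlt; apply/orP; left; apply/eqP; ring.
  have i0 : (0 <= (1 + tsq z) ^- 2)%R by rewrite invr_ge0 exprn_ge0// ltW.
  case/andP: pw2 => pw20 pw21.
  rewrite ler_pM ?mulr_ge0//.
    by rewrite -[leRHS]mulr1 ler_wpM2l.
  by rewrite ler_wpM2l// mulr_ge0.
by rewrite ler_wpM2l// mulr_ge0// sqr_ge0.
Qed.

Definition tentcut n b k : n.-tuple R -> R := cube (tentW b k) \o tsq.

(** A lower bound, for |x| <= 2, of minus the Laplacian of [newton b] when
    b = (n - 1) / 2 in dimension n + 1. *)
Definition tent_gain n b : R := (2 * b * n.+1%:R * 5^-1 ^+ 2 * newton b 4)%R.

(** For x in the unit ball, the ball of radius 1 about x stays within |z| <= 2,
    where the profile is at least 1 / 2 and the Newtonian term contributes at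
    least [tent_gain].  The loss comes from the term k s of the profile, which is
    at most 2. *)
Lemma tentcut_sub n b k (x : n.+1.-tuple R) : (2 * b = n.+1%:R - 2)%R -> (0 <= b)%R ->
  (0 <= k)%R -> (8 * k <= 1)%R ->
  (tentcut b k x)%:E + ((3 / 4 * tent_gain n b * bump_ratio n 1) * \1_(eball 1) x)%R%:E <=
  bavg 1 (@tentcut n.+1 b k) x + (24 * n.+1%:R * k * bump_ratio n 1)%R%:E.
Proof.
move=> bn b0 k0 k8; pose h := tent_gain n b; rewrite -/h.
have [mW mW1 mW2] := measurable_tentW b k.
have [mF [mF1 mF2]] := measurable_cube mW mW1 mW2.
have dW := is_derive_tentW b k; have dW1 := is_derive_tentW1 b k.
have cW2 := @continuous_tentW2 R b.
have B0 : (0 <= bump_ratio n (1 : R))%R by rewrite ltW// bump_ratio_gt0.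
have := @bavg_ge R _ _ _ mF mF1 mF2 (is_derive_cube dW)
  (is_derive_cube1 dW dW1) (continuous_cube2 dW dW1 cW2) n x 1
  (24 * n.+1%:R * k - 3 / 4 * h * \1_(eball 1) x)%R ltr01.
rewrite mulrBl EFinB addeA leeBrDr//.
rewrite (_ : (3 / 4 * h * \1_(eball 1) x * bump_ratio n 1 =
   3 / 4 * h * bump_ratio n 1 * \1_(eball 1) x)%R); last by ring.
apply => z zr; have s0 := tsq_ge0 z.
apply: le_trans (lap_cube _ _ _ n.+1 s0).
rewrite lap_tentW//.
set p := pos _; set g := (_ * newton b (tsq z))%R.
have nw0 := ltW (newton_gt0 b (tsq z)).
have g0 : (0 <= g)%R.
  apply: mulr_ge0 => //; apply: mulr_ge0; last exact: sqr_ge0.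
  by rewrite mulr_ge0// mulr_ge0.
have p0 : (0 <= p)%R by exact: pos_ge0.
have p2 : (p <= 2)%R.
  rewrite /p ge_max ler0n andbT /tentW.
  have := mulr_ge0 k0 s0; lra.
have pp : (p ^+ 2 <= 4)%R by nra.
have pp0 := sqr_ge0 p.
have nk : (0 <= n.+1%:R * k)%R by rewrite mulr_ge0.
rewrite indicE; have [xin|xin] := boolP (x \in eball 1); last first.
  by rewrite mulr0 subr0; nra.
rewrite mulr1.
have xB : eball 1 x by move: xin; rewrite inE.
have zn : (tnorm z <= 2)%R.
  have := tnorm_le_tsub z x; rewrite tnorm_tsubC.
  move: zr xB; rewrite !eballE; lra.
have z4 : (tsq z <= 4)%R by rewrite -tnorm_sqr; have := tnorm_ge0 z; nra.
have ph : (1 / 2 <= p)%R.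
  apply: (@le_trans _ _ (tentW b k (tsq z))); last by rewrite le_max lexx.
  rewrite /tentW; have := newton_le1 b0 s0; nra.
have ph2 : (1 / 4 <= p ^+ 2)%R by nra.
have gh : (h <= g)%R.
  rewrite /h /tent_gain /g ler_pM ?mulr_ge0 ?sqr_ge0// ?(ltW (newton_gt0 _ _))//; last first.
    by apply: newton_anti; rewrite ?s0.
  rewrite ler_wpM2l ?mulr_ge0// ler_pXn2r ?nnegrE ?invr_ge0 ?addr_ge0//.
  by rewrite lef_pV2 ?posrE ?ltr_wpDr//; lra.
nra.
Qed.

End cutoffs.

(** * Functions superharmonic in the mean *)

Section nonneg_integrals.
Context d (T : measurableType d) {R : realType} (mu : {measure set T -> \bar R}).
Implicit Types f g : T -> R.

Lemma measurable_EFinR f : measurable_fun setT f ->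
  measurable_fun setT (fun x => (f x)%:E).
Proof. by move=> mf; apply: measurableT_comp. Qed.

Lemma integral_leR f g : measurable_fun setT f -> measurable_fun setT g ->
  (forall x, (0 <= f x)%R) -> (forall x, (f x <= g x)%R) ->
  \int[mu]_x (f x)%:E <= \int[mu]_x (g x)%:E.
Proof.
move=> mf mg f0 fg; apply: ge0_le_integral.
- exact: measurableT.
- by move=> x _; rewrite lee_fin.
- exact: measurable_EFinR.
- exact: measurable_EFinR.
- by move=> x _; rewrite lee_fin.
Qed.

Lemma integral_DR f g : measurable_fun setT f -> measurable_fun setT g ->
  (forall x, (0 <= f x)%R) -> (forall x, (0 <= g x)%R) ->
  \int[mu]_x (f x + g x)%:E = \int[mu]_x (f x)%:E + \int[mu]_x (g x)%:E.
Proof.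
move=> mf mg f0 g0; under eq_integral do rewrite EFinD.
apply: ge0_integralD.
- exact: measurableT.
- by move=> x _; rewrite lee_fin.
- exact: measurable_EFinR.
- by move=> x _; rewrite lee_fin.
- exact: measurable_EFinR.
Qed.

Lemma integral_ZR c f : (0 <= c)%R -> measurable_fun setT f ->
  (forall x, (0 <= f x)%R) ->
  \int[mu]_x (c * f x)%:E = c%:E * \int[mu]_x (f x)%:E.
Proof.
move=> c0 mf f0; under eq_integral do rewrite EFinM.
apply: ge0_integralZl.
- exact: measurableT.
- exact: measurable_EFinR.
- by move=> x _; rewrite lee_fin.
- by rewrite lee_fin.
Qed.

Lemma ae_exists (P : T -> Prop) (A : set T) : measurable A -> 0 < mu A ->
  {ae mu, forall x, P x} -> exists2 x, A x & P x.
Proof.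
move=> mA A0 [N [mN N0 PN]]; apply: contrapT => h.
have AN : A `<=` N.
  by move=> x Ax; apply: PN => /= Px; apply: h; exists x.
have : mu A <= mu N by apply: le_measure; rewrite ?inE.
by rewrite N0 leNgt A0.
Qed.

Lemma integral_eq0_ae f : measurable_fun setT f -> (forall x, (0 <= f x)%R) ->
  \int[mu]_x (f x)%:E = 0 -> {ae mu, forall x, f x = 0%R}.
Proof.
move=> mf f0 If.
have mfE : measurable_fun setT (EFin \o f) by exact: measurable_EFinR.
have [+ _] := ae_eq_integral_abs mu measurableT mfE.
have -> : \int[mu]_x `|(EFin \o f) x| = 0.
  by rewrite -[RHS]If; apply: eq_integral => x _ /=; rewrite ger0_norm.
move=> /(_ erefl); apply: filterS => x /= /(_ I) []; exact.
Qed.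

End nonneg_integrals.

Section supersolution.
Context {R : realType} {n : nat}.
Local Notation nd := (@lebesgue_nd R n).
Local Notation bv := (@bvol R n).
Implicit Types (r : R) (x y z : n.-tuple R) (u k : n.-tuple R -> R).

Lemma measurable_bavg r u : (0 < r)%R -> measurable_fun setT u ->
  (forall x, (0 <= u x)%R) -> measurable_fun setT (bavg r u).
Proof.
move=> r0 mu u0.
have msub : measurable_fun setT (fun p : n.-tuple R * n.-tuple R => tsub p.1 p.2).
  by apply: measurable_mktuple => i; apply: measurable_funB => //;
    apply: (measurableT_comp (measurable_tnth i)).
have mF : measurable_fun setT (fun p : n.-tuple R * n.-tuple R =>
    (\1_(eball r) (tsub p.1 p.2) * u p.2)%:E).
  apply: measurable_EFinR; apply: measurable_funM; last exact: (measurableT_comp mu).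
  apply: (measurableT_comp _ msub).
  by apply: measurable_indic; exact: measurable_eball.
have mG := @measurable_fun_fubini_tonelli_F _ _ _ _ _ nd _ mF
  (fun p => ltac:(by rewrite lee_fin mulr_ge0// indicE)).
rewrite (_ : bavg r u = fun x => (bv * r ^+ n)^-1%:E *
    \int[nd]_y (\1_(eball r) (tsub x y) * u y)%:E).
  by apply: measurable_funeM.
by apply/funext => x; rewrite bavgE.
Qed.

Lemma bavg_ge0 r u x : (0 < r)%R -> (forall x, (0 <= u x)%R) -> 0 <= bavg r u x.
Proof.
move=> r0 u0; apply: mule_ge0.
  rewrite measure_eball// inver gt_eqF ?lee_fin ?mulr_gt0 ?bvol_gt0 ?exprn_gt0//.
  by rewrite invr_ge0 ltW// mulr_gt0 ?bvol_gt0 ?exprn_gt0.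
by apply: integral_ge0 => y _; rewrite lee_fin.
Qed.

Variable g : n.-tuple R -> R.
Hypothesis mg : measurable_fun setT g.
Hypothesis g0 : forall x, (0 <= g x)%R.

Definition supersol x := forall r, (0 < r)%R -> bavg r g x <= (g x)%:E.
Hypothesis hsup : {ae nd, forall x, supersol x}.

Lemma supersol_ball x r : supersol x -> (0 < r)%R ->
  \int[nd]_y (\1_(eball r) (tsub x y) * g y)%:E <= (bv * r ^+ n * g x)%:E.
Proof.
move=> sx r0; have := sx r r0; rewrite bavgE//.
have V0 : (0 < bv * r ^+ n)%R by rewrite mulr_gt0 ?bvol_gt0 ?exprn_gt0.
rewrite -(@lee_pmul2l _ (bv * r ^+ n)%:E) ?ltry//.
by rewrite muleA -!EFinM mulfV ?gt_eqF// mul1e.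
Qed.

Lemma measurable_indic_mul (E : set (n.-tuple R)) : measurable E ->
  measurable_fun setT (fun y => \1_E y * g y)%R.
Proof. by move=> mE; apply: measurable_funM => //; exact: measurable_indic. Qed.

Lemma indic_mul_ge0 (E : set (n.-tuple R)) y : (0 <= \1_E y * g y)%R.
Proof. by rewrite mulr_ge0// indicE. Qed.

Lemma measurable_tsub_indic_mul x r :
  measurable_fun setT (fun y => \1_(eball r) (tsub x y) * g y)%R.
Proof.
apply: measurable_funM => //; apply: measurableT_comp (measurable_tsub x).
by apply: measurable_indic; exact: measurable_eball.
Qed.

Lemma le_indic (A B : set (n.-tuple R)) y z : (A y -> B z) -> (\1_A y <= \1_B z :> R)%R.
Proof.
move=> AB; rewrite !indicE ler_nat.
have [yA|//] := boolP (y \in A).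
by have := AB (set_mem yA) => /mem_set ->.
Qed.

Lemma supersol_eball x r : supersol x -> (0 < r)%R ->
  \int[nd]_y (\1_(eball r) y * g y)%:E <= (bv * (r + tnorm x) ^+ n * g x)%:E.
Proof.
move=> sx r0; have r1 : (0 < r + tnorm x)%R by rewrite ltr_wpDr ?tnorm_ge0.
apply: le_trans (supersol_ball sx r1); apply: integral_leR.
- exact: measurable_indic_mul (measurable_eball r).
- exact: measurable_tsub_indic_mul.
- exact: indic_mul_ge0.
- move=> y; apply: ler_wpM2r => //; apply: le_indic; rewrite !eballE => h.
  by rewrite (le_lt_trans (tnorm_tsub_le x y))// addrC ltrD2r.
Qed.

Lemma measure_nd_gt0 : 0 < nd setT.
Proof.
have /andP[h _] := @eball1_bounds R n.
by apply: (lt_le_trans h); apply: le_measure; rewrite ?inE//; exact: measurable_eball.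
Qed.

(** If the integral vanishes then E contains a zero x of g at which [supersol]
    holds, and there the average of g over every ball about x is at most 0. *)
Lemma supersol_dichotomy (E : set (n.-tuple R)) : measurable E -> 0 < nd E ->
  \int[nd]_y (\1_E y * g y)%:E = 0 -> {ae nd, forall x, g x = 0%R}.
Proof.
move=> mE E0 gE.
have ae0 := integral_eq0_ae (measurable_indic_mul mE) (indic_mul_ge0 E) gE.
have aeb : {ae nd, forall x, supersol x /\ (\1_E x * g x = 0)%R}.
  by apply: filterS2 hsup ae0 => x ? ?; split.
have [x Ex [sx gx]] := ae_exists mE E0 aeb.
have gx0 : g x = 0%R.
  by move: gx; rewrite indicE mem_set// mul1r.
have balls (j : nat) : {ae nd, forall y, (\1_(eball j.+1%:R) (tsub x y) * g y = 0)%R}.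
  apply: integral_eq0_ae.
  - exact: measurable_tsub_indic_mul.
  - by move=> y; rewrite mulr_ge0// indicE.
  apply/eqP; rewrite eq_le integral_ge0 ?andbT; last first.
    by move=> y _; rewrite lee_fin mulr_ge0// indicE.
  have := supersol_ball sx (ltr0Sn R j).
  by rewrite gx0 mulr0.
have := ae_foralln balls; apply: filterS => y hy.
have := archi_boundP (tnorm_ge0 (tsub x y)).
set j := Num.bound _ => hj.
have := hy j; rewrite indicE mem_set ?mul1r//.
by rewrite eballE (lt_trans hj)// ltr_nat.
Qed.

(** The hypothesis is integrated against g and the average is moved from u to g by
    symmetry.  The integral of u times the average of g is finite because that of
    u g is, and cancels. *)
Lemma supersol_test u k1 k2 r : (0 < r)%R ->
  measurable_fun setT u -> (forall x, (0 <= u x)%R) ->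
  measurable_fun setT k1 -> (forall x, (0 <= k1 x)%R) ->
  measurable_fun setT k2 -> (forall x, (0 <= k2 x)%R) ->
  (forall x, (u x + k2 x)%:E <= bavg r u x + (k1 x)%:E) ->
  \int[nd]_x (u x * g x)%:E < +oo ->
  \int[nd]_x (k2 x * g x)%:E +
  \int[nd]_x (u x * Num.max (g x - fine (bavg r g x)) 0)%:E <=
  \int[nd]_x (k1 x * g x)%:E.
Proof.
move=> r0 mu u0 mk1 k10 mk2 k20 huk ugoo.
pose a x := fine (bavg r g x).
pose e x := Num.max (g x - a x)%R 0%R.
have mb := measurable_bavg r0 mg g0.
have ma : measurable_fun setT a by apply: measurableT_comp mb.
have a0 x : (0 <= a x)%R by rewrite fine_ge0// bavg_ge0.
have me : measurable_fun setT e by apply: measurable_maxr => //; exact: measurable_funB.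
have e0 x : (0 <= e x)%R by rewrite le_max lexx orbT.
have mub := measurable_bavg r0 mu u0.
have I1 : \int[nd]_x (u x * g x)%:E + \int[nd]_x (k2 x * g x)%:E <=
    \int[nd]_x ((u x)%:E * bavg r g x) + \int[nd]_x (k1 x * g x)%:E.
  rewrite integral_bavgC// -integral_DR; last 4 first.
  - exact: measurable_funM.
  - exact: measurable_funM.
  - by move=> x; rewrite mulr_ge0.
  - by move=> x; rewrite mulr_ge0.
  rewrite -ge0_integralD; last 5 first.
  - exact: measurableT.
  - by move=> x _; rewrite mule_ge0 ?lee_fin// bavg_ge0.
  - by apply: emeasurable_funM => //; exact: measurable_EFinR.
  - by move=> x _; rewrite lee_fin mulr_ge0.
  - by apply: measurable_EFinR; exact: measurable_funM.
  apply: ge0_le_integral.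
  - exact: measurableT.
  - by move=> x _; rewrite lee_fin addr_ge0// mulr_ge0.
  - by apply: measurable_EFinR; apply: measurable_funD; exact: measurable_funM.
  - apply: emeasurable_funD.
      by apply: emeasurable_funM => //; exact: measurable_EFinR.
    by apply: measurable_EFinR; exact: measurable_funM.
  - move=> x _; rewrite -mulrDl mulrC EFinM [in leRHS]mulrC EFinM -muleDr//.
    by apply: lee_wpmul2l; rewrite ?lee_fin.
    by rewrite fin_num_adde_defl.
have I2 : \int[nd]_x (u x * g x)%:E =
    \int[nd]_x ((u x)%:E * bavg r g x) + \int[nd]_x (u x * e x)%:E.
  rewrite -ge0_integralD; last 5 first.
  - exact: measurableT.
  - by move=> x _; rewrite mule_ge0 ?lee_fin// bavg_ge0.
  - by apply: emeasurable_funM => //; exact: measurable_EFinR.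
  - by move=> x _; rewrite lee_fin mulr_ge0.
  - by apply: measurable_EFinR; exact: measurable_funM.
  apply: ae_eq_integral.
  - exact: measurableT.
  - by apply: measurable_EFinR; exact: measurable_funM.
  - apply: emeasurable_funD.
      by apply: emeasurable_funM => //; exact: measurable_EFinR.
    by apply: measurable_EFinR; exact: measurable_funM.
  apply: filterS hsup => x /(_ r r0) sx _.
  have bf : bavg r g x = (a x)%:E.
    rewrite /a fineK// ge0_fin_numE ?bavg_ge0//; exact: le_lt_trans sx (ltry _).
  have ag : (a x <= g x)%R by rewrite -lee_fin -bf.
  by rewrite bf /e max_l ?subr_ge0// -EFinM -EFinD -mulrDr addrC subrK.
have bfin : \int[nd]_x ((u x)%:E * bavg r g x) \is a fin_num.
  rewrite ge0_fin_numE; last first.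
    by apply: integral_ge0 => x _; rewrite mule_ge0 ?lee_fin// bavg_ge0.
  apply: le_lt_trans ugoo; rewrite I2 leeDl//.
  by apply: integral_ge0 => x _; rewrite lee_fin mulr_ge0.
move: I1; rewrite I2 -addeA leeD2lE// addeC; exact.
Qed.

End supersolution.

(** * Constancy in dimensions one and two *)

Section low_dimension.
Context {R : realType} {n : nat}.
Hypothesis n2 : (n.+1 <= 2)%N.
Local Notation nd := (@lebesgue_nd R n.+1).
Local Notation bv := (@bvol R n.+1).
Implicit Types (r a : R) (x y z : n.+1.-tuple R).
Variable g : n.+1.-tuple R -> R.
Hypothesis mg : measurable_fun setT g.
Hypothesis g0 : forall x, (0 <= g x)%R.
Hypothesis hsup : {ae nd, forall x, supersol g x}.

Let bv0 : (0 <= bv)%R. Proof. by rewrite ltW// bvol_gt0. Qed.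

Let ball_int_le : exists2 D : R, (0 <= D)%R & forall r, (1 <= r)%R ->
  \int[nd]_y (\1_(eball r) y * g y)%:E <= (D * r ^+ 2)%:E.
Proof.
have [x0 _ sx0] := ae_exists measurableT (@measure_nd_gt0 R n.+1) hsup.
exists (bv * (1 + tnorm x0) ^+ 2 * g x0)%R.
  by rewrite mulr_ge0// mulr_ge0// sqr_ge0.
move=> r r1; have r0 : (0 < r)%R by exact: lt_le_trans r1.
apply: (le_trans (supersol_eball mg g0 sx0 r0)); rewrite lee_fin.
rewrite [leRHS]mulrAC ler_wpM2r// -mulrA ler_wpM2l//.
rewrite -exprMn; have t0 := tnorm_ge0 x0.
apply: (@le_trans _ _ (((1 + tnorm x0) * r) ^+ n.+1)%R).
  rewrite ler_pXn2r ?nnegrE//; [nra|nra|nra].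
apply: ler_weXn2l => //; nra.
Qed.

Let kk x : R := ((1 + tsq x) ^- 2)%R.

Let kk01 x : (0 <= kk x <= 1)%R.
Proof.
have X1 : (1 <= 1 + tsq x)%R by rewrite lerDl tsq_ge0.
have X0 : (0 < 1 + tsq x)%R by exact: lt_le_trans X1.
rewrite /kk invr_ge0 exprn_ge0 ?(ltW X0)//= invf_le1 ?exprn_gt0//.
by rewrite exprn_ege1.
Qed.

Let mkk : measurable_fun setT kk.
Proof.
apply: (measurableT_comp (f := fun s : R => s^-1)%R); first exact: measurable_inv.
by apply: measurable_funX; apply: measurable_funD => //; exact: measurable_tsq.
Qed.

Let mI r : measurable_fun setT (\1_(@eball R n.+1 r) : _ -> R).
Proof. by apply: measurable_indic; exact: measurable_eball. Qed.

Let I0 r x : (0 <= \1_(@eball R n.+1 r) x :> R)%R.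
Proof. by rewrite indicE. Qed.

(** On the dyadic shell 2^J <= |y| < 2^(J + 1) the weight is at most 16^(-J),
    while the integral of g over the ball is O(4^J) because n <= 2; induction on J
    sums the resulting geometric series. *)
Let weighted_int_le : exists2 D : R, (0 <= D)%R & forall J : nat,
  \int[nd]_y (\1_(eball (2 ^+ J)) y * kk y * g y)%:E <= D%:E.
Proof.
have [D D0 hD] := ball_int_le.
exists (D + 8 * D)%R; first by rewrite addr_ge0// mulr_ge0.
have mIg r : measurable_fun setT (fun y => \1_(eball r) y * g y)%R.
  exact: measurable_funM.
have mIkg r : measurable_fun setT (fun y => \1_(eball r) y * kk y * g y)%R.
  by apply: measurable_funM => //; exact: measurable_funM.
have Ig0 r y : (0 <= \1_(eball r) y * g y)%R by rewrite mulr_ge0.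
have Ikg0 r y : (0 <= \1_(eball r) y * kk y * g y)%R.
  by rewrite !mulr_ge0//; have /andP[] := kk01 y.
(* the partial sums 8 D (1 - 4^(-J)) absorb the shell terms 4 D 4^(-J) *)
suff main J : \int[nd]_y (\1_(eball (2 ^+ J)) y * kk y * g y)%:E <=
    (D + 8 * D * (1 - 4 ^- J))%:E.
  move=> J; apply: (le_trans (main J)); rewrite lee_fin lerD2l.
  by rewrite ler_piMr ?mulr_ge0// gerBl invr_ge0 exprn_ge0.
elim: J => [|J IH].
  rewrite expr0 invr1 subrr mulr0 addr0.
  have := hD 1%R (lexx _); rewrite expr1n mulr1; apply: le_trans.
  apply: integral_leR => // y; rewrite ler_wpM2r// ler_piMr//.
  by have /andP[] := kk01 y.
have step : \int[nd]_y (\1_(eball (2 ^+ J.+1)) y * kk y * g y)%:E <=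
   \int[nd]_y (\1_(eball (2 ^+ J)) y * kk y * g y)%:E +
   (16 ^- J)%:E * \int[nd]_y (\1_(eball (2 ^+ J.+1)) y * g y)%:E.
  have c0 : (0 <= 16 ^- J :> R)%R by rewrite invr_ge0 exprn_ge0.
  rewrite -integral_ZR// -integral_DR//; last 2 first.
  - exact: measurable_funM.
  - by move=> y; rewrite mulr_ge0.
  apply: integral_leR => //.
    by apply: measurable_funD => //; exact: measurable_funM.
  move=> y; rewrite [X in (_ <= _ + X)%R]mulrA -mulrDl ler_wpM2r//.
  have /andP[k0 k1] := kk01 y.
  have p2 : (0 < 2 ^+ J :> R)%R by rewrite exprn_gt0.
  have [yJ|yJ] := boolP (y \in @eball R n.+1 (2 ^+ J)).
    rewrite [X in (_ <= X * _ + _)%R]indicE yJ mul1r.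
    apply: ler_wpDr; first by rewrite mulr_ge0.
    by rewrite ler_piMl// indicE lern1 leq_b1.
  rewrite [X in (_ <= X * _ + _)%R]indicE (negbTE yJ) mul0r add0r mulrC ler_wpM2r//.
  have h : (2 ^+ J ^+ 2 <= tsq y)%R.
    rewrite leNgt; apply/negP => h; move/negP: yJ; apply.
    by apply/mem_set/eball_sq.
  rewrite /kk lef_pV2 ?posrE ?exprn_gt0 ?ltr_wpDr ?tsq_ge0//.
  rewrite (_ : (16 ^+ J = ((2 ^+ J) ^+ 2) ^+ 2 :> R)%R); last first.
    rewrite (_ : 16 = 2 ^+ 4 :> R)%R; last by rewrite -natrX.
    by rewrite -!exprM mulnC.
  rewrite ler_pXn2r ?nnegrE ?exprn_ge0 ?addr_ge0 ?tsq_ge0//.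
  by rewrite (le_trans h)// lerDr.
apply: (le_trans step).
have p1 : (1 <= 2 ^+ J.+1 :> R)%R by rewrite exprn_ege1// ler1n.
have c0 : (0 <= 16 ^- J :> R)%R by rewrite invr_ge0 exprn_ge0.
apply: (le_trans (leeD IH (lee_wpmul2l _ (hD _ p1)))); first by rewrite lee_fin.
rewrite -EFinM -EFinD lee_fin.
have -> : (16 ^- J * (D * 2 ^+ J.+1 ^+ 2) = 4 * D * 4 ^- J :> R)%R.
  rewrite (_ : 16 = 4 * 4 :> R)%R; last by rewrite -natrM.
  rewrite exprMn (exprS 2%R J) (_ : (2 * 2 ^+ J) ^+ 2 = 4 * 4 ^+ J :> R)%R; last first.
    rewrite exprMn -(exprM 2%R J 2) mulnC exprM.
    by rewrite (_ : 2 ^+ 2 = 4 :> R)%R// -natrX.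
  by field; rewrite expf_neq0// pnatr_eq0.
have -> : (4 ^- J.+1 = 4 ^- J / 4 :> R)%R by rewrite exprS invfM mulrC.
have q0 : (0 <= 4 ^- J :> R)%R by rewrite invr_ge0 exprn_ge0.
have := mulr_ge0 D0 q0; nra.
Qed.

Let logcut_support a : (0 < a)%R -> exists J : nat, forall x,
  ~ eball (2 ^+ J) x -> logcut a x = 0%R.
Proof.
move=> a0.
have [J hJ] : exists J : nat, (expR a^-1 <= 2 ^+ J :> R)%R.
  have := archi_boundP (ltW (expR_gt0 a^-1)); set J := Num.bound _ => hJ.
  exists J; apply: (le_trans (ltW hJ)).
  by rewrite -natrX ler_nat ltnW// ltn_expl.
exists J => x; rewrite eballE => /negP; rewrite -leNgt => xJ.
apply: cube_eq0; rewrite /logW subr_le0.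
have j1 : (1 <= 2 ^+ J :> R)%R by rewrite exprn_ege1// ler1n.
have : (a^-1 <= ln (1 + tsq x))%R.
  rewrite -[leLHS]expRK ler_ln ?posrE ?expR_gt0 ?ltr_wpDr ?tsq_ge0//.
  apply: (le_trans hJ); apply: (le_trans xJ).
  by rewrite -tnorm_sqr; have := tnorm_ge0 x; nra.
by move=> h; rewrite -ler_pdivrMl// mulr1.
Qed.

Let defect r x : R := Num.max (g x - fine (bavg r g x))%R 0%R.

Let mlog a : measurable_fun setT (@logcut R n.+1 a).
Proof.
have [mW mW1 mW2] := measurable_logW a.
have [mF _] := measurable_cube mW mW1 mW2.
exact: measurableT_comp mF measurable_tsq.
Qed.

Let logcut_le1 a x : (0 <= a)%R -> (logcut a x <= 1)%R.
Proof.
move=> a0; rewrite /logcut /= /cube expr_le1 ?pos_ge0//.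
rewrite ge_max ler01 andbT /logW gerBl mulr_ge0// ln_ge0// lerDl//.
exact: tsq_ge0.
Qed.

Let logcut_ge0 a x : (0 <= logcut a x)%R. Proof. exact: cube_ge0. Qed.

Let mdefect r : (0 < r)%R -> measurable_fun setT (defect r).
Proof.
move=> r0; apply: measurable_maxr => //; apply: measurable_funB => //.
apply: measurableT_comp => //; exact: measurable_bavg.
Qed.

Let defect_ge0 r x : (0 <= defect r x)%R.
Proof. by rewrite le_max lexx orbT. Qed.

Let test_log r : (0 < r)%R -> exists2 C : R, (0 <= C)%R & forall a, (0 < a)%R ->
  \int[nd]_x (logcut a x * defect r x)%:E <= (C * a)%:E.
Proof.
move=> r0; have [D D0 hD] := weighted_int_le.
pose c := (48 * (1 + r ^+ 2) ^+ 2 * bump_ratio n r)%R.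
have c0 : (0 <= c)%R.
  apply: mulr_ge0; last by rewrite ltW// bump_ratio_gt0.
  by apply: mulr_ge0 => //; exact: sqr_ge0.
exists (c * D)%R; first exact: mulr_ge0.
move=> a a0; have [J hJ] := logcut_support a0.
pose k1 x := (c * a * (\1_(@eball R n.+1 (2 ^+ J)) x * kk x))%R.
have ca0 : (0 <= c * a)%R by rewrite mulr_ge0// ltW.
have k10 x : (0 <= k1 x)%R.
  by apply: mulr_ge0 => //; apply: mulr_ge0 => //; have /andP[] := kk01 x.
have mk1 : measurable_fun setT k1.
  by apply: measurable_funM => //; exact: measurable_funM.
have p2 : (0 < 2 ^+ J :> R)%R by rewrite exprn_gt0.
have p1 : (1 <= 2 ^+ J :> R)%R by rewrite exprn_ege1// ler1n.
have hyp x : (logcut a x + 0)%:E <= bavg r (@logcut R n.+1 a) x + (k1 x)%:E.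
  rewrite addr0; have [xJ|xJ] := boolP (x \in @eball R n.+1 (2 ^+ J)).
    apply: (le_trans (logcut_sub x n2 (ltW a0) r0)).
    by rewrite /k1 indicE xJ mul1r.
  rewrite hJ; last by move=> /mem_set; apply/negP.
  by apply: adde_ge0; rewrite ?lee_fin// bavg_ge0.
have fin : \int[nd]_x (logcut a x * g x)%:E < +oo.
  have [D' _ hD'] := ball_int_le.
  apply: le_lt_trans (ltry (D' * (2 ^+ J) ^+ 2)%R).
  apply: le_trans (hD' _ p1); apply: integral_leR.
  - exact: measurable_funM.
  - exact: measurable_funM.
  - by move=> x; rewrite mulr_ge0.
  move=> x; rewrite ler_wpM2r// indicE.
  have [xJ|xJ] := boolP (x \in @eball R n.+1 (2 ^+ J)).
    by rewrite logcut_le1// ltW.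
  by rewrite hJ//; move=> /mem_set; apply/negP.
pose z0 (x : n.+1.-tuple R) : R := 0%R.
have mz0 : measurable_fun setT z0 by exact: measurable_cst.
have := supersol_test mg g0 hsup r0 (mlog a) (logcut_ge0 a) mk1 k10
  mz0 (fun=> lexx 0%R) hyp fin.
under eq_integral do rewrite /z0 mul0r.
rewrite integral0 add0e => /le_trans; apply.
under eq_integral do rewrite /k1 -mulrA.
rewrite integral_ZR//; last 2 first.
- by apply: measurable_funM => //; exact: measurable_funM.
- by move=> x; apply: mulr_ge0 => //; apply: mulr_ge0 => //; have /andP[] := kk01 x.
apply: (le_trans (lee_wpmul2l _ (hD J))); first by rewrite lee_fin.
by rewrite -EFinM lee_fin mulrAC.
Qed.

(** On a fixed ball the cutoff is at least 1 / 8 once a is small, so [test_log]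
    bounds the integral of the defect there by a constant times a. *)
Let defect_eq0 r : (0 < r)%R -> {ae nd, forall x, defect r x = 0%R}.
Proof.
move=> r0; have [C C0 hC] := test_log r0.
have ball0 (j : nat) : {ae nd, forall x, (\1_(eball j%:R) x * defect r x = 0)%R}.
  apply: integral_eq0_ae.
  - by apply: measurable_funM => //; exact: mdefect.
  - by move=> x; rewrite mulr_ge0.
  apply/eqP; rewrite eq_le integral_ge0 ?andbT; last first.
    by move=> y _; rewrite lee_fin mulr_ge0.
  apply/lee_addgt0Pr => e e0; rewrite add0e.
  pose L := ln (1 + j%:R ^+ 2 : R)%R.
  have L0 : (0 <= L)%R by rewrite ln_ge0// lerDl sqr_ge0.
  (* the first bound keeps the profile above 1 / 2 on the ball, the second
     makes the integral of the defect at most e *)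
  pose a := Num.min (2 * (L + 1))^-1%R (e / (8 * (C + 1)))%R.
  have a0 : (0 < a)%R.
    rewrite lt_min invr_gt0 mulr_gt0 ?ltr_wpDl//=.
    by rewrite divr_gt0// mulr_gt0// ltr_wpDl.
  have aL : (a * L <= 1 / 2)%R.
    apply: (@le_trans _ _ ((2 * (L + 1))^-1 * L)%R).
      by rewrite ler_wpM2r// ge_min lexx.
    rewrite mulrC ler_pdivrMr ?mulr_gt0 ?ltr_wpDl//.
    lra.
  have aC : (8 * (C * a) <= e)%R.
    apply: (@le_trans _ _ (8 * (C * (e / (8 * (C + 1)))))%R).
      by rewrite ler_wpM2l// ler_wpM2l// ge_min lexx orbT.
    have C1 : (0 < C + 1)%R by rewrite ltr_wpDl.
    rewrite (_ : (8 * (C * (e / (8 * (C + 1)))) = e * (C / (C + 1)))%R);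
      last by field; exact: lt0r_neq0.
    rewrite ler_piMr ?(ltW e0)// ler_pdivrMr// mul1r lerDl//.
  apply: le_trans (_ : 8%:E * \int[nd]_x (logcut a x * defect r x)%:E <= _); last first.
    apply: (le_trans (lee_wpmul2l _ (hC a a0))); first by rewrite lee_fin.
    by rewrite -EFinM lee_fin.
  rewrite -integral_ZR//; last 2 first.
  - by apply: measurable_funM => //; exact: mdefect.
  - by move=> x; rewrite mulr_ge0.
  apply: integral_leR.
  - by apply: measurable_funM => //; exact: mdefect.
  - by apply: measurable_funM => //; apply: measurable_funM => //; exact: mdefect.
  - by move=> x; rewrite mulr_ge0.
  move=> x; rewrite mulrA ler_wpM2r// indicE.
  have [xJ|xJ] := boolP (x \in @eball R n.+1 j%:R); last by rewrite mulr_ge0.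
  have jx : (tnorm x < j%:R)%R by move: xJ; rewrite inE.
  have lw : (1 / 2 <= logW a (tsq x))%R.
    rewrite /logW; suff : (a * ln (1 + tsq x) <= a * L)%R by lra.
    rewrite ler_pM2l// ler_ln ?posrE ?ltr_wpDr ?tsq_ge0 ?sqr_ge0// lerD2l.
    by rewrite -tnorm_sqr ler_pXn2r ?nnegrE ?tnorm_ge0// ltW.
  have pw : (1 / 2 <= pos (logW a (tsq x)))%R.
    by apply: (le_trans lw); rewrite le_max lexx.
  rewrite /logcut /= /cube.
  have h : ((1 / 2) ^+ 3 <= pos (logW a (tsq x)) ^+ 3)%R.
    by rewrite ler_pXn2r ?nnegrE// (le_trans _ pw).
  by move: h; rewrite (_ : (1 / 2) ^+ 3 = 8^-1 :> R)%R; [lra|field].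
have := ae_foralln ball0; apply: filterS => x hx.
have := archi_boundP (tnorm_ge0 x); set j := Num.bound _ => hj.
by have := hx j; rewrite indicE mem_set ?mul1r.
Qed.

(** Almost every z has all its averages over balls of integer radius k equal to
    g z.  The ball of radius k about z lies in the ball of radius k + del about w,
    where del = |z - w|, so that g z <= (1 + del / k)^(n + 1) g w; then k tends
    to infinity. *)
Lemma supersol_constant : exists c : R, {ae nd, forall x, g x = c}.
Proof.
have d0 : {ae nd, forall x, forall j : nat, defect j.+1%:R x = 0%R}.
  by apply: ae_foralln => j; exact: defect_eq0.
have good : {ae nd, forall x, supersol g x /\ forall j : nat, defect j.+1%:R x = 0%R}.
  by apply: filterS2 hsup d0 => x ? ?; split.
have le z w : supersol g z -> (forall j : nat, defect j.+1%:R z = 0%R) -> supersol g w ->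
    (g z <= g w)%R.
  move=> sz dz sw; apply/ler_addgt0Pr => e e0.
  pose del := tnorm (tsub z w).
  have del0 : (0 <= del)%R by exact: tnorm_ge0.
  pose Q := ((2 * del + del ^+ 2) * g w)%R.
  have Q0 : (0 <= Q)%R by rewrite mulr_ge0// addr_ge0 ?mulr_ge0 ?sqr_ge0.
  have := archi_boundP (divr_ge0 Q0 (ltW e0)); set j := Num.bound _ => hj.
  pose k : R := j.+1%:R.
  have k0 : (0 < k)%R by rewrite ltr0n.
  have k1 : (1 <= k)%R by rewrite ler1n.
  have hk : (Q / k <= e)%R.
    rewrite ler_pdivrMr// -ler_pdivrMl// mulrC; apply: (le_trans (ltW hj)).
    by rewrite ler_nat.
  have V0 : (0 < bv * k ^+ n.+1)%R by rewrite mulr_gt0 ?bvol_gt0 ?exprn_gt0.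
  have e1 : \int[nd]_y (\1_(eball k) (tsub z y) * g y)%:E = (bv * k ^+ n.+1 * g z)%:E.
    have b1 := sz k k0; have b0 := bavg_ge0 z k0 g0.
    have bf : bavg k g z = (fine (bavg k g z))%:E.
      by rewrite fineK// ge0_fin_numE//; exact: le_lt_trans b1 (ltry _).
    have : (g z - fine (bavg k g z) <= 0)%R.
      by rewrite -(dz j) /defect le_max lexx.
    rewrite subr_le0 => h1.
    have h2 : (fine (bavg k g z) <= g z)%R by rewrite -lee_fin -bf.
    have h3 : bavg k g z = (g z)%:E.
      by rewrite bf; congr EFin; apply/eqP; rewrite eq_le h1 h2.
    by rewrite EFinM -h3 bavgE// muleA -EFinM mulfV ?gt_eqF// mul1e.
  have kd0 : (0 < k + del)%R by rewrite ltr_wpDr.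
  have : (bv * k ^+ n.+1 * g z)%:E <= (bv * (k + del) ^+ n.+1 * g w)%:E.
    rewrite -e1; apply: le_trans (supersol_ball mg g0 sw kd0).
    apply: integral_leR.
    - exact: measurable_tsub_indic_mul.
    - exact: measurable_tsub_indic_mul.
    - by move=> y; rewrite mulr_ge0// indicE.
    move=> y; rewrite ler_wpM2r//; apply: le_indic; rewrite !eballE => h.
    have : (tnorm (tsub w y) <= tnorm (tsub w z) + tnorm (tsub z y))%R.
      by apply: tnormD => i; rewrite !tnth_mktuple; ring.
    by rewrite (tnorm_tsubC w z) -/del => /le_lt_trans; apply; rewrite addrC ltrD2r.
  rewrite lee_fin -!mulrA ler_pM2l ?bvol_gt0// => h.
  apply: le_trans (_ : g w + Q / k <= _)%R; last by rewrite lerD2l.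
  have h2 : (g z <= (1 + del / k) ^+ n.+1 * g w)%R.
    rewrite -(ler_pM2l (exprn_gt0 n.+1 k0)) mulrA -exprMn mulrDr mulr1.
    by rewrite mulrCA mulfV ?mulr1// gt_eqF.
  apply: (le_trans h2).
  have dk0 : (0 <= del / k)%R by rewrite divr_ge0// ltW.
  apply: (@le_trans _ _ ((1 + del / k) ^+ 2 * g w)%R).
    by rewrite ler_wpM2r// ler_weXn2l// lerDl.
  rewrite (_ : g w + Q / k = (1 + (2 * del + del ^+ 2) / k) * g w)%R; last first.
    by rewrite /Q; field; exact: lt0r_neq0.
  rewrite ler_wpM2r// sqrrD expr1n mul1r -addrA lerD2l mulrDl.
  rewrite -mulr_natl mulrA lerD2l exprMn exprVn.
  rewrite ler_wpM2l ?sqr_ge0// lef_pV2 ?posrE ?exprn_gt0//.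
  by rewrite expr2 ler_peMr// ltW.
have [w _ [sw dw]] := ae_exists measurableT (@measure_nd_gt0 R n.+1) good.
exists (g w); apply: filterS good => z [sz dz].
by apply/eqP; rewrite eq_le !le.
Qed.

End low_dimension.

(** * Growth in dimension at least three *)

Section high_dimension.
Context {R : realType} {n : nat}.
Hypothesis n3 : (3 <= n.+1)%N.
Local Notation nd := (@lebesgue_nd R n.+1).
Local Notation bv := (@bvol R n.+1).
Implicit Types (r rho : R) (x y z : n.+1.-tuple R).
Variable g : n.+1.-tuple R -> R.
Hypothesis mg : measurable_fun setT g.
Hypothesis g0 : forall x, (0 <= g x)%R.
Hypothesis hsup : {ae nd, forall x, supersol g x}.
Hypothesis gn0 : ~ {ae nd, forall x, g x = 0%R}.

Let b : R := ((n.+1%:R - 2) / 2)%R.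

Let bE : (2 * b = n.+1%:R - 2)%R.
Proof. by rewrite /b mulrC divfK. Qed.

Let b_gt0 : (0 < b)%R.
Proof. by rewrite divr_gt0// subr_gt0 ltr_nat. Qed.

Let I0 r x : (0 <= \1_(@eball R n.+1 r) x :> R)%R.
Proof. by rewrite indicE. Qed.

Let mI r : measurable_fun setT (\1_(@eball R n.+1 r) : _ -> R).
Proof. by apply: measurable_indic; exact: measurable_eball. Qed.

Let mIg r : measurable_fun setT (fun y => \1_(@eball R n.+1 r) y * g y)%R.
Proof. exact: measurable_funM. Qed.

Let Ig0 r y : (0 <= \1_(@eball R n.+1 r) y * g y)%R.
Proof. by rewrite mulr_ge0. Qed.

Let ball_int_fin r : (0 < r)%R -> \int[nd]_y (\1_(eball r) y * g y)%:E \is a fin_num.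
Proof.
move=> r0; have [x0 _ sx0] := ae_exists measurableT (@measure_nd_gt0 R n.+1) hsup.
rewrite ge0_fin_numE; last by apply: integral_ge0 => y _; rewrite lee_fin.
exact: le_lt_trans (supersol_eball mg g0 sx0 r0) (ltry _).
Qed.

Let tent_support k rho x : (0 < rho)%R -> k = (rho ^- 2)%R -> ~ eball (2 * rho) x ->
  tentcut b k x = 0%R.
Proof.
move=> r0 kE; rewrite eballE => /negP; rewrite -leNgt => xr.
apply: cube_eq0; rewrite /tentW.
have nw := newton_gt0 b (tsq x).
suff : (4 <= k * tsq x)%R by lra.
rewrite kE -tnorm_sqr mulrC -exprVn -exprMn.
have : (2 <= tnorm x / rho)%R by rewrite ler_pdivlMr.
by move=> h; nra.
Qed.

Let tent_le8 k x : (0 <= k)%R -> (tentcut b k x <= 8)%R.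
Proof.
move=> k0; have s0 := tsq_ge0 x; have nw := newton_gt0 b (tsq x).
have p2 : (pos (tentW b k (tsq x)) <= 2)%R.
  rewrite ge_max ler0n andbT /tentW; have := mulr_ge0 k0 s0; lra.
rewrite /tentcut /= /cube (_ : 8 = 2 ^+ 3 :> R)%R; last by rewrite -natrX.
by rewrite ler_pXn2r ?nnegrE ?pos_ge0.
Qed.

Let mtent k : measurable_fun setT (@tentcut R n.+1 b k).
Proof.
have [mW mW1 mW2] := measurable_tentW b k.
have [mF _] := measurable_cube mW mW1 mW2.
exact: measurableT_comp mF measurable_tsq.
Qed.

Let tent_gain_gt0 : (0 < tent_gain n b)%R.
Proof.
rewrite /tent_gain mulr_gt0 ?newton_gt0// mulr_gt0 ?exprn_gt0 ?invr_gt0//.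
by rewrite mulr_gt0// mulr_gt0.
Qed.

(** The test inequality for the tent of radius 2 rho.  Unless g vanishes almost
    everywhere, its integral over the unit ball is positive, and it is bounded by
    a multiple of rho^(-2) times the integral over the ball of radius 2 rho. *)
Lemma supersol_ball_growth : exists2 c : R, (0 < c)%R & forall rho, (3 <= rho)%R ->
  (c * rho ^+ 2)%:E <= \int[nd]_y (\1_(eball (2 * rho)) y * g y)%:E.
Proof.
pose G1 := \int[nd]_y (\1_(eball 1) y * g y)%:E.
have G1fin : G1 \is a fin_num by exact: ball_int_fin.
have G1gt0 : 0 < G1.
  rewrite lt_neqAle integral_ge0 ?andbT; last by move=> y _; rewrite lee_fin.
  apply/eqP => G10; apply: gn0.
  apply: (supersol_dichotomy mg g0 hsup (measurable_eball 1)) => //.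
  by have /andP[] := @eball1_bounds R n.+1.
pose h := tent_gain n b.
pose B : R := bump_ratio n 1.
have B0 : (0 < B)%R by exact: bump_ratio_gt0.
pose a : R := (3 / 4 * h * B)%R.
have a0 : (0 < a)%R by rewrite mulr_gt0// mulr_gt0// divr_gt0.
pose e : R := (24 * n.+1%:R * B)%R.
have e0 : (0 < e)%R by rewrite mulr_gt0// mulr_gt0.
have f0 : (0 < fine G1)%R by apply: fine_gt0; rewrite G1gt0 -ge0_fin_numE// ltW.
exists (a * fine G1 / e)%R; first by rewrite divr_gt0// mulr_gt0.
move=> rho r3; have r0 : (0 < rho)%R by apply: lt_le_trans r3.
pose k : R := (rho ^- 2)%R.
have k0 : (0 < k)%R by rewrite invr_gt0 exprn_gt0.
have k8 : (8 * k <= 1)%R.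
  by rewrite /k ler_pdivrMr ?exprn_gt0// mul1r; nra.
have r20 : (0 < 2 * rho)%R by rewrite mulr_gt0.
pose k1 x : R := (e * k * \1_(@eball R n.+1 (2 * rho)) x)%R.
pose k2 x : R := (a * \1_(@eball R n.+1 1) x)%R.
have k10 x : (0 <= k1 x)%R by apply: mulr_ge0 => //; rewrite mulr_ge0// ltW.
have k20 x : (0 <= k2 x)%R by apply: mulr_ge0 => //; exact: ltW.
have mk1 : measurable_fun setT k1 by exact: measurable_funM.
have mk2 : measurable_fun setT k2 by exact: measurable_funM.
have u0 x : (0 <= @tentcut R n.+1 b k x)%R by exact: cube_ge0.
have hyp x : (tentcut b k x + k2 x)%:E <= bavg 1 (@tentcut R n.+1 b k) x + (k1 x)%:E.
  have [xJ|xJ] := boolP (x \in @eball R n.+1 (2 * rho)).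
    have := tentcut_sub x bE (ltW b_gt0) (ltW k0) k8.
    rewrite EFinD /k2 (_ : k1 x = 24 * n.+1%:R * k * bump_ratio n 1)%R; first exact.
    by rewrite /k1 indicE xJ mulr1 /e /B; ring.
  have nx : ~ eball (2 * rho) x by move=> /mem_set; apply/negP.
  rewrite (tent_support r0 erefl nx) add0r /k2 indicE (_ : (x \in _) = false).
    by rewrite mulr0; apply: adde_ge0; rewrite ?lee_fin// bavg_ge0.
  apply/negP => /set_mem; rewrite eballE => x1; apply: nx; rewrite eballE.
  by apply: (lt_le_trans x1); lra.
have fin : \int[nd]_x (tentcut b k x * g x)%:E < +oo.
  apply: (@le_lt_trans _ _ (8%:E * \int[nd]_y (\1_(eball (2 * rho)) y * g y)%:E)).
    rewrite -integral_ZR//; apply: integral_leR.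
    - exact: measurable_funM.
    - exact: measurable_funM.
    - by move=> x; rewrite mulr_ge0.
    move=> x; rewrite mulrA ler_wpM2r// indicE.
    have [xJ|xJ] := boolP (x \in @eball R n.+1 (2 * rho)).
      by rewrite mulr1 tent_le8// ltW.
    by rewrite (tent_support r0 erefl) ?mulr0// => /mem_set; apply/negP.
  by rewrite -(fineK (ball_int_fin r20)) -EFinM ltry.
have := supersol_test mg g0 hsup ltr01 (mtent k) u0 mk1 k10 mk2 k20 hyp fin.
under eq_integral do rewrite /k2 -mulrA.
rewrite [X in X + _]integral_ZR//; last exact: ltW.
under [in X in _ <= X]eq_integral do rewrite /k1 -mulrA.
rewrite [X in _ <= X]integral_ZR//; last by rewrite mulr_ge0// ltW.
rewrite -/G1 => h1.
have h2 : a%:E * G1 <= (e * k)%:E * \int[nd]_x (\1_(eball (2 * rho)) x * g x)%:E.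
  apply: le_trans h1; rewrite leeDl//.
  by apply: integral_ge0 => x _; rewrite lee_fin mulr_ge0// le_max lexx orbT.
move: h2; rewrite -(fineK G1fin) -(fineK (ball_int_fin r20)) -!EFinM !lee_fin.
set G2 := fine (integral _ _ _) => h2.
rewrite mulrAC ler_pdivrMr// -ler_pdivlMr ?exprn_gt0//.
by apply: (le_trans h2); rewrite /k le_eqVlt; apply/orP; left; apply/eqP; ring.
Qed.

(** The ball of radius 2 |x| about x contains the ball of radius |x| about the
    origin, whose mass is of order at least |x|^2.  The conclusion is multiplied
    by |x|^(n + 1) to avoid a negative power. *)
Lemma supersol_lower_bound : exists2 c : R, (0 < c)%R &
  {ae nd, forall x, (6 <= tnorm x)%R -> (c * tnorm x ^+ 2 <= g x * tnorm x ^+ n.+1)%R}.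
Proof.
have [c c0 hc] := supersol_ball_growth.
have bv0 := @bvol_gt0 R n.+1.
exists (c / (4 * (bv * 2 ^+ n.+1)))%R.
  by rewrite divr_gt0// mulr_gt0// mulr_gt0// exprn_gt0.
apply: filterS hsup => x sx x6.
have x0 : (0 < tnorm x)%R by exact: lt_le_trans x6.
have h3 : (3 <= tnorm x / 2)%R by rewrite ler_pdivlMr//; lra.
have := hc _ h3; rewrite (mulrC 2%R) divfK// => h1.
have x20 : (0 < 2 * tnorm x)%R by rewrite mulr_gt0.
have h2 : \int[nd]_y (\1_(eball (tnorm x)) y * g y)%:E <=
    (bv * (2 * tnorm x) ^+ n.+1 * g x)%:E.
  have -> : (2 * tnorm x = tnorm x + tnorm x)%R by ring.
  exact: supersol_eball.
have := le_trans h1 h2; rewrite lee_fin exprMn => h.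
have P0 : (0 < bv * 2 ^+ n.+1)%R by rewrite mulr_gt0 ?exprn_gt0.
rewrite mulrAC ler_pdivrMr ?mulr_gt0//.
have : (c * tnorm x ^+ 2 / 4 <= bv * 2 ^+ n.+1 * (g x * tnorm x ^+ n.+1))%R.
  move: h; rewrite exprMn exprVn (_ : 2 ^+ 2 = 4 :> R)%R ?mulrA; last by rewrite -natrX.
  by move=> /le_trans; apply; rewrite le_eqVlt; apply/orP; left; apply/eqP; ring.
rewrite ler_pdivrMr// => /le_trans; apply.
by rewrite le_eqVlt; apply/orP; left; apply/eqP; ring.
Qed.

End high_dimension.

(** * Lower bounds for rearrangements *)

Section rearrangement_measurable.
Context d (T : measurableType d) {R : realType} (mu : {measure set T -> \bar R}).
Variable f : T -> R.
Hypothesis mf : measurable_fun setT f.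

Lemma measurable_superlevel (s : R) : measurable [set x | (s < `|f x|)%R].
Proof.
rewrite (_ : [set _ | _] = (fun x => `|f x|%R) @^-1` `]s, +oo[).
  rewrite -[X in measurable X]setTI.
  by apply: (measurableT_comp _ mf) => //; exact: measurable_itv.
by apply/seteqP; split=> x /=; rewrite in_itv/= andbT.
Qed.

Lemma measurable_rearrangement : measurable_fun setT (rearrangement mu f).
Proof.
apply: (measurability _ (ErealGenOInfty.measurableE R)) => //.
move=> /= _ [_ [a ->] <-]; rewrite setTI.
have [a0|a0] := ltP a 0%R.
  rewrite (_ : _ @^-1` _ = setT)//; apply/seteqP; split => // t _ /=.
  rewrite in_itv/= andbT; apply: lt_le_trans (rearrangement_ge0 mu f t).
  by rewrite lte_fin.
rewrite (_ : _ @^-1` _ = [set t | t%:E < distribution_function mu f a]); last first.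
  apply/seteqP; split => t /=; rewrite in_itv/= andbT.
    by rewrite (lt_rearrangement mu mf).
  by rewrite (lt_rearrangement mu mf).
case: (distribution_function mu f a) => [r| |].
- rewrite (_ : [set _ | _] = `]-oo, r[%classic); first exact: measurable_itv.
  by apply/seteqP; split => t /=; rewrite in_itv/= lte_fin.
- rewrite (_ : [set _ | _] = setT)//; by apply/seteqP; split => // t _ /=; rewrite ltry.
- rewrite (_ : [set _ | _] = set0)//; by apply/seteqP; split => // t /=.
Qed.

End rearrangement_measurable.

Section powers.
Context {R : realType}.
Local Notation leb := (@lebesgue_measure R).
Implicit Types a b e t : R.

Lemma is_derive_powR e t : (0 < t)%R -> e != 0%R ->
  is_derive t (1%R : R) (fun t => e^-1 * t `^ e)%R (t `^ (e - 1))%R.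
Proof.
move=> t0 e0; have d := is_derive1_powR e t0.
by apply: is_derive_eq; rewrite /GRing.scale/=; field.
Qed.

Lemma continuous_powR e t : (0 < t)%R -> {for t, continuous (fun t => t `^ e)%R}.
Proof.
by move=> t0; have d := is_derive1_powR e t0; exact: (continuous_at_derive d).
Qed.

Lemma integral_powR e a b : (0 < a)%R -> (a < b)%R -> e != 0%R ->
  \int[leb]_(t in `[a, b]) (t `^ (e - 1))%:E = (e^-1 * b `^ e - e^-1 * a `^ e)%:E.
Proof.
move=> a0 ab e0.
have pos t : t \in `[a, b] -> (0 < t)%R.
  by rewrite in_itv/= => /andP[/(lt_le_trans a0)].
rewrite (@continuous_FTC2 _ (fun t => t `^ (e - 1))%R (fun t => e^-1 * t `^ e)%R)//.
- apply: continuous_in_subspaceT => t; rewrite inE => /pos t0.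
  exact: continuous_powR.
- have cF t : (0 < t)%R -> {for t, continuous (fun t => e^-1 * t `^ e)%R}.
    by move=> t0; have d := is_derive_powR t0 e0; exact: (continuous_at_derive d).
  split.
  + move=> t /subset_itv_oo_cc/pos t0; have d := is_derive_powR t0 e0; exact: ex_derive.
  + by apply: cvg_at_right_filter; exact: cF.
  + by apply: cvg_at_left_filter; apply: cF; exact: lt_trans ab.
- move=> t /subset_itv_oo_cc/pos t0; have d := is_derive_powR t0 e0.
  by rewrite derive1E derive_val.
Qed.

Lemma integral_inv a b : (0 < a)%R -> (a < b)%R ->
  \int[leb]_(t in `[a, b]) (t^-1)%:E = (ln b - ln a)%:E.
Proof.
move=> a0 ab.
have pos t : t \in `[a, b] -> (0 < t)%R.
  by rewrite in_itv/= => /andP[/(lt_le_trans a0)].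
rewrite (@continuous_FTC2 _ (fun t => t^-1)%R (@ln R))//.
- apply: continuous_in_subspaceT => t; rewrite inE => /pos t0.
  by apply: inv_continuous; exact: lt0r_neq0.
- split.
  + by move=> t /subset_itv_oo_cc/pos t0; have d := is_derive1_ln t0; exact: ex_derive.
  + by apply: cvg_at_right_filter; exact: continuous_ln.
  + by apply: cvg_at_left_filter; apply: continuous_ln; exact: lt_trans ab.
- move=> t /subset_itv_oo_cc/pos t0; have d := is_derive1_ln t0.
  by rewrite derive1E derive_val.
Qed.

Lemma powR_inv_nat (a : R) (N : nat) : (0 < a)%R -> ((a `^ (N.+1%:R^-1)) ^+ N.+1 = a)%R.
Proof.
by move=> a0; rewrite -powR_mulrn ?powR_ge0// -powRrM mulVf ?pnatr_eq0// powRr1// ltW.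
Qed.

End powers.

Section lorentz_lower.
Context {R : realType} {k : nat}.
Local Notation N := k.+3.
Local Notation nd := (@lebesgue_nd R N).
Local Notation bv := (@bvol R N).
Local Notation leb := (@lebesgue_measure R).
Let beta : R := (k.+1%:R / N%:R)%R.
Variable f : N.-tuple R -> R.
Hypothesis mf : measurable_fun setT f.
Variable c : R.
Hypothesis c0 : (0 < c)%R.
Hypothesis lowf : {ae nd, forall x, (6 <= tnorm x)%R ->
  (c * tnorm x ^+ 2 <= `|f x| * tnorm x ^+ N)%R}.

Lemma shell_measure (a b : R) : (0 < a)%R -> (a <= b)%R ->
  nd (eball b `\` eball a) = (bv * (b ^+ N - a ^+ N))%:E.
Proof.
move=> a0 ab; have b0 := lt_le_trans a0 ab.
rewrite measureD; [|exact: measurable_eball|exact: measurable_eball|].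
  rewrite setIidr; last by move=> y; rewrite !eballE => /lt_le_trans; apply.
  rewrite -[X in X - _]/(@lebesgue_nd R N (eball b)).
  rewrite -[X in _ - X]/(@lebesgue_nd R N (eball a)).
  by rewrite !measure_eball// -EFinB mulrBr.
by rewrite -[X in X < _]/(@lebesgue_nd R N (eball b)) measure_eball// ltry.
Qed.

Lemma distribution_lower (rho : R) : (6 <= rho)%R ->
  (bv * (rho ^+ N - 6 ^+ N))%:E <= distribution_function nd f (c / rho ^+ k.+1)%R.
Proof.
move=> r6; have six0 : (0 < 6 :> R)%R by [].
have r0 : (0 < rho)%R by apply: lt_le_trans r6.
rewrite -(shell_measure six0 r6).
have [Z [mZ Z0 PZ]] := lowf.
rewrite /distribution_function; set S := [set x | (_ < `|f x|)%R].
have mS : measurable S by exact: measurable_superlevel.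
apply: (@le_trans _ _ (nd (S `|` Z))).
  apply: le_measure; rewrite ?inE.
  - by apply: measurableD; exact: measurable_eball.
  - exact: measurableU.
  move=> x [xr x6]; have [Zx|nZx] := pselect (Z x); first by right.
  left; rewrite /S /=.
  have {}x6 : (6 <= tnorm x)%R by rewrite leNgt; apply/negP.
  have {nZx} := contra_notP (@PZ x) nZx => /(_ x6) h.
  have t0 : (0 < tnorm x)%R by exact: lt_le_trans x6.
  have h2 : (c <= `|f x| * tnorm x ^+ k.+1)%R.
    move: h t0; set T := tnorm x => h t0.
    have e : (T ^+ k.+3 = T ^+ k.+1 * T ^+ 2)%R by rewrite -exprD addn2.
    by move: h; rewrite e (mulrA `|f x|%R) ler_pM2r// exprn_gt0.
  rewrite ltr_pdivrMr ?exprn_gt0//; apply: (le_lt_trans h2).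
  have fx0 : (0 < `|f x|)%R.
    rewrite lt_neqAle normr_ge0 andbT; apply/eqP => f0.
    by move: h2; rewrite -f0 mul0r leNgt c0.
  by rewrite ltr_pM2l// ltr_pXn2r// ?nnegrE ltW.
apply: (le_trans (measureU2 _ mS mZ)).
by rewrite [X in _ + X](_ : _ = 0)// adde0.
Qed.

(** The radius rho is taken so that its ball has volume 2 t: for large t the shell
    between 6 and rho still has volume greater than t, and on it |f| exceeds the
    stated bound. *)
Lemma rearrangement_lower : exists2 C : R, (0 < C)%R & exists2 t0 : R, (1 <= t0)%R &
  forall t, (t0 <= t)%R -> (C * t `^ (- beta))%:E <= rearrangement nd f t.
Proof.
have bv0 := @bvol_gt0 R N.
exists (c * (2 / bv) `^ (- beta))%R; first by rewrite mulr_gt0// powR_gt0// divr_gt0.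
exists (bv * 6 ^+ N + 1)%R; first by rewrite lerDr mulr_ge0 ?exprn_ge0// ltW.
move=> t tt0.
have b60 : (0 < bv * 6 ^+ N)%R by rewrite mulr_gt0 ?exprn_gt0.
have t0 : (0 < t)%R by rewrite (lt_le_trans _ tt0)// addr_gt0.
pose rho := ((2 * t / bv) `^ (N%:R^-1))%R.
have q0 : (0 < 2 * t / bv)%R by rewrite divr_gt0 ?mulr_gt0.
have rho0 : (0 < rho)%R by rewrite powR_gt0.
have rhoN : (rho ^+ N = 2 * t / bv)%R by exact: powR_inv_nat.
have r6 : (6 <= rho)%R.
  rewrite -(@ler_pXn2r _ N)// ?nnegrE ?(ltW rho0)// rhoN ler_pdivlMr// mulrC.
  lra.
have rk : (c / rho ^+ k.+1 = c * (2 / bv) `^ (- beta) * t `^ (- beta))%R.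
  rewrite -mulrA -powRM ?(ltW t0)//; last by rewrite divr_ge0// ltW.
  congr (c * _)%R; rewrite mulrAC powRN; congr (_^-1)%R.
  rewrite -powR_mulrn ?(ltW rho0)// /rho -powRrM /beta.
  by rewrite [(_^-1 * k.+1%:R)%R]mulrC.
rewrite -rk; apply/ltW; rewrite (lt_rearrangement nd mf); last first.
  by rewrite divr_ge0 ?exprn_ge0// ltW.
apply: lt_le_trans (distribution_lower r6).
rewrite rhoN lte_fin mulrBr mulrCA mulfV ?gt_eqF// mulr1; lra.
Qed.

Lemma not_lorentz_weak (p : \bar R) : (beta < fine p^-1)%R ->
  ~ in_lorentz p +oo f.
Proof.
move=> bp [_]; have [C C0 [t0 t01 h]] := rearrangement_lower.
set S := ereal_sup _ => Soo.
pose e := (fine p^-1 - beta)%R.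
have e0 : (0 < e)%R by rewrite subr_gt0.
have lo t : (t0 <= t)%R -> (C * t `^ e)%:E <= S.
  move=> tt; have t00 : (0 < t)%R by apply: lt_le_trans tt; apply: lt_le_trans t01.
  apply: (@le_trans _ _ ((t `^ fine p^-1)%:E * rearrangement nd f t)); last first.
    by apply: ereal_sup_ubound; exists t => //=; rewrite in_itv/= t00.
  apply: (@le_trans _ _ ((t `^ fine p^-1)%:E * (C * t `^ (- beta))%:E)).
    rewrite -EFinM lee_fin mulrCA /e powRD//.
    by apply/implyP => _; exact: lt0r_neq0.
  by apply: lee_wpmul2l; [rewrite lee_fin powR_ge0|exact: h].
have S0 : 0 <= S.
  by apply: le_trans (lo _ (lexx _)); rewrite lee_fin mulr_ge0 ?powR_ge0// ltW.
have Sf : S = (fine S)%:E by rewrite fineK// ge0_fin_numE.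
pose s := fine S; have s0 : (0 <= s)%R by exact: fine_ge0.
(* the second value makes C t^e at least s + 1, which exceeds the supremum *)
pose t := Num.max t0 (((s + 1) / C) `^ e^-1)%R.
have q0 : (0 < (s + 1) / C)%R by rewrite divr_gt0// ltr_wpDl.
have := lo t; rewrite le_max lexx => /(_ isT); rewrite Sf lee_fin -/s leNgt => /negP; apply.
apply: (@lt_le_trans _ _ (s + 1)%R); first by rewrite ltrDl.
rewrite mulrC -ler_pdivrMr//.
apply: (@le_trans _ _ ((((s + 1) / C) `^ e^-1) `^ e)%R).
  by rewrite -powRrM mulVf ?gt_eqF// powRr1// ltW.
apply: ge0_ler_powR; rewrite ?nnegrE ?powR_ge0// ?(ltW e0)//.
  by rewrite le_max powR_ge0 orbT.
by rewrite le_max lexx orbT.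
Qed.

(** For large t the integrand is at least a constant multiple of 1 / t, whose
    integral diverges logarithmically. *)
Lemma not_lorentz_strong (p : \bar R) (r : R) : (1 <= r)%R -> (beta <= fine p^-1)%R ->
  ~ in_lorentz p r%:E f.
Proof.
move=> r1 bp [_]; have [C C0 [t0 t01 h]] := rearrangement_lower.
set S := \int[_]_(_ in _) _ => Soo.
have t00 : (0 < t0)%R by apply: lt_le_trans t01.
have r0 : (0 <= r)%R by apply: le_trans r1.
pose e := (fine p^-1 - beta)%R.
have e0 : (0 <= e)%R by rewrite subr_ge0.
pose F t := (((t `^ fine p^-1)%:E * rearrangement nd f t) `^ r * (t^-1)%:E).
have mF (D : set R) : measurable_fun D F.
  apply: measurable_funTS; apply: emeasurable_funM.
    apply: (measurableT_comp (measurable_poweR r)).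
    apply: emeasurable_funM; last exact: measurable_rearrangement.
    by apply: measurable_EFinR; exact: measurable_powR.
  by apply: measurable_EFinR; exact: measurable_inv.
have F0 t : `]0%R, +oo[%classic t -> 0 <= F t.
  rewrite /= in_itv/= andbT => tp; apply: mule_ge0; first exact: poweR_ge0.
  by rewrite lee_fin invr_ge0 ltW.
have lo b : (t0 < b)%R -> (C `^ r * (ln b - ln t0))%:E <= S.
  move=> tb.
  apply: (@le_trans _ _ (\int[leb]_(t in `[t0, b]) F t)); last first.
    apply: ge0_subset_integral; [exact: measurable_itv|exact: measurable_itv|exact: mF|exact: F0|].
    by move=> t /=; rewrite !in_itv/= andbT => /andP[/(lt_le_trans t00)].
  rewrite EFinM -integral_inv// -ge0_integralZl; last 4 first.
  - exact: measurable_itv.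
  - by apply: measurable_funTS; apply: measurable_EFinR; exact: measurable_inv.
  - move=> t /=; rewrite in_itv/= => /andP[/(lt_le_trans t00) tp _].
    by rewrite lee_fin invr_ge0 ltW.
  - by rewrite lee_fin powR_ge0.
  apply: ge0_le_integral.
  - exact: measurable_itv.
  - move=> t /=; rewrite in_itv/= => /andP[/(lt_le_trans t00) tp _].
    by rewrite -EFinM lee_fin mulr_ge0 ?powR_ge0// invr_ge0 ltW.
  - apply: measurable_funTS; apply: measurable_funeM.
    by apply: measurable_EFinR; exact: measurable_inv.
  - exact: mF.
  move=> t /=; rewrite in_itv/= => /andP[tt0 _].
  have tp := lt_le_trans t00 tt0.
  have ti : 0 <= (t^-1)%:E by rewrite lee_fin invr_ge0 ltW.
  apply: lee_wpmul2r => //; rewrite -(poweR_EFin C r).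
  apply: gt0_ler_poweR => //.
  - by rewrite in_itv/= lee_fin (ltW C0) leey.
  - rewrite in_itv/= leey andbT mule_ge0 ?rearrangement_ge0//.
    by rewrite lee_fin powR_ge0.
  apply: (@le_trans _ _ ((t `^ fine p^-1)%:E * (C * t `^ (- beta))%:E)).
    rewrite -EFinM lee_fin mulrCA ler_peMr ?(ltW C0)//.
    rewrite -powRD; last by apply/implyP => _; exact: lt0r_neq0.
    rewrite -(powRr0 t); apply: ler_powR => //.
    exact: le_trans t01 tt0.
  by apply: lee_wpmul2l; [rewrite lee_fin powR_ge0|exact: h].
have S0 : 0 <= S by apply: integral_ge0 => t; exact: F0.
have Sf : S = (fine S)%:E by rewrite fineK// ge0_fin_numE.
pose s := fine S; have s0 : (0 <= s)%R by exact: fine_ge0.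
have Cr : (0 < C `^ r)%R by rewrite powR_gt0.
pose L := ((s + 1) / C `^ r)%R.
have L0 : (0 < L)%R by rewrite divr_gt0// ltr_wpDl.
(* ln b - ln t0 = L makes the lower bound equal to s + 1 *)
pose b := (t0 * expR L)%R.
have tb : (t0 < b)%R by rewrite ltr_pMr// expR_gt1.
have := lo _ tb; rewrite Sf lee_fin -/s lnM ?posrE ?expR_gt0// expRK.
rewrite addrC addKr mulrC divfK ?gt_eqF// leNgt => /negP; apply.
by rewrite ltrDl.
Qed.

End lorentz_lower.

(** * The Newtonian example *)

Section exhaustion.
Context d (T : measurableType d) {R : realType} (mu : {measure set T -> \bar R}).

Lemma integral_bigcup_le (E : nat -> set T) (F : T -> \bar R) (M : \bar R) :
  nondecreasing_seq E -> (forall j, measurable (E j)) ->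
  measurable_fun setT F -> (forall j x, E j x -> 0 <= F x) ->
  (forall j, \int[mu]_(x in E j) F x <= M) ->
  \int[mu]_(x in \bigcup_j E j) F x <= M.
Proof.
move=> ndE mE mF F0 hM.
have := ge0_nondecreasing_set_cvg_integral ndE mE
  (fun j => measurable_funTS mF) F0 (mu := mu).
move=> cv; rewrite -(cvg_lim _ cv)//; apply: lime_le.
  by apply/cvg_ex; eexists; exact: cv.
exact: nearW.
Qed.

End exhaustion.

Section power_tails.
Context {R : realType}.
Local Notation leb := (@lebesgue_measure R).
Variable F : R -> \bar R.
Hypothesis mF : measurable_fun setT F.
Hypothesis F0 : forall t, (0 < t)%R -> 0 <= F t.

Let le_power (a b e C : R) : (0 < a)%R -> (a < b)%R -> e != 0%R -> (0 <= C)%R ->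
  (forall t, (a <= t <= b)%R -> F t <= (C * t `^ (e - 1))%:E) ->
  \int[leb]_(t in `[a, b]) F t <= (C * (e^-1 * b `^ e - e^-1 * a `^ e))%:E.
Proof.
move=> a0 ab e0 C0 FC.
have mp : measurable_fun setT (fun t : R => (t `^ (e - 1))%:E).
  by apply: measurable_EFinR; exact: measurable_powR.
rewrite EFinM -integral_powR// -ge0_integralZl; last 4 first.
- exact: measurable_itv.
- exact: measurable_funTS.
- by move=> t _; rewrite lee_fin powR_ge0.
- by rewrite lee_fin.
apply: ge0_le_integral.
- exact: measurable_itv.
- by move=> t /=; rewrite in_itv/= => /andP[/(lt_le_trans a0)/F0].
- exact: measurable_funTS.
- by apply: measurable_funTS; exact: measurable_funeM.
- by move=> t /=; rewrite in_itv/= -EFinM => /FC.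
Qed.

Lemma integral_power_near0 (e C : R) : (0 < e)%R -> (0 <= C)%R ->
  (forall t, (0 < t <= 1)%R -> F t <= (C * t `^ (e - 1))%:E) ->
  \int[leb]_(t in `]0%R, 1%R]) F t < +oo.
Proof.
move=> e0 C0 FC; apply: le_lt_trans (ltry (C * e^-1)%R).
pose E (j : nat) : set R := `[(j.+2%:R^-1)%R, 1%R]%classic.
have jp (j : nat) : (0 < j.+2%:R^-1 :> R)%R by rewrite invr_gt0.
rewrite (_ : `]0%R, 1%R]%classic = \bigcup_j E j); last first.
  apply/seteqP; split=> [t|t [j _]]; rewrite /E /= !in_itv/=.
    move=> /andP[t0 t1]; have ti : (0 <= t^-1)%R by rewrite invr_ge0 ltW.
    have := archi_boundP ti; set j := Num.bound _ => hj.
    exists j => //=; rewrite in_itv/= t1 andbT -[leRHS]invrK lef_pV2 ?posrE ?invr_gt0//.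
    by apply: (le_trans (ltW hj)); rewrite ler_nat; apply: leq_trans (leqnSn _).
  by move=> /andP[/(lt_le_trans (jp j)) -> ->].
apply: integral_bigcup_le => //.
- apply/nondecreasing_seqP => j; apply/subsetPset => t; rewrite /E /= !in_itv/=.
  move=> /andP[h ->]; rewrite andbT (le_trans _ h)// lef_pV2 ?posrE// ler_nat//.
- by move=> j; exact: measurable_itv.
- by move=> j t; rewrite /E /= in_itv/= => /andP[/(lt_le_trans (jp j))/F0].
move=> j; apply: le_trans (le_power (jp j) _ (lt0r_neq0 e0) C0 _) _.
- by rewrite invf_lt1// ltr1n.
- by move=> t /andP[/(lt_le_trans (jp j)) t0 t1]; apply: FC; rewrite t0.
rewrite lee_fin ler_wpM2l// powR1 mulr1 gerBl mulr_ge0 ?powR_ge0// invr_ge0 ltW//.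
Qed.

Lemma integral_power_infty (e C : R) : (0 < e)%R -> (0 <= C)%R ->
  (forall t, (1 <= t)%R -> F t <= (C * t `^ (- e - 1))%:E) ->
  \int[leb]_(t in `[1%R, +oo[) F t < +oo.
Proof.
move=> e0 C0 FC; apply: le_lt_trans (ltry (C * e^-1)%R).
pose E (j : nat) : set R := `[1%R, (j.+2%:R)%R]%classic.
rewrite (_ : `[1%R, +oo[%classic = \bigcup_j E j); last first.
  apply/seteqP; split=> [t|t [j _]]; rewrite /E /= !in_itv/= ?andbT.
    move=> t1; have t0 : (0 <= t)%R by apply: le_trans t1.
    have := archi_boundP t0; set j := Num.bound _ => hj.
    exists j => //=; rewrite in_itv/= t1/=.
    by apply: (le_trans (ltW hj)); rewrite ler_nat; apply: leq_trans (leqnSn _).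
  by move=> /andP[].
apply: integral_bigcup_le => //.
- apply/nondecreasing_seqP => j; apply/subsetPset => t; rewrite /E /= !in_itv/=.
  by move=> /andP[-> h]; rewrite (le_trans h)// ler_nat.
- by move=> j; exact: measurable_itv.
- by move=> j t; rewrite /E /= in_itv/= => /andP[/(lt_le_trans ltr01)/F0].
have en0 : (- e != 0)%R by rewrite oppr_eq0 lt0r_neq0.
move=> j; apply: le_trans (le_power ltr01 _ en0 C0 _) _.
- by rewrite ltr1n.
- by move=> t /andP[t0 t1]; exact: FC.
rewrite lee_fin ler_wpM2l// powR1 mulr1 invrN opprK mulNr gerDr oppr_le0.
by rewrite mulr_ge0 ?powR_ge0// invr_ge0 ltW.
Qed.

End power_tails.

Section example.
Context {R : realType} {k : nat}.
Local Notation N := k.+3.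
Local Notation nd := (@lebesgue_nd R N).
Local Notation bv := (@bvol R N).
Local Notation leb := (@lebesgue_measure R).
Let beta : R := (k.+1%:R / N%:R)%R.
Let b : R := (k.+1%:R / 2)%R.

Definition newton_profile (x : N.-tuple R) : R := newton b (tsq x).
Local Notation u := newton_profile.

Let bE : (2 * b = N%:R - 2)%R.
Proof.
rewrite /b mulrC divfK// -(addn2 k.+1) natrD addrK//.
Qed.

Let b0 : (0 < b)%R. Proof. by rewrite divr_gt0. Qed.

Lemma measurable_newton_profile : measurable_fun setT u.
Proof.
have [m0 _ _] := @measurable_newton R b.
exact: measurableT_comp m0 measurable_tsq.
Qed.

Lemma newton_profile_gt0 x : (0 < u x)%R. Proof. exact: newton_gt0. Qed.

Lemma bavg_newton_le x (r : R) : (0 < r)%R -> bavg r u x <= (u x)%:E.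
Proof.
move=> r0; have [m0 m1 m2] := @measurable_newton R b.
apply: (bavg_le x m0 m1 m2 (is_derive_newton b) (is_derive_newton1 b)
  (@continuous_newton2 R b) r0) => s s0.
have s1 : (0 < 1 + s)%R by rewrite ltr_wpDr.
rewrite lap_newton// oppr_le0 mulr_ge0 ?(ltW (newton_gt0 _ _))//.
by rewrite mulr_ge0 ?sqr_ge0// mulr_ge0// mulr_ge0// ltW.
Qed.

Lemma bump_ratio_le n (r : R) : (0 < r)%R -> (bump_ratio n r <= r ^+ 2 / 4)%R.
Proof.
move=> r0; have V0 : (0 < @bvol R n.+1 * r ^+ n.+1)%R.
  by rewrite mulr_gt0 ?bvol_gt0 ?exprn_gt0.
rewrite /bump_ratio; set V := (bvol * _)%R in V0 *.
rewrite ler_pdivrMr; last exact: mulr_gt0.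
rewrite (_ : (r ^+ 2 / 4 * (4 * V) = r ^+ 2 * V)%R); last by field.
rewrite (_ : V = fine (@lebesgue_nd R n.+1 (eball r))); last by rewrite measure_eball.
rewrite -(@Rintegral_cst _ _ _ (@lebesgue_nd R n.+1) _ (measurable_eball r) (r ^+ 2)%R).
apply: le_Rintegral.
- exact: measurable_eball.
- exact: integrable_bump.
- apply: (@integrable_eball _ _ r (r ^+ 2)%R) => //.
  by move=> y _; rewrite ger0_norm// sqr_ge0.
- by move=> y _; rewrite gerBl tsq_ge0.
Qed.

(** The Laplacian is bounded below, so the averages tend to the value of the
    function as r tends to 0; this gives the lower bound for the maximal
    function. *)
Lemma bavg_newton_ge x (r : R) : (0 < r)%R ->
  (u x)%:E <= bavg r u x + (b * N%:R * r ^+ 2)%:E.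
Proof.
move=> r0; have [m0 m1 m2] := @measurable_newton R b.
have := @bavg_ge R _ _ _ m0 m1 m2 (is_derive_newton b) (is_derive_newton1 b)
  (@continuous_newton2 R b) k.+2 x r (2 * b * N%:R)%R r0.
move=> h; apply: le_trans (h _) _.
  move=> z _; have s0 := tsq_ge0 z.
  have s1 : (1 <= 1 + tsq z)%R by rewrite lerDl.
  have i1 : ((1 + tsq z)^-1 <= 1)%R by rewrite invf_le1// (lt_le_trans _ s1).
  have i0 : (0 <= (1 + tsq z)^-1)%R by rewrite invr_ge0 (le_trans _ s1).
  rewrite lap_newton// lerN2 -mulrA ler_piMr//.
    by rewrite mulr_ge0// mulr_ge0// ltW.
  rewrite mulr_ile1 ?sqr_ge0 ?(ltW (newton_gt0 _ _))//.
    by rewrite expr_le1.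
  by rewrite newton_le1// ltW.
apply: leeD2l; rewrite lee_fin.
have := bump_ratio_le k.+2 r0.
have bN : (0 <= 2 * b * N%:R)%R by rewrite mulr_ge0// mulr_ge0// ltW.
move=> /(ler_wpM2l bN) /le_trans; apply.
have := mulr_ge0 bN (sqr_ge0 r); lra.
Qed.

Lemma maximal_newton x : maximal u x = (u x)%:E.
Proof.
have E (r : R) : ((lebesgue_nd (@eball R N r))^-1 *
    \int[@lebesgue_nd R N]_(y in eball r) `|u (tsub x y)|%:E)%E = bavg r u x.
  rewrite /bavg; congr (_ * _); apply: eq_integral => y _.
  by rewrite ger0_norm// ltW// newton_profile_gt0.
apply/eqP; rewrite eq_le; apply/andP; split.
  apply: ge_ereal_sup => _ [r + <-]; rewrite /= in_itv/= andbT => r0.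
  by rewrite E; exact: bavg_newton_le.
apply/lee_addgt0Pr => e e0.
pose c : R := (b * N%:R)%R.
have c0 : (0 < c)%R by rewrite mulr_gt0.
(* r <= 1 gives r^2 <= r, hence c r^2 <= e *)
pose r := Num.min 1%R (e / c)%R.
have r0 : (0 < r)%R by rewrite lt_min ltr01 divr_gt0.
apply: (le_trans (bavg_newton_ge x r0)); apply: leeD.
  by rewrite -E; apply: ereal_sup_ubound; exists r => //=; rewrite in_itv/= r0.
rewrite lee_fin -/c.
have r1 : (r <= 1)%R by rewrite ge_min lexx.
have re : (r <= e / c)%R by rewrite ge_min lexx orbT.
rewrite mulrC -ler_pdivlMr//; apply: le_trans re.
by rewrite expr2 ler_piMr// ltW.
Qed.

Lemma newton_not_constant : ~ ae_constant u.
Proof.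
move=> [c hc].
have [x x1 ux] := ae_exists (measurable_eball 1)
  (proj1 (andP (@eball1_bounds R N))) hc.
have m32 : measurable (@eball R N 3 `\` eball 2).
  by apply: measurableD; exact: measurable_eball.
have p32 : 0 < nd (eball 3 `\` eball 2).
  have two0 : (0 < 2 :> R)%R by [].
  have l23 : (2 <= 3 :> R)%R by rewrite ler_nat.
  rewrite (shell_measure two0 l23) lte_fin mulr_gt0 ?bvol_gt0// subr_gt0.
  by rewrite ltr_pXn2r ?nnegrE// ltr_nat.
have [y [_ y2] uy] := ae_exists m32 p32 hc.
have {}y2 : (2 <= tnorm y)%R by rewrite leNgt; apply/negP.
have : (u y < u x)%R.
  rewrite /newton_profile /newton ltr_expR !mulNr ltrN2 ltr_pM2l//.
  have p1 (z : N.-tuple R) : ((1 + tsq z)%R \is Num.pos).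
    by rewrite posrE ltr_wpDr ?tsq_ge0.
  rewrite ltr_ln ?p1// ltrD2l -!tnorm_sqr.
  rewrite ltr_pXn2r ?nnegrE ?tnorm_ge0//.
  by move: x1; rewrite eballE => /lt_le_trans; apply; apply: le_trans y2; rewrite ler1n.
by rewrite ux uy ltxx.
Qed.

(** The function decreases with |x|, so its values above the one at radius rho are
    taken inside the ball of radius rho, chosen to have volume t. *)
Lemma rearrangement_newton (t : R) : (0 < t)%R ->
  rearrangement nd u t <= 1 /\
  rearrangement nd u t <= ((bv^-1) `^ (- beta) * t `^ (- beta))%:E.
Proof.
move=> t0; have bv0 := @bvol_gt0 R N.
pose rho := ((t / bv) `^ (N%:R^-1))%R.
have q0 : (0 < t / bv)%R by rewrite divr_gt0.
have rho0 : (0 < rho)%R by rewrite powR_gt0.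
have rhoN : (rho ^+ N = t / bv)%R by exact: powR_inv_nat.
have df : distribution_function nd u (newton b (rho ^+ 2)) <= t%:E.
  apply: (@le_trans _ _ (nd (eball rho))); last first.
    by rewrite measure_eball// rhoN mulrC divfK// gt_eqF.
  apply: le_measure; rewrite ?inE.
  - exact: measurable_superlevel measurable_newton_profile _.
  - exact: measurable_eball.
  move=> x /=; rewrite ger0_norm ?(ltW (newton_profile_gt0 _))// => h.
  rewrite -/(eball rho x) eballE ltNge; apply/negP => xr.
  move: h; rewrite ltNge => /negP; apply.
  apply: newton_anti; first exact: ltW.
  by rewrite sqr_ge0 -tnorm_sqr ler_pXn2r ?nnegrE ?tnorm_ge0// ltW.
have re : rearrangement nd u t <= (newton b (rho ^+ 2))%:E.
  apply: ereal_inf_lbound; exists (newton b (rho ^+ 2)) => //.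
  by split => //; exact: ltW (newton_gt0 _ _).
split; first by apply: (le_trans re); rewrite lee_fin newton_le1 ?sqr_ge0// ltW.
apply: (le_trans re); rewrite lee_fin -powRM ?(ltW t0) ?invr_ge0 ?(ltW bv0)//.
rewrite [X in (X `^ _)%R]mulrC.
apply: (@le_trans _ _ (expR (- b * ln (rho ^+ 2)))).
  rewrite ler_expR !mulNr lerN2 ler_pM2l// ler_ln ?posrE ?exprn_gt0//.
    by rewrite lerDr.
  by rewrite ltr_wpDr ?sqr_ge0.
rewrite /powR gt_eqF// ler_expR lnXn// /rho ln_powR.
rewrite le_eqVlt; apply/orP; left; apply/eqP.
rewrite /beta /b -mulr_natl; field.
by rewrite -(natrD _ 3 k) pnatr_eq0.
Qed.

Lemma newton_lorentz_weak (p : \bar R) : (0 <= fine p^-1 <= beta)%R ->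
  in_lorentz p +oo u.
Proof.
move=> /andP[p0 pb]; split; first exact: measurable_newton_profile.
pose C : R := ((bv^-1) `^ (- beta))%R.
apply: (@le_lt_trans _ _ (1 + C)%:E); last exact: ltry.
have C0 : (0 <= C)%R by exact: powR_ge0.
apply: ge_ereal_sup => _ [t + <-]; rewrite /= in_itv/= andbT => t0.
have [h1 h2] := rearrangement_newton t0.
have tp0 : 0 <= (t `^ fine p^-1)%:E by rewrite lee_fin powR_ge0.
have [t1|t1] := leP t 1%R.
  apply: (le_trans (lee_wpmul2l tp0 h1)).
  rewrite mule1 lee_fin (@le_trans _ _ 1%R)// ?lerDl//.
  apply: (@le_trans _ _ (1 `^ fine p^-1)%R); last by rewrite powR1.
  by apply: ge0_ler_powR; rewrite ?nnegrE// ltW.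
apply: (le_trans (lee_wpmul2l tp0 h2)).
rewrite -EFinM lee_fin mulrCA -/C.
apply: (@le_trans _ _ C); last by rewrite lerDr.
rewrite ler_piMr// -powRD; last by apply/implyP => _; exact: lt0r_neq0.
rewrite -[leRHS](powRr0 t); apply: ler_powR; first exact: ltW.
by rewrite subr_le0.
Qed.

(** With e = 1 / p, the integrand is at most t^(r e - 1) near 0 and a multiple of
    t^(- r (beta - e) - 1) near infinity. *)
Lemma newton_lorentz_strong (p : \bar R) (r : R) : (1 <= r)%R ->
  (0 < fine p^-1 < beta)%R -> in_lorentz p r%:E u.
Proof.
move=> r1 /andP[p0 pb]; split; first exact: measurable_newton_profile.
have r0 : (0 < r)%R by apply: lt_le_trans r1.
pose e := fine p^-1.
pose C : R := ((bv^-1) `^ (- beta))%R.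
have C0 : (0 <= C)%R by exact: powR_ge0.
pose F t := (((t `^ e)%:E * rearrangement nd u t) `^ r * (t^-1)%:E).
have mF : measurable_fun setT F.
  apply: emeasurable_funM.
    apply: (measurableT_comp (measurable_poweR r)).
    apply: emeasurable_funM; last exact: measurable_rearrangement measurable_newton_profile.
    by apply: measurable_EFinR; exact: measurable_powR.
  by apply: measurable_EFinR; exact: measurable_inv.
have F0 t : (0 < t)%R -> 0 <= F t.
  move=> tp; apply: mule_ge0; first exact: poweR_ge0.
  by rewrite lee_fin invr_ge0 ltW.
have Fle t (A B : R) : (0 < t)%R -> (0 <= B)%R ->
    rearrangement nd u t <= (B * t `^ A)%:E ->
    F t <= (B `^ r * t `^ (r * (e + A) - 1))%:E.
  move=> t0 B0 h.
  have ti : 0 <= (t^-1)%:E by rewrite lee_fin invr_ge0 ltW.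
  have X0 : 0 <= (t `^ e)%:E * rearrangement nd u t.
    by rewrite mule_ge0 ?rearrangement_ge0// lee_fin powR_ge0.
  apply: (@le_trans _ _ ((B * t `^ (e + A))%:E `^ r * (t^-1)%:E)).
    apply: lee_wpmul2r => //; apply: gt0_ler_poweR; first exact: ltW.
    - by rewrite in_itv/= leey X0.
    - by rewrite in_itv/= leey lee_fin mulr_ge0 ?powR_ge0.
    apply: (@le_trans _ _ ((t `^ e)%:E * (B * t `^ A)%:E)).
      by apply: lee_wpmul2l; rewrite ?lee_fin ?powR_ge0.
    rewrite -EFinM lee_fin mulrCA powRD//.
    by apply/implyP => _; exact: lt0r_neq0.
  rewrite poweR_EFin -EFinM lee_fin powRM ?powR_ge0// -mulrA.
  rewrite -powRrM [((e + A) * r)%R]mulrC.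
  rewrite powRB; last by apply/implyP => _; exact: lt0r_neq0.
  by rewrite powRr1// ltW.
have re0 : (0 < r * e)%R by rewrite mulr_gt0.
have g0 : (0 < r * (beta - e))%R by rewrite mulr_gt0// subr_gt0.
have I1 : \int[leb]_(t in `]0%R, 1%R]) F t < +oo.
  apply: (integral_power_near0 mF F0 re0 ler01) => t /andP[t0 t1].
  have [h1 _] := rearrangement_newton t0.
  have := @Fle t 0%R 1%R t0 ler01.
  by rewrite powRr0 mulr1 powR1 addr0; apply.
have I2 : \int[leb]_(t in `[1%R, +oo[) F t < +oo.
  apply: (@integral_power_infty _ _ mF F0 _ (C `^ r)%R g0 (powR_ge0 _ _)) => t t1.
  have t0 : (0 < t)%R by apply: lt_le_trans t1.
  have [_ h2] := rearrangement_newton t0.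
  have := @Fle t (- beta)%R C t0 C0 h2.
  by rewrite (_ : (r * (e + - beta) = - (r * (beta - e)))%R)//; ring.
rewrite -/(F _) (_ : `]0%R, +oo[%classic =
  `]0%R, 1%R]%classic `|` `]1%R, +oo[%classic :> set R); last first.
  apply/seteqP; split => t /=; rewrite !in_itv/= !andbT.
    by move=> ->; have [t1|t1] := leP t 1%R; [left|right].
  by move=> [/andP[]//|]; exact: lt_trans.
rewrite ge0_integral_setU.
- apply: lte_add_pinfty; first exact: I1.
  apply: le_lt_trans I2; apply: ge0_subset_integral.
  + exact: measurable_itv.
  + exact: measurable_itv.
  + exact: measurable_funTS.
  + by move=> t /=; rewrite in_itv/= andbT => t1; apply: F0; apply: lt_le_trans t1.
  + by move=> t /=; rewrite !in_itv/= !andbT => /ltW.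
- exact: measurable_itv.
- exact: measurable_itv.
- exact: measurable_funTS.
- move=> t /=; rewrite !in_itv/= !andbT => -[/andP[/F0]//|t1].
  by apply: F0; apply: lt_trans t1.
- apply/disj_setPS => t [] /=; rewrite !in_itv/= !andbT => /andP[_ t1] t2.
  by move: (lt_le_trans t2 t1); rewrite ltxx.
Qed.

End example.

(** * Fixed points of the maximal operator *)

Section maximal_fixed_point.
Context {R : realType} {n : nat}.
Local Notation nd := (@lebesgue_nd R n).
Variable f : n.-tuple R -> R.
Hypothesis fixf : {ae nd, forall x, maximal f x = (f x)%:E}.

Lemma maximal_fixed_supersol :
  {ae nd, forall x, supersol (fun x => `|f x|%R) x /\ f x = `|f x|%R}.
Proof.
apply: filterS fixf => x fx.
have bavg_le (r : R) : (0 < r)%R -> bavg r (fun x => `|f x|%R) x <= (f x)%:E.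
  move=> r0; rewrite -fx; apply: ereal_sup_ubound; exists r => //=.
  by rewrite in_itv/= r0.
have f0 : (0 <= f x)%R.
  rewrite -lee_fin; apply: le_trans (bavg_le 1%R ltr01).
  by apply: bavg_ge0 => // y; exact: normr_ge0.
split; last by rewrite ger0_norm.
by move=> r r0; rewrite ger0_norm//; exact: bavg_le.
Qed.

End maximal_fixed_point.

Lemma maximal_fixed_constant {R : realType} n (f : n.+1.-tuple R -> R) :
  (n.+1 <= 2)%N -> measurable_fun setT f ->
  {ae @lebesgue_nd R n.+1, forall x, maximal f x = (f x)%:E} -> ae_constant f.
Proof.
move=> n2 mf fixf; have sup := maximal_fixed_supersol fixf.
have mg : measurable_fun setT (fun x => `|f x|%R) by exact: measurableT_comp.
have hs : {ae @lebesgue_nd R n.+1, forall x, supersol (fun x => `|f x|%R) x}.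
  by apply: filterS sup => x [].
have [c hc] := supersol_constant n2 mg (fun x => normr_ge0 (f x)) hs.
by exists c; apply: filterS2 sup hc => x [_ fx] gx; rewrite fx.
Qed.

Lemma maximal_fixed_lower_bound {R : realType} k (f : k.+3.-tuple R -> R) :
  measurable_fun setT f -> ~ ae_constant f ->
  {ae @lebesgue_nd R k.+3, forall x, maximal f x = (f x)%:E} ->
  exists2 c : R, (0 < c)%R & {ae @lebesgue_nd R k.+3, forall x,
    (6 <= tnorm x)%R -> (c * tnorm x ^+ 2 <= `|f x| * tnorm x ^+ k.+3)%R}.
Proof.
move=> mf ncf fixf; have sup := maximal_fixed_supersol fixf.
have mg : measurable_fun setT (fun x => `|f x|%R) by exact: measurableT_comp.
have hs : {ae @lebesgue_nd R k.+3, forall x, supersol (fun x => `|f x|%R) x}.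
  by apply: filterS sup => x [].
apply: (@supersol_lower_bound R k.+2 isT _ mg (fun x => normr_ge0 (f x)) hs).
move=> f0; apply: ncf; exists 0%R.
by apply: filterS2 sup f0 => x [_ fx] gx; rewrite fx.
Qed.

Theorem corollary3p7 (R : realType) (n : nat) (p q : \bar R)
    (n_ge1 : (1 <= n)%N) (p_ge1 : 1 <= p) (q_ge1 : 1 <= q)
    (p_eq1 : p = 1 -> q = 1) (p_eqy : p = +oo -> q = +oo) :
  (exists f : n.-tuple R -> R,
     [/\ in_lorentz p q f,
         ~ ae_constant f &
         {ae @lebesgue_nd R n, forall x, maximal f x = (f x)%:E}])
  <->
  ((3 <= n)%N /\
   ((n%:R / (n%:R - 2))%:E < p <= +oo \/
    p = (n%:R / (n%:R - 2))%:E /\ q = +oo)).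
Proof.
have thr k : (k.+3%:R / (k.+3%:R - 2) = (k.+1%:R / k.+3%:R)^-1 :> R)%R.
  by rewrite invf_div -(addn2 k.+1) [in X in (_ / X = _)%R]natrD addrK.
have b0 k : (0 < k.+1%:R / k.+3%:R :> R)%R by rewrite divr_gt0.
split.
- move=> [f [lf ncf fixf]].
  have mf : measurable_fun setT f by case: lf.
  case: n n_ge1 f lf ncf fixf mf => // m _ f lf ncf fixf mf.
  have [m2|m2] := leqP m.+1 2; first by case: ncf; exact: maximal_fixed_constant.
  split => //.
  case: m m2 f lf ncf fixf mf => [|[|k]]// _ f lf ncf fixf mf.
  have [c c0 lowf] := maximal_fixed_lower_bound mf ncf fixf.
  have nweak := not_lorentz_weak mf c0 lowf.
  have nstrong := not_lorentz_strong mf c0 lowf.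
  rewrite thr; case: p p_ge1 p_eq1 p_eqy lf => [a| |]// a1 _ _ lf; last first.
    by left; rewrite ltry lexx.
  rewrite lee_fin in a1; have a0 : (0 < a)%R by apply: lt_le_trans a1.
  have ai : fine (a%:E)^-1 = a^-1%R by rewrite inver gt_eqF.
  have [Ta|aT|aE] := ltgtP (k.+1%:R / k.+3%:R)^-1%R a.
  + by left; rewrite lte_fin Ta leey.
  + have ba : (k.+1%:R / k.+3%:R < fine (a%:E)^-1)%R.
      by rewrite ai -[ltLHS]invrK ltf_pV2 ?posrE ?invr_gt0.
    case: q q_ge1 lf => [r| |]// r1 lf.
      by case: (nstrong a%:E r r1 (ltW ba)).
    by case: (nweak a%:E ba).
  + case: q q_ge1 lf => [r| |]// r1 lf; last by right; rewrite -aE.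
    by case: (nstrong a%:E r r1) => //; rewrite ai -aE invrK.
- case=> n3 hp; case: n n3 hp {n_ge1} => [|[|[|k]]]// _ hp.
  exists (@newton_profile R k); split; last 2 first.
  + exact: newton_not_constant.
  + by apply: aeW => x; exact: maximal_newton.
  rewrite thr in hp.
  case: p p_ge1 p_eq1 p_eqy hp => [a| |]// a1 _ poo hp; last first.
    by rewrite poo//; apply: newton_lorentz_weak; rewrite invey/= lexx ltW.
  rewrite lee_fin in a1; have a0 : (0 < a)%R by apply: lt_le_trans a1.
  have ai : fine (a%:E)^-1 = a^-1%R by rewrite inver gt_eqF.
  case: hp => [/andP[+ _]|[[->] ->]]; last first.
    apply: newton_lorentz_weak; rewrite inver gt_eqF ?invr_gt0//=.
    by rewrite invrK lexx ltW.
  rewrite lte_fin => Ta.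
  have ba : (a^-1 < k.+1%:R / k.+3%:R)%R.
    by rewrite -[ltRHS]invrK ltf_pV2 ?posrE ?invr_gt0.
  case: q q_ge1 {poo} => [r| |]// r1.
    by apply: newton_lorentz_strong => //; rewrite ai invr_gt0 a0.
  by apply: newton_lorentz_weak; rewrite ai ltW ?invr_gt0//= ltW.
Qed.
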